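(* Let $E=A\#_fH$ be a crossed product and $M$ an $E$-bimodule. The filtration $F_0\supseteq F_1\supseteq F_2\supseteq\cdots$ of the cochain complex $\widehat X^*(E,M)$ (defined in the context) given by $F_i(\widehat X^n)=\bigoplus_{s\ge i}\mathrm{Hom}_k(\overline H^s\otimes\overline A^{n-s},M)$ yields a convergent spectral sequence $$E_1^{rs}=H^r(A,\mathrm{Hom}_k(\overline H^s,M))\ \Rightarrow\ H^{r+s}(E,M),$$ where $\mathrm{Hom}_k(\overline H^s,M)$ is considered as an $A$-bimodule via $(a_1\varphi a_2)(\mathbf h)=a_1^{\overline{\mathbf h^{(1)}}}\varphi(\mathbf h^{(2)})a_2$.
   Context: $k$ is a commutative ring with unit, $\otimes=\otimes_k$, $H$ is a Hopf algebra with counit $\epsilon$ and Sweedler notation $\Delta(h)=h^{(1)}\otimes h^{(2)}$ (sum understood), $A$ is a $k$-algebra. A weak action of $H$ on $A$ is a bilinear map $(h,a)\mapsto a^h$, $H\times A\to A$, with $(ab)^h=a^{h^{(1)}}b^{h^{(2)}}$, $1^h=\epsilon(h)1$, $a^1=a$. Given a weak action and a $k$-linear map $f:H\otimes H\to A$, $A\#_fH$ is $A\otimes H$ (elements written $a\#h$) with product $(a\#h)(b\#l)=ab^{h^{(1)}}f(h^{(2)},l^{(1)})\#h^{(3)}l^{(2)}$; it is called a crossed product if it is associative with unit $1\#1$, equivalently: $f(h,1)=f(1,h)=\epsilon(h)1_A$; $f(l^{(1)},m^{(1)})^{h^{(1)}}f(h^{(2)},l^{(2)}m^{(2)})=f(h^{(1)},l^{(1)})f(h^{(2)}l^{(2)},m)$;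 and $(a^{l^{(1)}})^{h^{(1)}}f(h^{(2)},l^{(2)})=f(h^{(1)},l^{(1)})a^{h^{(2)}l^{(2)}}$ for all $h,l,m\in H$, $a\in A$. $A$ is regarded as the subalgebra $A\#1$ of $E$. Notation: $\overline B=B/k$ (classes denoted by the same letter), $\overline B^l$ its $l$-fold tensor power. $\mathbf h_{ij}=h_i\otimes\cdots\otimes h_j$, $\mathfrak h_{ij}=h_i\cdots h_j\in H$, $\mathbf a_{ij}=a_i\otimes\cdots\otimes a_j$ (empty tensors are $1_k$). For $\mathbf h=h_i\otimes\cdots\otimes h_j$: $\mathbf h^{(1)}\otimes\mathbf h^{(2)}=(h_i^{(1)}\otimes\cdots\otimes h_j^{(1)})\otimes(h_i^{(2)}\otimes\cdots\otimes h_j^{(2)})$; $a^{\overline{\mathbf h}}=(\cdots((a^{h_j})^{h_{j-1}})\cdots)^{h_i}$ for $a\in A$; and for $\mathbf a=a_1\otimes\cdots\otimes a_r$, $\mathbf a^{\overline{\mathbf h}}=a_1^{\overline{\mathbf h^{(1)}}}\otimes\cdots\otimes a_r^{\overline{\mathbf h^{(r)}}}$; for a single $h\in H$, $\mathbf a^h=a_1^{h^{(1)}}\otimes\cdots\otimes a_r^{h^{(r)}}$. The maps $F^{(l)}_r$ ($l\ge2$, $r\ge0$), $F^{(l)}_r:\overline H^l\otimes\overline A^r\to\overline A^{r+l-1}$. For $r=0$: $F^{(2)}_0(h_1\otimes h_2)=-f(h_1,h_2)$ and $F^{(l+1)}_0(\mathbf h)=\sum_{j=1}^l(-1)^jf(h_j^{(1)},h_{j+1}^{(1)})^{\overline{\mathbf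 h_{1,j-1}^{(1)}}}\otimes F^{(l)}_0(\mathbf h_{1,j-1}^{(2)}\otimes h_j^{(2)}h_{j+1}^{(2)}\otimes\mathbf h_{j+2,l+1})$. For $r\ge1$: $F^{(2)}_r(\mathbf h\otimes\mathbf a)=\sum_{i=0}^r(-1)^{i+1}\mathbf a_{1i}^{\overline{\mathbf h_{12}^{(1)}}}\otimes f(h_1^{(2)},h_2^{(2)})\otimes\mathbf a_{i+1,r}^{\mathfrak h_{12}^{(3)}}$ and $F^{(l+1)}_r(\mathbf h\otimes\mathbf a)=\sum_{j=1}^l\sum_{i=0}^r(-1)^{il+j}\mathbf a_{1i}^{\overline{\mathbf h_{1,l+1}^{(1)}}}\otimes f(h_j^{(2)},h_{j+1}^{(2)})^{\overline{\mathbf h_{1,j-1}^{(2)}}}\otimes F^{(l)}_{r-i}\big((\mathbf h_{1,j-1}^{(3)}\otimes h_j^{(3)}h_{j+1}^{(3)}\otimes\mathbf h_{j+2,l+1}^{(2)})\otimes\mathbf a_{i+1,r}\big)$. The complex $\widehat X^*(E,M)$: $\widehat X^n=\bigoplus_{r+s=n}\mathrm{Hom}_k(\overline H^s\otimes\overline A^r,M)$ with differential $\widehat d^{\,n}=\sum_{r+s=n}\sum_{0\le l\le s,\,r+l>0}\widehat d^{\,rs}_l$, where $\widehat d^{\,rs}_l:\mathrm{Hom}_k(\overline H^{s-l}\otimes\overline A^{r+l-1},M)\to\mathrm{Hom}_k(\overline H^s\otimes\overline A^r,M)$ is, for $\mathbf x=\mathbf h\otimes\mathbf a$, $\mathbf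 h=h_1\otimes\cdots\otimes h_s$, $\mathbf a=a_1\otimes\cdots\otimes a_r$, $\widehat d^{\,rs}_0(\varphi)(\mathbf x)=a_1^{\overline{\mathbf h^{(1)}}}\varphi(\mathbf h^{(2)}\otimes\mathbf a_{2r})+(-1)^r\varphi(\mathbf h\otimes\mathbf a_{1,r-1})a_r+\sum_{i=1}^{r-1}(-1)^i\varphi(\mathbf h\otimes\mathbf a_{1,i-1}\otimes a_ia_{i+1}\otimes\mathbf a_{i+2,r})$; $\widehat d^{\,rs}_1(\varphi)(\mathbf x)=(-1)^r(1\#h_1)\varphi(\mathbf h_{2s}\otimes\mathbf a)+(-1)^{r+s}\varphi(\mathbf h_{1,s-1}\otimes\mathbf a^{h_s^{(1)}})(1\#h_s^{(2)})+\sum_{i=1}^{s-1}(-1)^{r+i}f(h_i^{(1)},h_{i+1}^{(1)})^{\overline{\mathbf h_{1,i-1}^{(1)}}}\varphi(\mathbf h_{1,i-1}^{(2)}\otimes h_i^{(2)}h_{i+1}^{(2)}\otimes\mathbf h_{i+2,s}\otimes\mathbf a)$; for $l\ge2$: $\widehat d^{\,rs}_l(\varphi)(\mathbf x)=(-1)^{l(r+s)}\varphi\big(\mathbf h_{1,s-l}\otimes F^{(l)}_r(\mathbf h_{s-l+1,s}^{(1)}\otimes\mathbf a)\big)(1\#\mathfrak h_{s-l+1,s}^{(2)})$. For a $k$-algebra $B$ and a $B$-bimodule $N$, $H^*(B,N)$ is Hochschild cohomology, the cohomology of the normalized Hochschild complex $(\mathrm{Hom}_k(\overline B^*,N),b^*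 )$. Here $s$ is the filtration degree and $r$ the complementary degree. *)

(* Defs.v *)
From HB Require Import structures.
From mathcomp Require Import all_boot all_algebra.
From mathcomp Require Import all_classical.

Set Implicit Arguments.
Unset Strict Implicit.
Unset Printing Implicit Defensive.

Import GRing.Theory.
Local Open Scope ring_scope.
Local Open Scope quotient_scope.

Section LinearMaps.
Context (k : comPzRingType) (U V : lmodType k).

HB.instance Definition _ := gen_eqMixin {linear U -> V}.
HB.instance Definition _ := gen_choiceMixin {linear U -> V}.

Lemma linear_ext (f g : {linear U -> V}) : f =1 g -> f = g.
Proof.
case: f g => [f cf] [g cg] /= /funext fg; case: _ / fg cg => cg; congr GRing.Linear.Pack.
case: cf cg => [[fD] [fZ]] [[gD] [gZ]].
by rewrite (Prop_irrelevance fD gD) (Prop_irrelevance fZ gZ).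
Qed.

Definition lin_add (f g : {linear U -> V}) : {linear U -> V} := f \+ g.
Definition lin_opp (f : {linear U -> V}) : {linear U -> V} := \- f.
Definition lin_scale (c : k) (f : {linear U -> V}) : {linear U -> V} := c \*: f.
Definition lin_zero : {linear U -> V} := \0.

Fact lin_addA : associative lin_add.
Proof. by move=> f g h; apply: linear_ext => x /=; rewrite addrA. Qed.
Fact lin_addC : commutative lin_add.
Proof. by move=> f g; apply: linear_ext => x /=; rewrite addrC. Qed.
Fact lin_add0 : left_id lin_zero lin_add.
Proof. by move=> f; apply: linear_ext => x /=; rewrite add0r. Qed.
Fact lin_addN : left_inverse lin_zero lin_opp lin_add.
Proof. by move=> f; apply: linear_ext => x /=; rewrite addNr. Qed.
HB.instance Definition _ :=
  GRing.isZmodule.Build {linear U -> V} lin_addA lin_addC lin_add0 lin_addN.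

Fact lin_scaleA a b f : lin_scale a (lin_scale b f) = lin_scale (a * b) f.
Proof. by apply: linear_ext => x /=; rewrite scalerA. Qed.
Fact lin_scale1 : left_id 1 lin_scale.
Proof. by move=> f; apply: linear_ext => x /=; rewrite scale1r. Qed.
Fact lin_scaleDr : right_distributive lin_scale +%R.
Proof. by move=> a f g; apply: linear_ext => x /=; rewrite scalerDr. Qed.
Fact lin_scaleDl f : {morph lin_scale^~ f : a b / a + b}.
Proof. by move=> a b; apply: linear_ext => x /=; rewrite scalerDl. Qed.
HB.instance Definition _ := GRing.Zmodule_isLmodule.Build k {linear U -> V}
  lin_scaleA lin_scale1 lin_scaleDr lin_scaleDl.

End LinearMaps.

Record submod (k : comPzRingType) (V : lmodType k) := Submod {
  in_submod :> V -> Prop;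
  submod0 : in_submod 0;
  submodL : forall c x y, in_submod x -> in_submod y -> in_submod (c *: x + y)
}.

Section SubQuot.
Context (k : comPzRingType) (V : lmodType k).
Implicit Types (W : submod V).

Lemma submodD W x y : W x -> W y -> W (x + y).
Proof. by move=> Wx Wy; rewrite -[x]scale1r; apply: submodL. Qed.
Lemma submodZ W c x : W x -> W (c *: x).
Proof. by move=> Wx; rewrite -[_ *: _]addr0; apply: submodL => //; apply: submod0. Qed.
Lemma submodN W x : W x -> W (- x).
Proof. by move=> Wx; rewrite -scaleN1r; apply: submodZ. Qed.
Lemma submodB W x y : W x -> W y -> W (x - y).
Proof. by move=> Wx Wy; apply/submodD/submodN. Qed.

Definition submod_pred W : pred V := fun x => `[<W x>].
Fact submod_pred_closed W : submod_closed (submod_pred W).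
Proof.
split=> [|c x y]; rewrite !unfold_in; first exact/asboolP/submod0.
by move=> /asboolP Wx /asboolP Wy; apply/asboolP/submodL.
Qed.
HB.instance Definition _ W :=
  GRing.isSubmodClosed.Build k V (submod_pred W) (submod_pred_closed W).

Definition sub_of W := {x : V | submod_pred W x}.
HB.instance Definition _ W := [isSub of sub_of W for @sval _ _].
HB.instance Definition _ W := [Choice of sub_of W by <:].
HB.instance Definition _ W := [SubChoice_isSubLmodule of sub_of W by <:].

Definition quot_equiv W (x y : V) := `[<W (x - y)>].
Fact quot_equiv_class W : equiv_class_of (quot_equiv W).
Proof.
split=> [x|x y|y x z].
- by apply/asboolP; rewrite subrr; apply: submod0.
- by apply/asboolP/asboolP => /submodN; rewrite opprB.
- move=> /asboolP xy /asboolP yz; apply/asboolP.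
  by rewrite -[x](subrK y) -addrA; apply: submodD.
Qed.
Canonical quot_equivRel W := EquivRelPack (quot_equiv_class W).
Canonical quot_encModRel W := defaultEncModRel (quot_equiv W).

Definition quot W := {eq_quot (quot_equiv W)}.
HB.instance Definition _ W := EqQuotient.on (quot W).
HB.instance Definition _ W := Choice.on (quot W).

Definition qclass W (x : V) : quot W := \pi x.
Lemma qclass_eq W x y : qclass W x = qclass W y <-> W (x - y).
Proof. by split=> [/eqmodP/asboolP|Wxy] //; apply/eqmodP/asboolP. Qed.
Lemma qclass_surj W (q : quot W) : exists x, q = qclass W x.
Proof. by exists (repr q); rewrite /qclass reprK. Qed.
Lemma quot_reprK W (q : quot W) : qclass W (repr q) = q.
Proof. exact: reprK. Qed.
Lemma quot_repr W x : W (repr (qclass W x) - x).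
Proof. by apply/qclass_eq; rewrite quot_reprK. Qed.

Definition quot_add W (p q : quot W) := qclass W (repr p + repr q).
Definition quot_opp W (p : quot W) := qclass W (- repr p).
Definition quot_scale W c (p : quot W) := qclass W (c *: repr p).
Lemma qclassD W x y : quot_add (qclass W x) (qclass W y) = qclass W (x + y).
Proof. by apply/qclass_eq; rewrite opprD addrACA; apply/submodD; apply: quot_repr. Qed.
Lemma qclassN W x : quot_opp (qclass W x) = qclass W (- x).
Proof. by apply/qclass_eq; rewrite -opprD; apply/submodN/quot_repr. Qed.
Lemma qclassZ W c x : quot_scale c (qclass W x) = qclass W (c *: x).
Proof. by apply/qclass_eq; rewrite -scalerBr; apply/submodZ/quot_repr. Qed.

Fact quot_addA W : associative (@quot_add W).
Proof.
move=> p q r; case: (qclass_surj p) (qclass_surj q) (qclass_surj r).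
by move=> x -> [y ->] [z ->]; rewrite !qclassD addrA.
Qed.
Fact quot_addC W : commutative (@quot_add W).
Proof. by move=> p q; rewrite /quot_add addrC. Qed.
Fact quot_add0 W : left_id (qclass W 0) (@quot_add W).
Proof. by move=> p; case: (qclass_surj p) => x ->; rewrite qclassD add0r. Qed.
Fact quot_addN W : left_inverse (qclass W 0) (@quot_opp W) (@quot_add W).
Proof. by move=> p; case: (qclass_surj p) => x ->; rewrite qclassN qclassD addNr. Qed.
HB.instance Definition _ W := GRing.isZmodule.Build (quot W)
  (@quot_addA W) (@quot_addC W) (@quot_add0 W) (@quot_addN W).

Let quot_addE W (p q : quot W) : p + q = quot_add p q. Proof. by []. Qed.

Fact quot_scaleA W a b (p : quot W) : quot_scale a (quot_scale b p) = quot_scale (a * b) p.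
Proof. by case: (qclass_surj p) => x ->; rewrite !qclassZ scalerA. Qed.
Fact quot_scale1 W : left_id 1 (@quot_scale W).
Proof. by move=> p; case: (qclass_surj p) => x ->; rewrite qclassZ scale1r. Qed.
Fact quot_scaleDr W : right_distributive (@quot_scale W) +%R.
Proof.
move=> a p q; case: (qclass_surj p) (qclass_surj q) => x -> [y ->].
by rewrite !quot_addE !(qclassD, qclassZ) scalerDr.
Qed.
Fact quot_scaleDl W (p : quot W) : {morph (@quot_scale W)^~ p : a b / a + b}.
Proof.
move=> a b; case: (qclass_surj p) => x ->.
by rewrite !quot_addE !(qclassD, qclassZ) scalerDl.
Qed.
HB.instance Definition _ W := GRing.Zmodule_isLmodule.Build k (quot W)
  (@quot_scaleA W) (@quot_scale1 W) (@quot_scaleDr W) (@quot_scaleDl W).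

Fact qclass_linear W : linear (qclass W).
Proof. by move=> c x y; rewrite -[LHS]qclassD -[X in quot_add X]qclassZ. Qed.
HB.instance Definition _ W :=
  GRing.isLinear.Build k V (quot W) *:%R (qclass W) (@qclass_linear W).

End SubQuot.

(* V (x) W: formal sums of pairs, as lists, modulo the smallest congruence that
   makes the pairs bilinear; (- v, w) gives the opposite. *)
Section Tensor.
Context (k : comPzRingType) (V W : lmodType k).

Inductive tensor_rel : seq (V * W) -> seq (V * W) -> Prop :=
| TRrefl s : tensor_rel s s
| TRsym s t : tensor_rel s t -> tensor_rel t s
| TRtrans s t u : tensor_rel s t -> tensor_rel t u -> tensor_rel s u
| TRcat s s' t t' : tensor_rel s s' -> tensor_rel t t' -> tensor_rel (s ++ t) (s' ++ t')
| TRcatC s t : tensor_rel (s ++ t) (t ++ s)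
| TRaddl v v' w : tensor_rel [:: (v + v', w)] [:: (v, w); (v', w)]
| TRaddr v w w' : tensor_rel [:: (v, w + w')] [:: (v, w); (v, w')]
| TRscale c v w : tensor_rel [:: (c *: v, w)] [:: (v, c *: w)]
| TRzero w : tensor_rel [:: (0, w)] [::].

Definition tensor_equiv s t := `[<tensor_rel s t>].
Fact tensor_equiv_class : equiv_class_of tensor_equiv.
Proof.
split=> [s|s t|t s u]; first exact/asboolP/TRrefl.
- by apply/asboolP/asboolP => /TRsym.
- by move=> /asboolP st /asboolP tu; apply/asboolP/(TRtrans st).
Qed.
Canonical tensor_equivRel := EquivRelPack tensor_equiv_class.
Canonical tensor_encModRel := defaultEncModRel tensor_equiv.

Definition tensor := {eq_quot tensor_equiv}.
HB.instance Definition _ := EqQuotient.on tensor.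
HB.instance Definition _ := Choice.on tensor.

Let cl (s : seq (V * W)) : tensor := \pi s.
Let clE s t : tensor_rel s t -> cl s = cl t.
Proof. by move=> st; apply/eqP; rewrite /cl eqquotE; apply/asboolP. Qed.
Let cl_surj (x : tensor) : exists s, x = cl s.
Proof. by exists (repr x); rewrite /cl reprK. Qed.
Let cl_repr s : tensor_rel (repr (cl s)) s.
Proof.
by apply/asboolP; rewrite -/(tensor_equiv _ _) -(eqquotE tensor) reprK.
Qed.

Let neg s : seq (V * W) := [seq (- p.1, p.2) | p <- s].
Let scl c s : seq (V * W) := [seq (c *: p.1, p.2) | p <- s].
Let cons_rel p s t : tensor_rel s t -> tensor_rel (p :: s) (p :: t).
Proof. exact: (TRcat (TRrefl [:: p])). Qed.
Let scl_rel c s t : tensor_rel s t -> tensor_rel (scl c s) (scl c t).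
Proof.
elim=> {s t} [s|s t _|s t u _ st _|s s' t t' _ ss' _|s t|v v' w|v w w'|a v w|w] /=.
- exact: TRrefl.
- exact: TRsym.
- exact: TRtrans.
- by rewrite /scl !map_cat; apply: TRcat.
- by rewrite /scl !map_cat; apply: TRcatC.
- by rewrite scalerDr; apply: TRaddl.
- exact: TRaddr.
- by rewrite scalerA mulrC -scalerA; apply: TRscale.
- by rewrite scaler0; apply: TRzero.
Qed.
Let negE s : neg s = scl (-1) s.
Proof. by apply: eq_map => p; rewrite scaleN1r. Qed.

Definition tensor_add (x y : tensor) : tensor := cl (repr x ++ repr y).
Definition tensor_opp (x : tensor) : tensor := cl (neg (repr x)).
Definition tensor_scale c (x : tensor) : tensor := cl (scl c (repr x)).

Let addE s t : tensor_add (cl s) (cl t) = cl (s ++ t).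
Proof. by apply: clE; apply: TRcat; apply: cl_repr. Qed.
Let oppE s : tensor_opp (cl s) = cl (neg s).
Proof. by apply: clE; rewrite !negE; apply/scl_rel/cl_repr. Qed.
Let scaleE c s : tensor_scale c (cl s) = cl (scl c s).
Proof. by apply: clE; apply/scl_rel/cl_repr. Qed.

Let scl_add a b s : tensor_rel (scl (a + b) s) (scl a s ++ scl b s).
Proof.
elim: s => [|[v w] s IH] /=; first exact: TRrefl.
apply: TRtrans (_ : tensor_rel _ ([:: (a *: v, w); (b *: v, w)] ++ (scl a s ++ scl b s))) _.
  rewrite -[_ :: scl _ _]cat1s; apply: TRcat IH.
  by rewrite scalerDl; apply: TRaddl.
apply: cons_rel; rewrite -[_ :: scl b s]cat1s catA -cat1s catA.
by apply: TRcat (TRrefl _); apply: TRcatC.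
Qed.
Let scl0 s : tensor_rel (scl 0 s) [::].
Proof.
elim: s => [|[v w] s IH] /=; first exact: TRrefl.
by rewrite scale0r; apply: (TRcat (TRzero w) IH).
Qed.

Fact tensor_addA : associative tensor_add.
Proof.
move=> x y z; case: (cl_surj x) (cl_surj y) (cl_surj z).
by move=> s -> [t ->] [u ->]; rewrite !addE catA.
Qed.
Fact tensor_addC : commutative tensor_add.
Proof.
move=> x y; case: (cl_surj x) (cl_surj y) => s -> [t ->].
by rewrite !addE; apply/clE/TRcatC.
Qed.
Fact tensor_add0 : left_id (cl [::]) tensor_add.
Proof. by move=> x; case: (cl_surj x) => s ->; rewrite addE. Qed.
Fact tensor_addN : left_inverse (cl [::]) tensor_opp tensor_add.
Proof.
move=> x; case: (cl_surj x) => s ->; rewrite oppE addE negE; apply: clE.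
have {2}->: s = scl 1 s by rewrite /scl -[LHS]map_id; apply: eq_map => -[v w]; rewrite scale1r.
by apply: TRtrans (TRsym (scl_add _ _ _)) _; rewrite addNr.
Qed.
HB.instance Definition _ :=
  GRing.isZmodule.Build tensor tensor_addA tensor_addC tensor_add0 tensor_addN.

Let plusE x y : x + y = tensor_add x y. Proof. by []. Qed.

Fact tensor_scaleA a b x : tensor_scale a (tensor_scale b x) = tensor_scale (a * b) x.
Proof.
case: (cl_surj x) => s ->; rewrite !scaleE /scl -map_comp; congr cl.
by apply: eq_map => p; rewrite /= scalerA.
Qed.
Fact tensor_scale1 : left_id 1 tensor_scale.
Proof.
move=> x; case: (cl_surj x) => s ->; rewrite scaleE; congr cl.
by rewrite -[RHS]map_id; apply: eq_map => -[v w]; rewrite scale1r.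
Qed.
Fact tensor_scaleDr : right_distributive tensor_scale +%R.
Proof.
move=> c x y; case: (cl_surj x) (cl_surj y) => s -> [t ->].
by rewrite !plusE addE !scaleE addE /scl map_cat.
Qed.
Fact tensor_scaleDl x : {morph tensor_scale^~ x : a b / a + b}.
Proof.
move=> a b; case: (cl_surj x) => s ->.
by rewrite plusE !scaleE addE; apply/clE/scl_add.
Qed.
HB.instance Definition _ := GRing.Zmodule_isLmodule.Build k tensor
  tensor_scaleA tensor_scale1 tensor_scaleDr tensor_scaleDl.

Definition tpure (v : V) (w : W) : tensor := cl [:: (v, w)].

(* A chosen expression of a tensor as a sum of pure tensors. *)
Definition tensor_terms (x : tensor) : seq (V * W) := repr x.

Lemma tpureDl v v' w : tpure (v + v') w = tpure v w + tpure v' w.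
Proof. by rewrite [RHS]addE; apply/clE/TRaddl. Qed.
Lemma tpureDr v w w' : tpure v (w + w') = tpure v w + tpure v w'.
Proof. by rewrite [RHS]addE; apply/clE/TRaddr. Qed.
Lemma tpureZl c v w : tpure (c *: v) w = c *: tpure v w.
Proof. by rewrite [RHS]scaleE. Qed.
Lemma tpureZr c v w : tpure v (c *: w) = c *: tpure v w.
Proof. by rewrite -tpureZl; apply/clE/TRsym/TRscale. Qed.
Lemma tpure0l w : tpure 0 w = 0.
Proof. by rewrite -(scale0r 0) tpureZl scale0r. Qed.
Lemma tpure0r v : tpure v 0 = 0.
Proof. by rewrite -(scale0r 0) tpureZr scale0r. Qed.

Lemma tensor_termsE x : x = \sum_(p <- tensor_terms x) tpure p.1 p.2.
Proof.
rewrite -[LHS]reprK /tensor_terms; elim: (repr x) => [|[v w] s IH].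
  by rewrite big_nil.
by rewrite big_cons -IH [RHS]addE.
Qed.

Lemma tensor_linear_ext (P : lmodType k) (f g : {linear tensor -> P}) :
  (forall v w, f (tpure v w) = g (tpure v w)) -> f = g.
Proof.
move=> fg; apply: linear_ext => x; rewrite (tensor_termsE x) !linear_sum.
by apply: eq_bigr => p _; apply: fg.
Qed.

Section Lift.
Context (P : lmodType k) (B : {linear V -> {linear W -> P}}).

Definition tensor_lift_fun (x : tensor) : P := \sum_(p <- tensor_terms x) B p.1 p.2.

Let relE s t : tensor_rel s t -> \sum_(p <- s) B p.1 p.2 = \sum_(p <- t) B p.1 p.2.
Proof.
elim=> {s t} [s|s t _|s t u _ st _|s s' t t' _ ss' _|s t|v v' w|v w w'|c v w|w] //.
- by rewrite st.
- by move=> tt'; rewrite !big_cat /= ss' tt'.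
- by rewrite !big_cat /= addrC.
- by rewrite !big_cons !big_nil /= linearD !addr0.
- by rewrite !big_cons !big_nil /= linearD !addr0.
- by rewrite !big_cons !big_nil /= !linearZ !addr0.
- by rewrite !big_cons !big_nil /= linear0 addr0.
Qed.

Fact tensor_lift_linear : linear tensor_lift_fun.
Proof.
move=> c x y; case: (cl_surj x) (cl_surj y) => s -> [t ->].
rewrite [_ *: cl s]scaleE [_ + _]addE /tensor_lift_fun !(relE (cl_repr _)).
rewrite big_cat big_map scaler_sumr /=; congr (_ + _).
by apply: eq_bigr => p _; rewrite linearZ.
Qed.
HB.instance Definition _ :=
  GRing.isLinear.Build k tensor P *:%R tensor_lift_fun tensor_lift_linear.
Definition tensor_lift : {linear tensor -> P} := tensor_lift_fun.

Lemma tensor_liftE v w : tensor_lift (tpure v w) = B v w.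
Proof. by rewrite /= /tensor_lift_fun (relE (cl_repr _)) big_cons big_nil addr0. Qed.
End Lift.

End Tensor.

Notation "x ⊗ y" := (tpure x y) (at level 40, left associativity) : ring_scope.

(* Associative unital k-algebras; unlike MathComp's algType, the zero ring is
   allowed. *)
Record algebra (k : comPzRingType) := Algebra {
  alg_mod : lmodType k;
  alg_one : alg_mod;
  alg_mul : alg_mod -> alg_mod -> alg_mod;
  alg_mulA : associative alg_mul;
  alg_mul1 : left_id alg_one alg_mul;
  alg_mulr1 : right_id alg_one alg_mul;
  alg_mulDl : left_distributive alg_mul +%R;
  alg_mulDr : right_distributive alg_mul +%R;
  alg_scaleAl : forall (c : k) x y, c *: alg_mul x y = alg_mul (c *: x) y;
  alg_scaleAr : forall (c : k) x y, c *: alg_mul x y = alg_mul x (c *: y)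
}.
Definition alg_car k (A : algebra k) : Type := alg_mod A.
Coercion alg_car : algebra >-> Sortclass.
HB.instance Definition _ k (A : algebra k) := GRing.Lmodule.copy (alg_car A) (alg_mod A).
HB.instance Definition _ k (A : algebra k) :=
  GRing.Zmodule_isPzRing.Build (alg_car A) (@alg_mulA k A) (@alg_mul1 k A)
    (@alg_mulr1 k A) (@alg_mulDl k A) (@alg_mulDr k A).

Lemma algZl (k : comPzRingType) (A : algebra k) c (x y : A) : c *: (x * y) = (c *: x) * y.
Proof. exact: alg_scaleAl. Qed.
Lemma algZr (k : comPzRingType) (A : algebra k) c (x y : A) : c *: (x * y) = x * (c *: y).
Proof. exact: alg_scaleAr. Qed.

Section QuotLift.
Context (k : comPzRingType) (V P : lmodType k) (W : submod V) (g : {linear V -> P}).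
Hypothesis gW : forall x, W x -> g x = 0.

Definition quot_lift_fun (q : quot W) : P := g (repr q).
Let quot_lift_funE x : quot_lift_fun (qclass W x) = g x.
Proof. by apply/subr0_eq; rewrite -linearB; apply/gW/quot_repr. Qed.
Fact quot_lift_linear : linear quot_lift_fun.
Proof.
move=> c p q; case: (qclass_surj p) (qclass_surj q) => x -> [y ->].
by rewrite -linearP !quot_lift_funE linearP.
Qed.
HB.instance Definition _ :=
  GRing.isLinear.Build k (quot W) P *:%R quot_lift_fun quot_lift_linear.
Definition quot_lift : {linear quot W -> P} := quot_lift_fun.
Lemma quot_liftE x : quot_lift (qclass W x) = g x.
Proof. exact: quot_lift_funE. Qed.
End QuotLift.

Section TensorPowers.
Context (k : comPzRingType).

Fixpoint tpow (V : lmodType k) (n : nat) : lmodType k :=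
  if n is m.+1 then tensor V (tpow V m) else k^o.

Definition scalars_pred (B : algebra k) (x : B) := exists c : k, x = c *: (1 : B).
Fact scalars0 B : @scalars_pred B 0.
Proof. by exists 0; rewrite scale0r. Qed.
Fact scalarsL B c x y : @scalars_pred B x -> @scalars_pred B y -> @scalars_pred B (c *: x + y).
Proof. by move=> [a ->] [b ->]; exists (c * a + b); rewrite scalerA scalerDl. Qed.
Definition scalars (B : algebra k) : submod B := Submod (@scalars0 B) (@scalarsL B).

Definition bar (B : algebra k) : lmodType k := quot (scalars B).

Context (B : algebra k).

(* [pre w t] is x_1 (x) ... (x) x_m (x) t in degree m + deg t, for w = x_1 ... x_m and a
   family t of tensors, one for each degree. *)
Fixpoint pre (w : seq B) (t : forall n, tpow (bar B) n) (n : nat) : tpow (bar B) n :=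
  if w is x :: w' then
    if n is m.+1 then (qclass (scalars B) x : bar B) ⊗ pre w' t m else 0
  else t n.

Definition empty_tensor (n : nat) : tpow (bar B) n := if n is 0 then (1 : k^o) else 0.

(* x_1 (x) ... (x) x_n for w = x_1 ... x_n; zero if w has another length. *)
Definition word (n : nat) (w : seq B) : tpow (bar B) n := pre w empty_tensor n.

Definition multilinear (P : lmodType k) (n : nat) (g : seq B -> P) :=
  forall w1 w2 c x y, (size w1 + (size w2).+1)%N = n ->
  g (w1 ++ (c *: x + y) :: w2) = c *: g (w1 ++ x :: w2) + g (w1 ++ y :: w2).
Definition normalized (P : lmodType k) (n : nat) (g : seq B -> P) :=
  forall w1 w2, (size w1 + (size w2).+1)%N = n -> g (w1 ++ 1 :: w2) = 0.

Lemma word_multilinear n : multilinear n (word n).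
Proof.
elim: n => [|n IH] [|z w1] w2 c x y //=; rewrite ?addSn ?addnS //.
  by move=> _; rewrite /word /= linearP tpureDl tpureZl.
by move=> [/esym E]; rewrite /word /= [X in _ ⊗ X]IH ?tpureDr ?tpureZr // E addnS.
Qed.

Lemma word_normalized n : normalized n (word n).
Proof.
elim: n => [|n IH] [|z w1] w2 //=; rewrite ?addSn ?addnS //.
  move=> _; rewrite /word /=; have -> : qclass (scalars B) 1 = 0 :> bar B.
    by apply/qclass_eq; rewrite subr0; exists 1; rewrite scale1r.
  exact: tpure0l.
by move=> [/esym E]; rewrite /word /= [X in _ ⊗ X]IH ?tpure0r // E addnS.
Qed.

Fact tpure_linear (V W : lmodType k) (v : V) : linear (tpure v : W -> tensor V W).
Proof. by move=> c x y; rewrite tpureDr tpureZr. Qed.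
HB.instance Definition _ (V W : lmodType k) (v : V) :=
  GRing.isLinear.Build k W (tensor V W) *:%R (tpure v) (tpure_linear v).

Lemma word_ext (P : lmodType k) n (f g : {linear tpow (bar B) n -> P}) :
  (forall w, size w = n -> f (word n w) = g (word n w)) -> f = g.
Proof.
elim: n P f g => [|n IH] P f g fg.
  apply: linear_ext => c; have -> : c = c *: (1 : k^o) by rewrite /GRing.scale /= mulr1.
  by rewrite !linearZ; congr (_ *: _); apply: (fg [::]).
apply: tensor_linear_ext => v w; case: (qclass_surj v) => x ->.
pose t : {linear tpow (bar B) n -> tpow (bar B) n.+1} := tpure (qclass (scalars B) x : bar B).
have E : f \o t = g \o t :> {linear tpow (bar B) n -> P}.
  by apply: IH => u su; apply: (fg (x :: u)); rewrite /= su.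
exact: (congr1 (fun h : {linear _ -> _} => h w) E).
Qed.

Lemma word_lift (P : lmodType k) n (g : seq B -> P) :
    multilinear n g -> normalized n g ->
  exists h : {linear tpow (bar B) n -> P}, forall w, size w = n -> h (word n w) = g w.
Proof.
elim: n g => [|n IH] g gL gN.
  have hL : linear (fun c : k^o => c *: g [::] : P).
    by move=> c x y; rewrite scalerDl scalerA.
  pose h : {linear k^o -> P} := HB.pack (fun c : k^o => c *: g [::]) (GRing.isLinear.Build _ _ _ _ _ hL).
  by exists h => -[|//] _; apply: scale1r.
have hx x : {h : {linear tpow (bar B) n -> P} | forall w, size w = n -> h (word n w) = g (x :: w)}.
  apply: cid; apply: IH => [w1 w2 c y z E|w1 w2 E].
    by rewrite -!cat_cons gL //= addSn E.
  by rewrite -!cat_cons gN //= addSn E.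
pose H x := sval (hx x).
have HL : linear H.
  move=> c x y; apply: word_ext => w sw.
  by rewrite /= /H !(svalP (hx _)) // -[X in g X]cat0s gL //= sw.
pose H' : {linear B -> {linear tpow (bar B) n -> P}} :=
  HB.pack H (GRing.isLinear.Build _ _ _ _ _ HL).
have H1 x : scalars B x -> H' x = 0.
  move=> [c ->]; rewrite linearZ; apply: word_ext => w sw.
  by rewrite /= /H !(svalP (hx _)) // -[X in g X]cat0s gN ?scaler0 //= sw.
exists (tensor_lift (quot_lift H1)) => -[//|x w] [sw].
by rewrite tensor_liftE quot_liftE /= /H !(svalP (hx _)).
Qed.

End TensorPowers.

Section SubmodOps.
Context (k : comPzRingType).

Definition linear_iso (V W : lmodType k) := exists g : {linear V -> W}, bijective g.

Section Fixed.
Context (V : lmodType k).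

Definition full_submod : submod V := @Submod k V (fun=> True) I (fun _ _ _ _ _ => I).

Fact zero_submodL (c : k) (x y : V) : x = 0 -> y = 0 -> c *: x + y = 0.
Proof. by move=> -> ->; rewrite scaler0 addr0. Qed.
Definition zero_submod : submod V := @Submod k V (fun x => x = 0) erefl zero_submodL.

Definition cap_submod (Z W : submod V) : submod V.
Proof.
exists (fun x => Z x /\ W x); first by split; apply: submod0.
by move=> c x y [Zx Wx] [Zy Wy]; split; apply: submodL.
Defined.

Definition sum_submod (Z W : submod V) : submod V.
Proof.
exists (fun x => exists2 z, Z z & exists2 w, W w & x = z + w).
  by exists 0; [|exists 0]; rewrite ?addr0 //; apply: submod0.
move=> c _ _ [z Zz [w Ww ->]] [z' Zz' [w' Ww' ->]].
exists (c *: z + z'); [exact: submodL|exists (c *: w + w'); [exact: submodL|]].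
by rewrite scalerDr addrACA.
Defined.
End Fixed.

Definition preim_submod (V W : lmodType k) (g : {linear V -> W}) (Z : submod W) : submod V.
Proof.
exists (fun x => Z (g x)); first by rewrite linear0; apply: submod0.
by move=> c x y; rewrite linearP; apply: submodL.
Defined.

Definition im_submod (V W : lmodType k) (g : {linear V -> W}) (Z : submod V) : submod W.
Proof.
exists (fun y => exists2 x, Z x & y = g x).
  by exists 0; [apply: submod0|rewrite linear0].
move=> c _ _ [x Zx ->] [y Zy ->]; exists (c *: x + y); first exact: submodL.
by rewrite linearP.
Defined.

Definition ker_submod (V W : lmodType k) (g : {linear V -> W}) : submod V :=
  preim_submod g (zero_submod W).

(* Z / (Z ∩ W) *)
Definition subquot (V : lmodType k) (Z W : submod V) : lmodType k :=
  quot (preim_submod (val : {linear sub_of Z -> V}) W).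

Definition sclass (V : lmodType k) (Z W : submod V) (x : V) (Zx : Z x) : subquot Z W :=
  qclass _ (exist _ x (introT (asboolP (Z x)) Zx) : sub_of Z).

End SubmodOps.

Section Complexes.
Context (k : comPzRingType) (C : nat -> lmodType k) (d : forall n, {linear C n -> C n.+1}).

Definition coboundaries (n : nat) : submod (C n) :=
  match n with
  | 0 => zero_submod (C 0)
  | m.+1 => im_submod (d m) (full_submod (C m))
  end.

Definition cohomology (n : nat) : lmodType k :=
  subquot (ker_submod (d n)) (coboundaries n).

End Complexes.

Record bimodule_on (k : comPzRingType) (B : algebra k) (N : lmodType k) := Bimodule {
  lact : {linear B -> {linear N -> N}};
  ract : {linear B -> {linear N -> N}};
  lactM : forall (a b : B) x, lact (a * b) x = lact a (lact b x);
  ractM : forall (a b : B) x, ract (a * b) x = ract b (ract a x);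
  lact1 : forall x, lact 1 x = x;
  ract1 : forall x, ract 1 x = x;
  lact_ract : forall (a b : B) x, lact a (ract b x) = ract b (lact a x)
}.

(* x_0 ... x_(j-1) (x_j x_(j+1)) x_(j+2) ... *)
Definition contract (k : comPzRingType) (B : algebra k) (j : nat) (w : seq B) : seq B :=
  take j w ++ w`_j * w`_j.+1 :: drop j.+2 w.

Section Hochschild.
Context (k : comPzRingType) (B : algebra k) (N : lmodType k) (S : bimodule_on B N).

Definition hochschild_cochains (n : nat) : lmodType k := {linear tpow (bar B) n -> N}.

Definition hochschild_face (n : nat) (phi : hochschild_cochains n) (i : nat) (w : seq B) : N :=
  if i == 0 then lact S w`_0 (phi (word n (behead w)))
  else if i == n.+1 then ract S w`_n (phi (word n (take n w)))
  else phi (word n (contract i.-1 w)).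

Definition hochschild_formula n (phi : hochschild_cochains n) (w : seq B) : N :=
  \sum_(i < n.+2) (-1) ^+ i *: hochschild_face phi i w.

Let mlin_cons n (g : seq B -> N) x :
  multilinear n.+1 g -> multilinear n (fun w => g (x :: w)).
Proof. by move=> gL u v c y z E; apply: (gL (x :: u)); rewrite /= addSn E. Qed.
Let norm_cons n (g : seq B -> N) x :
  normalized n.+1 g -> normalized n (fun w => g (x :: w)).
Proof. by move=> gL u v E; apply: (gL (x :: u)); rewrite /= addSn E. Qed.

Let mlin_head n (g : seq B -> N) :
  multilinear n g -> multilinear n.+1 (fun w => lact S w`_0 (g (behead w))).
Proof.
move=> gL [|a u] v c x y /= E; first by rewrite linearP.
by case: E => E; rewrite gL // linearP.
Qed.

Let mlin_last n (g : seq B -> N) :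
  multilinear n g -> multilinear n.+1 (fun w => ract S w`_n (g (take n w))).
Proof.
elim: n g => [|n IH] g gL [|a u] v c x y /= E.
- by rewrite linearP.
- by move: E; rewrite addSn addnS.
- by rewrite -[X in g X]cat0s gL ?linearP // add0n /= size_takel //; case: E => ->.
- by apply: (IH _ (mlin_cons a gL)); case: E.
Qed.

Let size_contract n i a (v : seq B) : (i.+1 < n.+1)%N -> size v = n.+1 ->
  (0 + (size (take i v ++ a :: drop i.+2 v)).+1)%N = n.+1.
Proof.
move=> ltin E; rewrite add0n size_cat /= size_drop size_takel E; last by rewrite ltnW // ltnW.
by rewrite -addSnnS subSS addnC subnK.
Qed.

Let mlin_contract n (g : seq B -> N) i : (i < n)%N ->
  multilinear n g -> multilinear n.+1 (fun w => g (contract i w)).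
Proof.
elim: i n g => [|i IH] [//|n] g /= ltin gL u v c x y; rewrite /contract.
  case: u => [|a [|b u]] /=; rewrite ?drop0.
  - case: v => // b v [E]; rewrite /= drop0 mulrDl -algZl.
    by rewrite (gL [::]) // E.
  - by move=> [E]; rewrite mulrDr -algZr (gL [::]) // E.
  - by rewrite !addSn => -[E]; rewrite (gL (_ :: u)) //= addSn E.
case: u => [|a u] /= [E]; first by rewrite (gL [::]) //; apply: size_contract.

exact: (IH n (fun w => g (a :: w)) ltin (mlin_cons a gL)).
Qed.

Let norm_contract n (g : seq B -> N) i u v : (i < n)%N -> normalized n g ->
    (size u + (size v).+1)%N = n.+1 ->
  g (contract i (u ++ 1 :: v)) =
    if (i == size u) || (i.+1 == size u) then g (u ++ v) else 0.
Proof.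
elim: i n g u => [|i IH] [//|n] g u /= ltin gN; rewrite /contract.
  case: u => [|a [|b u]] /=; rewrite ?drop0.
  - by case: v => // b v [E]; rewrite /= drop0 mul1r.
  - by move=> [E]; rewrite mulr1.
  - by rewrite !addSn => -[E]; rewrite (gN (_ :: u)) //= addSn E.
case: u => [|a u] /= [E]; first by rewrite (gN [::]) //; apply: size_contract.

by rewrite [LHS](IH n (fun w => g (a :: w)) u ltin (norm_cons a gN)) // !eqSS.
Qed.

Let face_multilinear n phi i : (i < n.+2)%N -> multilinear n.+1 (@hochschild_face n phi i).
Proof.
have L : multilinear n (fun w => phi (word n w)).
  by move=> *; rewrite word_multilinear ?linearP.
move=> ltin u v c x y E; rewrite /hochschild_face.
case: eqP => [_|/eqP i0]; first exact: (mlin_head L).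
case: eqP => [_|/eqP iN]; first exact: (mlin_last L).
apply: (mlin_contract _ L) => //.
by case: i i0 iN ltin => // i _; rewrite eqSS !ltnS leq_eqVlt => /negPf ->.
Qed.

Let face_one n phi i u v : (i < n.+2)%N -> (size u + (size v).+1)%N = n.+1 ->
  @hochschild_face n phi i (u ++ 1 :: v) =
    if (i == size u) || (i == (size u).+1) then phi (word n (u ++ v)) else 0.
Proof.
have L : normalized n (fun w => phi (word n w)).
  by move=> *; rewrite word_normalized ?linear0.
move=> ltin E; rewrite /hochschild_face.
case: eqP => [-> /=|/eqP i0].
  case: u E => [|a u] /= E; first by rewrite lact1.
  by rewrite L ?linear0 //; case: E.
case: eqP => [->|/eqP iN].
  have -> : (n.+1 == size u) = false.
    by apply/eqP => F; move: E; rewrite F addnS => -[/eqP]; rewrite -[X in _ == X]addn0 -addnS eqn_add2l.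
  rewrite eqSS /=; case: (lastP v) E => [|v' z] E.
    have {E}E : size u = n by move: E; rewrite addn1 => -[].
    by rewrite E eqxx nth_cat E ltnn subnn take_size_cat // ract1 cats0.
  rewrite size_rcons in E; have -> : (n == size u) = false.
    by apply/eqP => F; move: E; rewrite F -[X in _ = X]addn1 => /addnI.
  rewrite -rcons_cons -rcons_cat -cats1 takel_cat ?size_cat /=; last by rewrite -ltnS -E addnS.
  have {}E : (size u + (size v').+1 = n)%N by move: E; rewrite addnS => -[].
  by rewrite take_oversize ?size_cat ?E // L ?linear0.
case: i i0 iN ltin => // i _; rewrite eqSS !ltnS leq_eqVlt => /negPf -> /= lin.
by rewrite (norm_contract lin L E) orbC.
Qed.

Fact hochschild_formula_multilinear n phi : multilinear n.+1 (@hochschild_formula n phi).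
Proof.
move=> u v c x y E; rewrite /hochschild_formula scaler_sumr -big_split /=.
apply: eq_bigr => i _; rewrite face_multilinear // scalerDr !scalerA.
by rewrite (mulrC c).
Qed.

Fact hochschild_formula_normalized n phi : normalized n.+1 (@hochschild_formula n phi).
Proof.
move=> u v E; have ltu : (size u < n.+2)%N by rewrite ltnS -E addnS ltnW // ltnS leq_addr.
have ltu1 : ((size u).+1 < n.+2)%N by rewrite ltnS -E addnS ltnS leq_addr.
rewrite /hochschild_formula (bigD1 (Ordinal ltu)) //= (bigD1 (Ordinal ltu1)) /=; last first.
  by rewrite -val_eqE /= eq_sym neq_ltn leqnn.
rewrite !face_one // !eqxx orbT /= big1 => [|i /andP[iu iu1]].
  by rewrite addr0 exprS mulN1r scaleNr subrr.
rewrite face_one //; move: iu iu1; rewrite -!val_eqE /= => /negPf -> /negPf ->.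
exact: scaler0.
Qed.

Let hochschild_ex n phi := cid (word_lift
  (@hochschild_formula_multilinear n phi) (@hochschild_formula_normalized n phi)).
Definition hochschild_fun n (phi : hochschild_cochains n) : hochschild_cochains n.+1 :=
  sval (hochschild_ex phi).

Lemma hochschild_funE n (phi : hochschild_cochains n) w : size w = n.+1 ->
  hochschild_fun phi (word n.+1 w) = hochschild_formula phi w.
Proof. exact: (svalP (hochschild_ex phi)). Qed.

Fact hochschild_linear n : linear (@hochschild_fun n).
Proof.
move=> c phi psi; apply: word_ext => w sw; rewrite /= !hochschild_funE //.
rewrite /hochschild_formula scaler_sumr -big_split; apply: eq_bigr => i _ /=.
rewrite scalerA mulrC -scalerA -scalerDr; congr (_ *: _).
by rewrite /hochschild_face; case: ifP => _; [|case: ifP => _]; rewrite /= ?linearP.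
Qed.
HB.instance Definition _ n := GRing.isLinear.Build k
  (hochschild_cochains n) (hochschild_cochains n.+1) *:%R (@hochschild_fun n) (@hochschild_linear n).

Definition hochschild_diff n : {linear hochschild_cochains n -> hochschild_cochains n.+1} :=
  @hochschild_fun n.

Definition hochschild_cohomology (n : nat) : lmodType k := cohomology hochschild_diff n.

End Hochschild.

Section SubquotTheory.
Context (k : comPzRingType) (V : lmodType k) (Z W : submod V).

Lemma sclass_surj (q : subquot Z W) : exists x (Zx : Z x), q = sclass W Zx.
Proof.
case: (qclass_surj q) => -[x Zx] ->; exists x, (elimT (asboolP _) Zx).
by congr qclass; apply: val_inj.
Qed.

Lemma sclass_eq x y (Zx : Z x) (Zy : Z y) : sclass W Zx = sclass W Zy <-> W (x - y).
Proof. by split=> [/qclass_eq /=|Wxy]; [|apply/qclass_eq]; rewrite /= ?linearB. Qed.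

Lemma sclass_eq0 x (Zx : Z x) : sclass W Zx = 0 <-> W x.
Proof.
have -> : 0 = sclass W (submod0 Z) by symmetry; apply/qclass_eq; rewrite subr0; apply: submod0.
by rewrite sclass_eq subr0.
Qed.

Lemma sclassL c x y (Zx : Z x) (Zy : Z y) (Zxy : Z (c *: x + y)) :
  sclass W Zxy = c *: sclass W Zx + sclass W Zy.
Proof. by rewrite /sclass -linearP; congr qclass; apply: val_inj. Qed.

Section Lift.
Context (P : lmodType k) (g : forall x, Z x -> P).
Arguments g : clear implicits.
Hypothesis gL : forall c x y Zx Zy Zxy, g (c *: x + y) Zxy = c *: g x Zx + g y Zy.
Hypothesis gW : forall x Zx, W x -> g x Zx = 0.

Let g' (x : sub_of Z) : P := g (val x) (elimT (asboolP _) (valP x)).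
Let g'L : linear g'.
Proof. by move=> c x y; apply: gL. Qed.
Let g'' : {linear sub_of Z -> P} := HB.pack g' (GRing.isLinear.Build _ _ _ _ _ g'L).
Let g''W x : preim_submod (val : {linear sub_of Z -> V}) W x -> g'' x = 0.
Proof. exact: gW. Qed.

Definition subquot_lift : {linear subquot Z W -> P} := quot_lift g''W.
Lemma subquot_liftE x Zx : subquot_lift (sclass W Zx) = g x Zx.
Proof. by rewrite /subquot_lift /sclass quot_liftE /= /g'; congr g; apply: Prop_irrelevance. Qed.
End Lift.
End SubquotTheory.

Lemma inj_surj_bij (T U : Type) (f : T -> U) :
  injective f -> (forall y, exists x, f x = y) -> bijective f.
Proof.
move=> fI fS; exists (fun y => sval (cid (fS y))) => [x|y].
  exact/fI/(svalP (cid (fS (f x)))).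
exact: (svalP (cid (fS y))).
Qed.

Record filtered_complex (k : comPzRingType) := FilteredComplex {
  fc_obj :> nat -> lmodType k;
  fc_diff : forall n, {linear fc_obj n -> fc_obj n.+1};
  fc_fil : nat -> forall n, submod (fc_obj n);
  fc_diffK : forall n x, fc_diff n.+1 (fc_diff n x) = 0;
  fc_fil0 : forall n x, fc_fil 0 n x;
  fc_filS : forall i n x, fc_fil i.+1 n x -> fc_fil i n x;
  fc_fil_diff : forall i n x, fc_fil i n x -> fc_fil i n.+1 (fc_diff n x)
}.

(* Cohomological spectral sequences. [ss_page p s n] is E_p in filtration degree s and
   total degree n, i.e. E_p^(rs) with r = n - s the complementary degree; the
   equations in the type of [ss_diff] avoid transports. *)
Record spectral_sequence_data (k : comPzRingType) := SpectralSequenceData {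
  ss_page : nat -> nat -> nat -> lmodType k;
  ss_diff : forall p s n s' n', (s + p = s')%N -> n.+1 = n' ->
    {linear ss_page p s n -> ss_page p s' n'}
}.

Section Boundaries.
Context (k : comPzRingType) (E : spectral_sequence_data k) (p s n : nat).

Definition ss_boundary (x : ss_page E p s n) :=
  x = 0 \/ exists s' n' (es : (s' + p = s)%N) (en : n'.+1 = n) (y : ss_page E p s' n'),
    x = ss_diff E es en y.

Fact ss_boundary0 : ss_boundary 0. Proof. by left. Qed.
Fact ss_boundaryL c x y : ss_boundary x -> ss_boundary y -> ss_boundary (c *: x + y).
Proof.
move=> [->|[s1 [n1 [e1 [f1 [x1 ->]]]]]]; first by rewrite scaler0 add0r.
move=> [->|[s2 [n2 [e2 [f2 [x2 ->]]]]]].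
  by rewrite addr0; right; exists s1, n1, e1, f1, (c *: x1); rewrite linearZ.
have es : s2 = s1 by apply/(@addIn p); rewrite e2.
have en : n2 = n1 by move: f1; rewrite -f2 => -[].
subst s2 n2; rewrite (Prop_irrelevance e2 e1) (Prop_irrelevance f2 f1).
by right; exists s1, n1, e1, f1, (c *: x1 + x2); rewrite linearP.
Qed.
Definition ss_boundaries : submod (ss_page E p s n) := Submod ss_boundary0 ss_boundaryL.

Definition ss_cycles : submod (ss_page E p s n) := ker_submod (ss_diff E (erefl (s + p)%N) (erefl n.+1)).
End Boundaries.

Record spectral_sequence (k : comPzRingType) := SpectralSequence {
  ss_data :> spectral_sequence_data k;
  ss_diffK : forall p s n s' n' s'' n'' (es : (s + p = s')%N) (en : n.+1 = n')
    (es' : (s' + p = s'')%N) (en' : n'.+1 = n'') (x : ss_page ss_data p s n),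
    ss_diff ss_data es' en' (ss_diff ss_data es en x) = 0;
  ss_homology : forall p s n,
    linear_iso (ss_page ss_data p.+1 s n) (subquot (ss_cycles ss_data p s n) (ss_boundaries ss_data p s n))
}.

Section FilteredSpectralSequence.
Context (k : comPzRingType) (X : filtered_complex k).
Local Notation d := (fc_diff X).
Local Notation F := (fc_fil X).

(* Z_p^s = { x in F_s | d x in F_(s+p) } and B_p^s = d F_(s-p), where F_i is everything
   for i <= 0; E_p^s = Z_p^s / (Z_p^s ∩ (Z_(p-1)^(s+1) + B_(p-1)^s)). *)
Definition fc_cycles p s n : submod (X n) :=
  cap_submod (F s n) (preim_submod (d n) (F (s + p) n.+1)).
Definition fc_images i n : submod (X n) :=
  match n with
  | 0 => zero_submod (X 0)
  | m.+1 => im_submod (d m) (F i m)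
  end.
Definition fc_trivial p s n : submod (X n) :=
  sum_submod (cap_submod (F s.+1 n) (preim_submod (d n) (F (s + p) n.+1)))
             (fc_images (s.+1 - p) n).
Definition fc_page p s n : lmodType k := subquot (fc_cycles p s n) (fc_trivial p s n).

Lemma fc_fil_le i j n x : (i <= j)%N -> F j n x -> F i n x.
Proof. by move=> /subnK <-; elim: (j - i)%N => // m IH /fc_filS. Qed.

Fact fc_cycles_diff p s n x : fc_cycles p s n x -> fc_cycles p (s + p) n.+1 (d n x).
Proof. by move=> [_ Fdx]; split=> //=; rewrite fc_diffK; apply: submod0. Qed.

Let dcl p s n x (Zx : fc_cycles p s n x) : fc_page p (s + p) n.+1 :=
  sclass _ (fc_cycles_diff Zx).
Let dclL p s n c x y Zx Zy Zxy :
  @dcl p s n (c *: x + y) Zxy = c *: @dcl p s n x Zx + @dcl p s n y Zy.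
Proof.
rewrite /dcl -sclassL; first by rewrite -linearP; apply: fc_cycles_diff.
by move=> Z; apply/sclass_eq; rewrite linearP subrr; apply: submod0.
Qed.
Let dclW p s n x Zx : fc_trivial p s n x -> @dcl p s n x Zx = 0.
Proof.
move=> [u [Fu Fdu] [v Bv E]]; apply/sclass_eq0; rewrite E linearD.
have -> : d n v = 0.
  by case: n v Bv {x Zx u Fu Fdu E} => [v ->|n v [y _ ->]]; rewrite ?linear0 ?fc_diffK.
exists 0; first exact: submod0; exists (d n u); last by rewrite add0r addr0.
by exists u => //; apply: fc_fil_le Fu; rewrite leq_subLR addnS addnC.
Qed.

Definition fc_page_diff p s n : {linear fc_page p s n -> fc_page p (s + p) n.+1} :=
  @subquot_lift k _ _ _ _ (@dcl p s n) (@dclL p s n) (@dclW p s n).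
Lemma fc_page_diffE p s n x (Zx : fc_cycles p s n x) :
  fc_page_diff p s n (sclass _ Zx) = sclass _ (fc_cycles_diff Zx).
Proof. exact: subquot_liftE. Qed.

Definition fc_ss_data : spectral_sequence_data k :=
  @SpectralSequenceData k fc_page (fun p s n s' n' es en =>
    match es in _ = s', en in _ = n' return {linear fc_page p s n -> fc_page p s' n'} with
    | erefl, erefl => fc_page_diff p s n
    end).

Fact fc_ss_diffK p s n s' n' s'' n'' (es : (s + p = s')%N) (en : n.+1 = n')
    (es' : (s' + p = s'')%N) (en' : n'.+1 = n'') (x : ss_page fc_ss_data p s n) :
  ss_diff fc_ss_data es' en' (ss_diff fc_ss_data es en x) = 0.
Proof.
subst s' n' s'' n''; case: (sclass_surj x) => y [Zy ->].
change (fc_page_diff p (s + p) n.+1 (fc_page_diff p s n (sclass _ Zy)) = 0).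
rewrite !fc_page_diffE; apply/sclass_eq0; rewrite fc_diffK; exact: submod0.
Qed.

Local Notation cyc p s n := (ss_cycles fc_ss_data p s n).
Local Notation bnd p s n := (ss_boundaries fc_ss_data p s n).

Let cycW p s n x : fc_cycles p.+1 s n x -> fc_cycles p s n x.
Proof. by move=> [Fx Fdx]; split=> //; apply: fc_fil_le Fdx; rewrite addnS. Qed.
Let cyc_cyc p s n x (Zx : fc_cycles p.+1 s n x) :
  cyc p s n (sclass (fc_trivial p s n) (cycW Zx)).
Proof.
change (fc_page_diff p s n (sclass _ (cycW Zx)) = 0).
rewrite fc_page_diffE; apply/sclass_eq0; case: Zx => _ Fdx.
exists (d n x); last by exists 0; [exact: submod0|rewrite addr0].
by split; [rewrite /= -addnS|rewrite /= fc_diffK; apply: submod0].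
Qed.
Let h p s n x (Zx : fc_cycles p.+1 s n x) : subquot (cyc p s n) (bnd p s n) :=
  sclass _ (cyc_cyc Zx).
Let hL p s n c x y Zx Zy Zxy :
  @h p s n (c *: x + y) Zxy = c *: @h p s n x Zx + @h p s n y Zy.
Proof.
rewrite /h -sclassL; first by apply: submodL; apply: cyc_cyc.
move=> Z; apply/sclass_eq.
rewrite -sclassL; first by apply: cycW.
by move=> Z'; rewrite (Prop_irrelevance Z' (cycW Zxy)) subrr; apply: submod0.
Qed.

Let diff_images i n v : fc_images i n v -> d n v = 0.
Proof. by case: n v => [v ->|n v [y _ ->]]; rewrite ?linear0 ?fc_diffK. Qed.

Let h_eq0 p s n x Zx : @h p s n x Zx = 0 <-> fc_trivial p.+1 s n x.
Proof.
rewrite /h sclass_eq0; split.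
- case=> [/sclass_eq0 [u [Fu Fdu] [v Bv E]]|].
    exists u.
      split=> //=; have -> : u = x - v by rewrite E addrK.
      by rewrite linearB (diff_images Bv) subr0; case: Zx.
    exists v => //; case: n v Bv {x Zx u Fu Fdu E} => [//|n v [y Fy ->]].
    by exists y => //; apply: fc_fil_le Fy; rewrite subSS leq_sub2r.
  case=> s' [n' [es [en [y]]]]; subst s n; case: (sclass_surj y) => y0 [Zy ->].
  move=> E; change (sclass (fc_trivial p (s' + p) n'.+1) (cycW Zx) =
    fc_page_diff p s' n' (sclass _ Zy)) in E.
  rewrite fc_page_diffE in E; move/sclass_eq: E => [u [Fu Fdu] [v [v0 Fv0 Ev] E]].
  exists u.
    split=> //=; have -> : u = x - d _ y0 - v by rewrite E addrK.
    by rewrite !linearB /= fc_diffK Ev fc_diffK !subr0; case: Zx.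
  exists (d _ y0 + v); last by rewrite addrCA -E addrC subrK.
  exists (y0 + v0); last by rewrite linearD Ev.
  apply: submodD; first by case: Zy => + _; rewrite subSS addnK.
  by apply: fc_fil_le Fv0; rewrite subSS leq_sub2r.
- move=> [u [Fu Fdu] [v Bv E]]; case: (leqP p s) => [le_ps|lt_sp]; last first.
    left; apply/sclass_eq0; exists u.
      by split=> //; apply: fc_fil_le Fdu; rewrite addnS.
    exists v => //; case: n v Bv {x Zx u Fu Fdu E} => [//|n v [y Fy ->]].
    by exists y => //; have -> : (s.+1 - p = 0)%N by [apply/eqP; rewrite subn_eq0]; apply: fc_fil0.
  have [s' es] : exists s', (s' + p = s)%N by exists (s - p)%N; rewrite subnK.
  subst s; case: n x Zx u Fu Fdu v Bv E => [|n] x Zx u Fu Fdu v.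
    move=> -> E; left; apply/sclass_eq0; exists u.
      by split=> //; apply: fc_fil_le Fdu; rewrite addnS.
    by exists 0; rewrite ?E //; apply: submod0.
  case=> v0 Fv0 Ev E.
  have Zv0 : fc_cycles p s' n v0.
    split; first by move: Fv0; rewrite subSS addnK.
    rewrite /=; have -> : d n v0 = x - u by rewrite E Ev addrC addKr.
    by apply: submodB; [case: Zx|apply: fc_filS].
  right; exists s', n, erefl, erefl, (sclass _ Zv0).
  change (sclass (fc_trivial p (s' + p) n.+1) (cycW Zx) = fc_page_diff p s' n (sclass _ Zv0)).
  rewrite fc_page_diffE; apply/sclass_eq; rewrite E Ev addrK.
  exists u; first by split=> //; apply: fc_fil_le Fdu; rewrite addnS.
  by exists 0; rewrite ?addr0 //; apply: submod0.
Qed.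

Let h_surj p s n (q : subquot (cyc p s n) (bnd p s n)) :
  exists x (Zx : fc_cycles p.+1 s n x), q = h Zx.
Proof.
case: (sclass_surj q) => y [Zy ->]; case: (sclass_surj y) Zy => x [Zx ->] Zy.
have : fc_page_diff p s n (sclass _ Zx) = 0 by exact: Zy.
rewrite fc_page_diffE => /sclass_eq0 [u [Fu Fdu] [v [v0 Fv0 Ev] E]].
have {}Fv0 : F s.+1 n v0 by move: Fv0; rewrite -addSn addnK.
have Zx' : fc_cycles p.+1 s n (x - v0).
  split; first by apply: submodB; [exact: Zx.1|apply: fc_filS].
  by rewrite /= linearB -Ev E addrK addnS.
exists _, Zx'; apply/sclass_eq.
have -> : sclass _ Zx = sclass (fc_trivial p s n) (cycW Zx'); last by rewrite subrr; left.
apply/sclass_eq; rewrite subKr; exists v0; last first.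
  by exists 0; rewrite ?addr0 //; apply: submod0.
split=> //=; have -> : d n v0 = d n x - u by rewrite E Ev addrC addKr.
by apply: submodB; [exact: Zx.2|apply: fc_filS].
Qed.

Fact fc_ss_homology p s n :
  linear_iso (ss_page fc_ss_data p.+1 s n) (subquot (cyc p s n) (bnd p s n)).
Proof.
exists (@subquot_lift k _ _ _ _ (@h p s n) (@hL p s n)
  (fun x Zx => (iffRL (@h_eq0 p s n x Zx)))).
apply: inj_surj_bij => [x y|q].
  case: (sclass_surj x) (sclass_surj y) => x' [Zx ->] [y' [Zy ->]].
  rewrite !subquot_liftE => /eqP; rewrite -subr_eq0 -scaleN1r addrC.
  rewrite -hL; first by rewrite addrC scaleN1r; apply: submodB.
  move=> Z /eqP/h_eq0; rewrite addrC scaleN1r => W; exact/sclass_eq.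
by case: (h_surj q) => x [Zx ->]; exists (sclass _ Zx); rewrite subquot_liftE.
Qed.

Definition filtration_spectral_sequence : spectral_sequence k :=
  SpectralSequence fc_ss_diffK fc_ss_homology.

End FilteredSpectralSequence.

Section Convergence.
Context (k : comPzRingType).

Definition converges (E : spectral_sequence k) (G : nat -> lmodType k)
    (Phi : nat -> forall n, submod (G n)) : Prop :=
  [/\ forall n x, Phi 0 n x,
      forall s n x, Phi s.+1 n x -> Phi s n x,
      forall n, exists s, forall x, Phi s n x -> x = 0
    & forall s n, exists p0, forall p, (p0 <= p)%N ->
        [/\ forall x, ss_cycles E p s n x,
            forall x, ss_boundaries E p s n x -> x = 0
          & linear_iso (ss_page E p s n) (subquot (Phi s n) (Phi s.+1 n))]].

Context (X : filtered_complex k).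

Definition fc_cohomology (n : nat) : lmodType k := cohomology (fc_diff X) n.

Definition fc_cohomology_fil_pred s n (q : fc_cohomology n) :=
  exists x (Zx : ker_submod (fc_diff X n) x),
    fc_fil X s n x /\ q = sclass (coboundaries (fc_diff X) n) Zx.
Fact fc_cohomology_fil0 s n : @fc_cohomology_fil_pred s n 0.
Proof.
exists 0, (submod0 _); split; first exact: submod0.
by symmetry; apply/sclass_eq0/submod0.
Qed.
Fact fc_cohomology_filL s n c p q : @fc_cohomology_fil_pred s n p ->
  @fc_cohomology_fil_pred s n q -> @fc_cohomology_fil_pred s n (c *: p + q).
Proof.
move=> [x [Zx [Fx ->]]] [y [Zy [Fy ->]]].
exists (c *: x + y), (submodL c Zx Zy); split; first exact: submodL.
by symmetry; apply: sclassL.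
Qed.
(* The image of H^n(F_s) in H^n(X). *)
Definition fc_cohomology_fil s n : submod (fc_cohomology n) :=
  Submod (@fc_cohomology_fil0 s n) (@fc_cohomology_filL s n).
End Convergence.

Section DependentProduct.
Context (k : comPzRingType) (I : Type) (V : I -> lmodType k).
Definition dprod := forall i, V i.
HB.instance Definition _ := gen_eqMixin dprod.
HB.instance Definition _ := gen_choiceMixin dprod.
Definition dprod_add (x y : dprod) : dprod := fun i => x i + y i.
Definition dprod_opp (x : dprod) : dprod := fun i => - x i.
Definition dprod_scale c (x : dprod) : dprod := fun i => c *: x i.
Fact dprod_addA : associative dprod_add.
Proof. by move=> x y z; apply: functional_extensionality_dep => i; apply: addrA. Qed.
Fact dprod_addC : commutative dprod_add.
Proof. by move=> x y; apply: functional_extensionality_dep => i; apply: addrC. Qed.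
Fact dprod_add0 : left_id ((fun=> 0) : dprod) dprod_add.
Proof. by move=> x; apply: functional_extensionality_dep => i; apply: add0r. Qed.
Fact dprod_addN : left_inverse ((fun=> 0) : dprod) dprod_opp dprod_add.
Proof. by move=> x; apply: functional_extensionality_dep => i; apply: addNr. Qed.
HB.instance Definition _ :=
  GRing.isZmodule.Build dprod dprod_addA dprod_addC dprod_add0 dprod_addN.
Fact dprod_scaleA a b x : dprod_scale a (dprod_scale b x) = dprod_scale (a * b) x.
Proof. by apply: functional_extensionality_dep => i; apply: scalerA. Qed.
Fact dprod_scale1 : left_id 1 dprod_scale.
Proof. by move=> x; apply: functional_extensionality_dep => i; apply: scale1r. Qed.
Fact dprod_scaleDr : right_distributive dprod_scale +%R.
Proof. by move=> a x y; apply: functional_extensionality_dep => i; apply: scalerDr. Qed.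
Fact dprod_scaleDl x : {morph dprod_scale^~ x : a b / a + b}.
Proof. by move=> a b; apply: functional_extensionality_dep => i; apply: scalerDl. Qed.
HB.instance Definition _ := GRing.Zmodule_isLmodule.Build k dprod
  dprod_scaleA dprod_scale1 dprod_scaleDr dprod_scaleDl.
End DependentProduct.

(* Sums over Sweedler indices run over [tensor_terms (hopf_comul h)]. The choice of that
   expression of the comultiplication is immaterial where the summand is bilinear. *)
Record hopf_algebra (k : comPzRingType) := HopfAlgebra {
  hopf_alg :> algebra k;
  hopf_comul : {linear hopf_alg -> tensor hopf_alg hopf_alg};
  hopf_counit : {linear hopf_alg -> k^o};
  hopf_antipode : {linear hopf_alg -> hopf_alg};
  hopf_comul1 : hopf_comul 1 = (1 : hopf_alg) ⊗ (1 : hopf_alg);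
  hopf_comulM : forall g h : hopf_alg, hopf_comul (g * h) =
    \sum_(p <- tensor_terms (hopf_comul g)) \sum_(q <- tensor_terms (hopf_comul h))
      (p.1 * q.1) ⊗ (p.2 * q.2);
  hopf_counit1 : hopf_counit 1 = 1 :> k;
  hopf_counitM : forall g h : hopf_alg, hopf_counit (g * h) = hopf_counit g * hopf_counit h :> k;
  hopf_coassoc : forall h,
    \sum_(p <- tensor_terms (hopf_comul h)) p.1 ⊗ hopf_comul p.2 =
    \sum_(p <- tensor_terms (hopf_comul h)) \sum_(q <- tensor_terms (hopf_comul p.1))
      q.1 ⊗ (q.2 ⊗ p.2);
  hopf_counitl : forall h,
    \sum_(p <- tensor_terms (hopf_comul h)) (hopf_counit p.1 : k) *: p.2 = h;
  hopf_counitr : forall h,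
    \sum_(p <- tensor_terms (hopf_comul h)) (hopf_counit p.2 : k) *: p.1 = h;
  hopf_antipodel : forall h,
    \sum_(p <- tensor_terms (hopf_comul h)) hopf_antipode p.1 * p.2 = (hopf_counit h : k) *: (1 : hopf_alg);
  hopf_antipoder : forall h,
    \sum_(p <- tensor_terms (hopf_comul h)) p.1 * hopf_antipode p.2 = (hopf_counit h : k) *: (1 : hopf_alg)
}.

Section Sweedler.
Context (k : comPzRingType) (H : hopf_algebra k) (P : lmodType k).

(* [sweedler n h e] is the sum of the e [:: h^(1); ...; h^(n)]. *)
Fixpoint sweedler (n : nat) (h : H) (e : seq H -> P) : P :=
  match n with
  | 0 => (hopf_counit H h : k) *: e [::]
  | m.+1 =>
    if m is 0 then e [:: h] else
    \sum_(p <- tensor_terms (hopf_comul H h)) sweedler m p.2 (fun w => e (p.1 :: w))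
  end.

(* For a word h, the sum of the e [:: h^(1); ...; h^(n)], each h^(i) being a word of the
   same length as h. *)
Fixpoint sweedler_word (n : nat) (h : seq H) (e : seq (seq H) -> P) : P :=
  if h is x :: h' then
    sweedler n x (fun w => sweedler_word n h' (fun R => e [seq p.1 :: p.2 | p <- zip w R]))
  else e (nseq n [::]).

Definition sweedler2 (h : seq H) (e : seq H -> seq H -> P) : P :=
  sweedler_word 2 h (fun R => e (nth [::] R 0) (nth [::] R 1)).
Definition sweedler3 (h : seq H) (e : seq H -> seq H -> seq H -> P) : P :=
  sweedler_word 3 h (fun R => e (nth [::] R 0) (nth [::] R 1) (nth [::] R 2)).
End Sweedler.

Section CrossedProducts.
Context (k : comPzRingType) (H : hopf_algebra k) (A : algebra k).
Context (act : {linear H -> {linear A -> A}}) (f : {linear tensor H H -> A}).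

(* [act h a] is a^h. *)
Definition weak_action : Prop :=
  [/\ forall (h : H) (a b : A), act h (a * b) = sweedler 2 h (fun w => act w`_0 a * act w`_1 b),
      forall h, act h 1 = (hopf_counit H h : k) *: (1 : A)
    & forall a, act 1 a = a].

(* The formula [cp_mulE] always defines a unique bilinear product on A ⊗ H; being a
   crossed product amounts to the last three fields. *)
Record crossed_product := CrossedProduct {
  cp_mul : {linear tensor A H -> {linear tensor A H -> tensor A H}};
  cp_mulE : forall a h b l, cp_mul (a ⊗ h) (b ⊗ l) =
    sweedler 3 h (fun u => sweedler 2 l (fun v =>
      (a * act u`_0 b * f (u`_1 ⊗ v`_0)) ⊗ (u`_2 * v`_1)));
  cp_mulA : forall x y z, cp_mul x (cp_mul y z) = cp_mul (cp_mul x y) z;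
  cp_mul1l : forall x, cp_mul ((1 : A) ⊗ (1 : H)) x = x;
  cp_mul1r : forall x, cp_mul x ((1 : A) ⊗ (1 : H)) = x
}.

Section Algebra.
Context (E : crossed_product).
Fact cp_mulDl : left_distributive (fun x y => cp_mul E x y) +%R.
Proof. by move=> x y z; rewrite linearD. Qed.
Fact cp_mulDr : right_distributive (fun x y => cp_mul E x y) +%R.
Proof. by move=> x y z; rewrite linearD. Qed.
Fact cp_mulZl c x y : c *: cp_mul E x y = cp_mul E (c *: x) y.
Proof. by rewrite linearZ. Qed.
Fact cp_mulZr c x y : c *: cp_mul E x y = cp_mul E x (c *: y).
Proof. by rewrite linearZ. Qed.
Definition cp_algebra : algebra k :=
  @Algebra k (tensor A H) ((1 : A) ⊗ (1 : H)) (fun x y => cp_mul E x y) (cp_mulA E) (cp_mul1l E) (cp_mul1r E)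
    cp_mulDl cp_mulDr cp_mulZl cp_mulZr.
End Algebra.

(* a to the power h-bar, for a word h = h_i ... h_j: the last letter acts first. *)
Definition act_bar (a : A) (h : seq H) : A := foldr (fun x b => act x b) a h.

(* [act_word a h e] is the sum of the values of e on the words whose tensor is the word a
   to the power h-bar; for h of length one this is also a^h. *)
Definition act_word (P : lmodType k) (a : seq A) (h : seq H) (e : seq A -> P) : P :=
  sweedler_word (size a) h (fun R => e [seq act_bar p.1 p.2 | p <- zip a R]).

(* f(h_(j+1), h_(j+2)) to the power h_1 ... h_j-bar: letters of words are counted from
   0 here, from 1 in mathematical notation. *)
Definition cocycle_at (j : nat) (h : seq H) : A :=
  act_bar (f (h`_j ⊗ h`_j.+1)) (take j h).

(* F^(2)_r(h ⊗ a), r = size a, as the component of degree n = r + 1. *)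
Definition F2 (h : seq H) (a : seq A) (n : nat) : tpow (bar A) n :=
  if a is [::] then - word n [:: f (h`_0 ⊗ h`_1)]
  else \sum_(i < (size a).+1) (-1) ^+ i.+1 *:
    sweedler3 h (fun h1 h2 h3 =>
      act_word (take i a) h1 (fun u =>
      act_word (drop i a) [:: h3`_0 * h3`_1] (fun v =>
        word n (u ++ f (h2`_0 ⊗ h2`_1) :: v)))).

(* [Fmap m h a] is F^(m+2)_r(h ⊗ a), with h of length m + 2 and r = size a; it is
   the component of degree n = r + m + 1, the other components being zero. *)
Fixpoint Fmap (m : nat) (h : seq H) (a : seq A) (n : nat) : tpow (bar A) n :=
  match m with
  | 0 => F2 h a n
  | m'.+1 => let l := m'.+2 in
    if a is [::] then
      \sum_(j < l) (-1) ^+ j.+1 *: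
        sweedler2 (take j.+2 h) (fun u v =>
          pre [:: cocycle_at j u] (Fmap m' (contract j v ++ drop j.+2 h) [::]) n)
    else
      \sum_(j < l) \sum_(i < (size a).+1) (-1) ^+ (i * l + j.+1) *:
        sweedler2 h (fun h1 h' =>
        sweedler2 (take j.+2 h') (fun u v =>
          act_word (take i a) h1 (fun b =>
            pre (rcons b (cocycle_at j u))
                (Fmap m' (contract j v ++ drop j.+2 h') (drop i a)) n)))
  end.

End CrossedProducts.
Coercion cp_algebra : crossed_product >-> algebra.

Definition hom_mod (k : comPzRingType) (U V : lmodType k) : lmodType k := {linear U -> V}.

Section XComplex.
Context (k : comPzRingType) (H : hopf_algebra k) (A : algebra k).
Context (act : {linear H -> {linear A -> A}}) (f : {linear tensor H H -> A}).
Context (E : crossed_product act f) (M : lmodType k) (S : bimodule_on E M).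

Definition cochains (s r : nat) : lmodType k :=
  hom_mod (tensor (tpow (bar H) s) (tpow (bar A) r)) M.

Definition xeval s r (phi : cochains s r) (h : seq H) (t : tpow (bar A) r) : M :=
  phi (word s h ⊗ t).

Local Notation "x ⋅ m" := (lact S (x : E) m) (at level 40).
Local Notation "m ∘ x" := (ract S (x : E) m) (at level 40).
Local Notation inA a := ((a : A) ⊗ (1 : H)).
Local Notation inH h := ((1 : A) ⊗ (h : H)).

(* dhat_l^(rs)(phi)(h ⊗ a) for words h and a of lengths s and r; phi lies in
   Hom(H^(s-l) ⊗ A^(r+l-1), M). *)
Definition dhat0 s' r' (phi : cochains s' r') (h : seq H) (a : seq A) : M :=
  let r := size a in
  sweedler2 h (fun u v => inA (act_bar act a`_0 u) ⋅ xeval phi v (word r' (behead a)))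
  + (-1) ^+ r *: (xeval phi h (word r' (take r.-1 a)) ∘ inA a`_r.-1)
  + \sum_(i < r.-1) (-1) ^+ i.+1 *: xeval phi h (word r' (contract i a)).

Definition dhat1 s' r' (phi : cochains s' r') (h : seq H) (a : seq A) : M :=
  let r := size a in let s := size h in
  (-1) ^+ r *: (inH h`_0 ⋅ xeval phi (behead h) (word r' a))
  + (-1) ^+ (r + s) *:
      sweedler 2 h`_s.-1 (fun x => act_word act a [:: x`_0] (fun b =>
        xeval phi (take s.-1 h) (word r' b) ∘ inH x`_1))
  + \sum_(i < s.-1) (-1) ^+ (r + i.+1) *:
      sweedler2 (take i.+2 h) (fun u v =>
        inA (cocycle_at act f i u) ⋅ xeval phi (contract i v ++ drop i.+2 h) (word r' a)).

Definition dhat2 l s' r' (phi : cochains s' r') (h : seq H) (a : seq A) : M :=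
  let r := size a in let s := size h in
  (-1) ^+ (l * (r + s)) *:
    sweedler2 (drop (s - l) h) (fun u v =>
      xeval phi (take (s - l) h) (Fmap act f l.-2 u a r') ∘ inH (\prod_(x <- v) x)).

Definition dhat l s' r' (phi : cochains s' r') (h : seq H) (a : seq A) : M :=
  match l with
  | 0 => dhat0 phi h a
  | 1 => dhat1 phi h a
  | _ => dhat2 l phi h a
  end.

Definition xhat (n : nat) : lmodType k := dprod (fun s : 'I_n.+1 => cochains s (n - s)).
Definition xcomp n (phi : xhat n) (s : 'I_n.+1) : cochains s (n - s) := phi s.

(* The elements h ⊗ a span, so that these equations determine d (is_dhat_unique). *)
Definition is_dhat (d : forall n, {linear xhat n -> xhat n.+1}) : Prop :=
  forall n (phi : xhat n) (s : 'I_n.+2) (h : seq H) (a : seq A),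
    size h = s -> size a = (n.+1 - s)%N ->
  xcomp (d n phi) s (word s h ⊗ word (n.+1 - s) a) =
    \sum_(l < s.+1 | (0 < n.+1 - s + l)%N) dhat l (xcomp phi (inord (s - l))) h a.

Definition xfil_pred i n (phi : xhat n) := forall s : 'I_n.+1, (s < i)%N -> xcomp phi s = 0.
Fact xfil_pred0 i n : @xfil_pred i n 0.
Proof. by []. Qed.
Fact xfil_predL i n c phi psi : @xfil_pred i n phi -> @xfil_pred i n psi ->
  @xfil_pred i n (c *: phi + psi).
Proof.
move=> Fx Fy s lts; have := Fx s lts; have := Fy s lts; rewrite /xcomp => y x.
by rewrite -[LHS]/(c *: phi s + psi s) x y scaler0 addr0.
Qed.
Definition xfil (i n : nat) : submod (xhat n) := Submod (@xfil_pred0 i n) (@xfil_predL i n).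

Fact xfil_full n x : xfil 0 n x. Proof. by []. Qed.
Fact xfil_dec i n x : xfil i.+1 n x -> xfil i n x.
Proof. by move=> Fx s lts; apply: Fx; apply: ltnW. Qed.

Section Filtered.
Context (d : forall n, {linear xhat n -> xhat n.+1}).
Hypothesis dK : forall n x, d n.+1 (d n x) = 0.
Hypothesis dF : forall i n x, xfil i n x -> xfil i n.+1 (d n x).
Definition xhat_complex : filtered_complex k :=
  @FilteredComplex k xhat d xfil dK xfil_full xfil_dec dF.
End Filtered.

(* (a phi b)(h) = a^(h^(1)-bar) phi(h^(2)) b; the structure is determined by these
   equations (is_hom_bimodule_unique). *)
Definition is_hom_bimodule (N : forall s, bimodule_on A (hom_mod (tpow (bar H) s) M)) : Prop :=
  forall s (a : A) (phi : hom_mod (tpow (bar H) s) M) (h : seq H), size h = s ->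
    (lact (N s) a phi : hom_mod _ _) (word s h) =
      sweedler2 h (fun u v => inA (act_bar act a u) ⋅ phi (word s v)) /\
    (ract (N s) a phi : hom_mod _ _) (word s h) = phi (word s h) ∘ inA a.

Lemma cochain_ext s r (phi psi : cochains s r) :
  (forall h a, size h = s -> size a = r ->
    phi (word s h ⊗ word r a) = psi (word s h ⊗ word r a)) -> phi = psi.
Proof.
move=> E2; apply: tensor_linear_ext => v w.
have L w' : linear (fun v' : tpow (bar H) s => v' ⊗ (w' : tpow (bar A) r)).
  by move=> c x y; rewrite tpureDl tpureZl.
pose t w' : {linear _ -> _} := HB.pack (fun v' : tpow (bar H) s => v' ⊗ w')
  (GRing.isLinear.Build _ _ _ _ _ (L w')).
have {}E2 h : size h = s -> phi (word s h ⊗ w) = psi (word s h ⊗ w).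
  move=> sh; pose u : {linear _ -> tensor (tpow (bar H) s) (tpow (bar A) r)} := tpure (word s h).
  have E3 : phi \o u = psi \o u :> {linear tpow (bar A) r -> M}.
    by apply: word_ext => a sa; apply: E2.
  exact: (congr1 (fun g : {linear _ -> _} => g w) E3).
have E3 : phi \o t w = psi \o t w :> {linear tpow (bar H) s -> M}.
  by apply: word_ext => h sh; apply: E2.
exact: (congr1 (fun g : {linear _ -> _} => g v) E3).
Qed.

Lemma is_dhat_unique d d' : is_dhat d -> is_dhat d' -> forall n phi, d n phi = d' n phi.
Proof.
move=> D D' n phi; apply: functional_extensionality_dep => s; apply: cochain_ext => h a sh sa.
exact: etrans (D n phi s h a sh sa) (esym (D' n phi s h a sh sa)).
Qed.

Lemma is_hom_bimodule_unique N N' : is_hom_bimodule N -> is_hom_bimodule N' ->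
  forall s a phi, lact (N s) a phi = lact (N' s) a phi /\ ract (N s) a phi = ract (N' s) a phi.
Proof.
move=> D D' s a phi; split; apply: word_ext => h sh.
  by case: (D s a phi h sh) (D' s a phi h sh) => + _ [+ _] => -> ->.
by case: (D s a phi h sh) (D' s a phi h sh) => _ + [_ +] => -> ->.
Qed.

End XComplex.
Arguments xhat {k} H A M n.
Arguments xfil {k H A M} i n.

(* Main.v *)
(** Only dhat_0 preserves the filtration degree, and on a column it is the Hochschild differential
    of A, whence E_1; the filtration is finite in each degree, whence convergence.

    The cohomology of the complex is compared with that of E by dimension shifting, without a
    chain map. Both complexes are functors of M that are exact on sequences split over k, and both
    have the central elements of M as cohomology in degree 0. Every M embeds, split over k, into
    the bimodule Hom_k(E, M), for which both complexes are acyclic in positive degrees.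

    What has to be computed with dhat (its square, its compatibility with units, its acyclicity on
    Hom_k(E, M)) is done in a form free of f and of Sweedler indices: E^n over A is A ⊗ H^n, so
    that a cochain on H^s ⊗ A^r is a function on words of E balanced over A, and every term of
    dhat comes from multiplying adjacent letters of E. *)
Require Import Defs.
From HB Require Import structures.
From mathcomp Require Import all_boot all_algebra.
From mathcomp Require Import all_classical.
From mathcomp Require Import zify.

Set Implicit Arguments.
Unset Strict Implicit.
Unset Printing Implicit Defensive.

Import GRing.Theory.
Local Open Scope ring_scope.

(** * Linear functions *)

(** The formula for the differential prescribes values on words only, so even its existence requires
    that it be multilinear and normalized in all letters; checking this, or the vanishing of the
    square, on the nested Sweedler sums of the maps F is the obstacle. Every F is therefore
    recognised as the outcome of one recursion in [E]: multiply neighbouring letters, or let the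
    last letter absorb the next letter of [A], and push what lies in [A] to the left. The conditions
    on [f] enter only through associativity and the unit laws of [E].

    The same recursion with [A] = [E] and [H] = k describes the Hochschild complex of [E], so square
    zero, functoriality and acyclicity are proved once for both complexes.

    Acyclicity for Hom_k(E, M) takes two homotopies. Coinduction from [A] clears every filtration
    degree in which a letter of [A] occurs. The remaining cochains on words of [H] alone belong to a
    bar complex relative to [A], which is contracted by turning the argument in [E] into one more
    letter. *)

Section Lin.
Context (k : comPzRingType).

(** Unbundled, so that linearity of an expression in one of its letters can be proved by composing
    the lemmas below. *)
Definition lin (V P : lmodType k) (F : V -> P) := forall c x y, F (c *: x + y) = c *: F x + F y.

Section One.
Context (V P : lmodType k).
Implicit Types (F : V -> P).

Definition lin_pack F (L : lin F) : {linear V -> P} := HB.pack F (GRing.isLinear.Build _ _ _ _ _ L).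
Lemma linD F : lin F -> forall x y, F (x + y) = F x + F y.
Proof. by move=> L x y; apply: (linearD (lin_pack L)). Qed.
Lemma linB F : lin F -> forall x y, F (x - y) = F x - F y.
Proof. by move=> L x y; apply: (linearB (lin_pack L)). Qed.
Lemma linN F : lin F -> forall x, F (- x) = - F x.
Proof. by move=> L x; apply: (linearN (lin_pack L)). Qed.
Lemma lin0 F : lin F -> F 0 = 0.
Proof. by move=> L; apply: (linear0 (lin_pack L)). Qed.
Lemma linZ F : lin F -> forall c x, F (c *: x) = c *: F x.
Proof. by move=> L c x; rewrite -[c *: x]addr0 L lin0 // addr0. Qed.
Lemma lin_sum F : lin F -> forall I (r : seq I) (Q : pred I) (x : I -> V),
  F (\sum_(i <- r | Q i) x i) = \sum_(i <- r | Q i) F (x i).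
Proof. by move=> L I r Q x; apply: (linear_sum (lin_pack L)). Qed.
Lemma linear_lin (F : {linear V -> P}) : lin F.
Proof. by move=> c x y; rewrite linearP. Qed.

Lemma lin_add F1 F2 : lin F1 -> lin F2 -> lin (fun x => F1 x + F2 x).
Proof. by move=> L1 L2 c x y; rewrite L1 L2 scalerDr addrACA. Qed.
Lemma lin_scale a F : lin F -> lin (fun x => a *: F x).
Proof. by move=> L c x y; rewrite L scalerDr !scalerA mulrC. Qed.
Lemma lin_zero : lin (fun _ : V => 0 : P).
Proof. by move=> c x y; rewrite scaler0 addr0. Qed.
Lemma lin_bigsum I (r : seq I) (Q : pred I) (F : I -> V -> P) :
  (forall i, lin (F i)) -> lin (fun x => \sum_(i <- r | Q i) F i x).
Proof. by move=> L c x y; rewrite scaler_sumr -big_split; apply: eq_bigr => i _; apply: L. Qed.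
End One.

Lemma lin_comp (V W P : lmodType k) (F : W -> P) (G : V -> W) :
  lin F -> lin G -> lin (fun x => F (G x)).
Proof. by move=> LF LG c x y; rewrite LG LF. Qed.
Lemma lin_id (V : lmodType k) : lin (fun x : V => x).
Proof. by []. Qed.
Lemma lin_fun (T : Type) (V P : lmodType k) (F : V -> T -> P) :
  (forall t, lin (F^~ t)) -> lin (F : V -> (T -> P)).
Proof. by move=> L c x y; apply: funext => t; rewrite L. Qed.

End Lin.

(** * Normal forms of words *)

Section Multilinear.
Context (k : comPzRingType) (V P : lmodType k).
Implicit Types (g : seq V -> P).

(** Unlike [multilinear], no length is fixed: cochains are treated as functions on words of every
    length that vanish outside their degree, which frees inductions on words from bookkeeping. *)
Definition mlin g := forall u v, lin (fun x => g (u ++ x :: v)).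

Lemma mlin_head g w : mlin g -> lin (fun x => g (x :: w)).
Proof. by move=> L; apply: (L [::]). Qed.
Lemma mlin_cons g x : mlin g -> mlin (fun w => g (x :: w)).
Proof. by move=> L u v; apply: (L (x :: u)). Qed.
Lemma mlinP g : (forall w, lin (fun x => g (x :: w))) ->
  (forall x, mlin (fun w => g (x :: w))) -> mlin g.
Proof. by move=> L1 L2 [|x u] v; [apply: L1|apply: L2]. Qed.
Lemma mlin_const0 : mlin (fun _ : seq V => 0 : P).
Proof. by move=> u v; apply: lin_zero. Qed.
End Multilinear.

(* E = A ⊗ H as a left A-module; for a crossed product [inA a * inH h] is a # h. [eterms e]
   is a chosen expression of e, which only bilinear summands may use. *)
Record free_extension (k : comPzRingType) (A H E : algebra k) := FreeExtension {
  inA : {linear A -> E};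
  inH : {linear H -> E};
  eterms : E -> seq (A * H);
  inA1 : inA 1 = 1;
  inH1 : inH 1 = 1;
  inAM : forall a b, inA (a * b) = inA a * inA b;
  eterms_sum : forall e, e = \sum_(p <- eterms e) inA p.1 * inH p.2;
  esum_lin : forall (P : lmodType k) (F : A -> H -> P),
    (forall h, lin (F^~ h)) -> (forall a, lin (F a)) ->
    lin (fun e => \sum_(p <- eterms e) F p.1 p.2);
  esumE : forall (P : lmodType k) (F : A -> H -> P),
    (forall h, lin (F^~ h)) -> (forall a, lin (F a)) ->
    forall a h, \sum_(p <- eterms (inA a * inH h)) F p.1 p.2 = F a h
}.
Arguments inA {k A H E} f.
Arguments inH {k A H E} f.

Lemma mulr_lin (k : comPzRingType) (B : algebra k) (b : B) : lin (fun x : B => b * x).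
Proof. by move=> c x y; rewrite mulrDr algZr. Qed.
Lemma mulr_linr (k : comPzRingType) (B : algebra k) (b : B) : lin (fun x : B => x * b).
Proof. by move=> c x y; rewrite mulrDl algZl. Qed.

Section NormalForm.
Context (k : comPzRingType) (A H E : algebra k) (X : free_extension A H E).
Local Notation iA := (inA X).
Local Notation iH := (inH X).

Section Val.
Context (P : lmodType k).
Implicit Types (F : A -> seq H -> P).

Definition esum (e : E) (F : A -> H -> P) : P := \sum_(p <- eterms X e) F p.1 p.2.
Definition bil (F : A -> H -> P) := (forall h, lin (F^~ h)) /\ (forall a, lin (F a)).

Lemma esum_linl (F : A -> H -> P) : bil F -> lin (fun e => esum e F).
Proof. by move=> [L1 L2]; apply: esum_lin. Qed.
Lemma esum_in (F : A -> H -> P) a h : bil F -> esum (iA a * iH h) F = F a h.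
Proof. by move=> [L1 L2]; apply: esumE. Qed.
Lemma esum_mulA (F : A -> H -> P) a e : bil F ->
  esum (iA a * e) F = esum e (fun b h => F (a * b) h).
Proof.
move=> BF; have B2 : bil (fun b h => F (a * b) h).
  by split=> [h|b]; [apply: lin_comp (BF.1 h) _; apply: mulr_lin|apply: BF.2].
rewrite (eterms_sum X e) mulr_sumr.
rewrite (lin_sum (esum_linl BF)) (lin_sum (esum_linl B2)).
by apply: eq_bigr => p _; rewrite mulrA -inAM !esum_in.
Qed.
Lemma eq_esum e (F G : A -> H -> P) : (forall a h, F a h = G a h) -> esum e F = esum e G.
Proof. by move=> FG; apply: eq_bigr => p _; apply: FG. Qed.
Lemma esum_eval (G : E -> P) e : lin G -> esum e (fun a h => G (iA a * iH h)) = G e.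
Proof. by move=> L; rewrite {2}(eterms_sum X e) (lin_sum L). Qed.

(* E^n over A is A ⊗ H^n: moving letters of A to the left rewrites e_1 ⊗ ... ⊗ e_n as a sum
   of terms x h_1 ⊗ ... ⊗ h_n, and [nf w F] is the sum of the F x [:: h_1; ...; h_n]. *)
Fixpoint nf (w : seq E) (F : A -> seq H -> P) : P :=
  if w is e :: w' then nf w' (fun x hs => esum (e * iA x) (fun a h => F a (h :: hs)))
  else F 1 [::].

Definition mlF F := (forall hs, lin (F^~ hs)) /\ (forall a, mlin (F a)).

Lemma eq_nf w F G : (forall a hs, size hs = size w -> F a hs = G a hs) -> nf w F = nf w G.
Proof.
elim: w F G => [|e w IH] F G FG /=; first exact: FG.
by apply: IH => x hs sh; apply: eq_bigr => p _; apply: FG; rewrite /= sh.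
Qed.

Lemma mlF_bil F hs : mlF F -> bil (fun a h => F a (h :: hs)).
Proof. by move=> [L1 L2]; split=> [h|a]; [apply: L1|apply: mlin_head]. Qed.

Lemma mlF_step F e : mlF F -> mlF (fun x hs => esum (e * iA x) (fun a h => F a (h :: hs))).
Proof.
move=> mF; split=> [hs|x].
  apply: (lin_comp (esum_linl (mlF_bil hs mF))).
  by move=> c x y; rewrite linearP mulrDr algZr.
by move=> u v; apply: lin_bigsum => p; apply: (mF.2 p.1 (p.2 :: u)).
Qed.
End Val.

Lemma esum_fun (P : lmodType k) (T : Type) e (F : A -> H -> T -> P) t :
  esum e F t = esum e (fun a h => F a h t).
Proof. by rewrite /esum; elim/big_rec2: _ => // p _ y _ <-. Qed.

Section Val2.
Context (P : lmodType k).
Implicit Types (F : A -> seq H -> P).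

Lemma esum_linF e : lin (fun F : A -> H -> P => esum e F).
Proof. by move=> c F G; rewrite /esum scaler_sumr -big_split. Qed.

Lemma nf_linF w : lin (fun F : A -> seq H -> P => nf w F).
Proof.
elim: w => [|e w IH] c F G //=.
rewrite -IH; apply: eq_nf => x hs _.
exact: (esum_linF _ c (fun a h => F a (h :: hs)) (fun a h => G a (h :: hs))).
Qed.

Lemma nf_mlin F : mlF F -> mlin (fun w => nf w F).
Proof.
move=> mF u; elim: u F mF => [|e u IH] F mF v /=; last first.
  by apply: IH; apply: mlF_step.
move=> c x y; rewrite -nf_linF; apply: eq_nf => z hs _.
rewrite (mulrDl _ _ (iA z)) -algZl esum_linl //; exact: mlF_bil.
Qed.

Lemma nf_inH F hs : mlF F -> nf (map iH hs) F = F 1 hs.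
Proof.
elim: hs F => [|h hs IH] F mF //=; rewrite IH; last exact: mlF_step.
by rewrite inA1 mulr1 -[iH h]mul1r -(inA1 X) esum_in //; apply: mlF_bil.
Qed.

Lemma nf_mulA F a e w : mlF F ->
  nf (iA a * e :: w) F = nf (e :: w) (fun b hs => F (a * b) hs).
Proof.
move=> mF /=; apply: eq_nf => x hs _.
by rewrite -mulrA esum_mulA //; apply: mlF_bil.
Qed.

Lemma nf0 w : nf w (fun _ _ => 0 : P) = 0.
Proof. exact: (lin0 (@nf_linF w)). Qed.

(** The letter of [A] meets the element of [A] carried to it from the right; their product again
    lies in [A] and moves on, so the normal form has the letter 1 of [H] in this place. *)
Lemma nf_letterA F b u v : mlF F ->
    (forall a hs1 hs2, size hs1 = size u -> size hs2 = size v -> F a (hs1 ++ 1 :: hs2) = 0) ->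
  nf (u ++ iA b :: v) F = 0.
Proof.
elim: u F => [|e u IH] F mF F1 /=.
  rewrite -(nf0 v); apply: eq_nf => x hs sh.
  rewrite -inAM -[iA _]mulr1 -(inH1 X) (esum_in _ _ (mlF_bil hs mF)).
  exact: (F1 _ [::]).
apply: IH => [|a hs1 hs2 s1 s2]; first exact: mlF_step.
by apply: big1 => p _; apply: (F1 _ (p.2 :: hs1)) => //=; rewrite s1.
Qed.

(** Together with multilinearity: [Psi] factors through tensor products over [A]. *)
Definition balanced (Psi : seq E -> P) := forall u e a e' v,
  Psi (u ++ e * iA a :: e' :: v) = Psi (u ++ e :: iA a * e' :: v).

Lemma balanced_cons Psi e : balanced Psi -> balanced (fun w => Psi (e :: w)).
Proof. by move=> B u e1 a e2 v; apply: (B (e :: u)). Qed.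

(** [nf] only moves letters of [A] across tensor signs over [A], which [balanced] permits. Hence a
    balanced function is determined by its values on words whose letters after the first come from
    [H], and identities between balanced functions are checked there. *)
Lemma nf_balanced (Psi : seq E -> P) e0 w : mlin Psi -> balanced Psi ->
  nf w (fun x hs => Psi (e0 * iA x :: map iH hs)) = Psi (e0 :: w).
Proof.
elim: w Psi e0 => [|e w IH] Psi e0 mP bP /=; first by rewrite inA1 mulr1.
rewrite -(IH (fun w => Psi (e0 :: w))); last 2 first.
- exact: mlin_cons.
- exact: balanced_cons.
apply: eq_nf => x hs _.
rewrite -(@esum_eval P (fun e => Psi (e0 :: e :: map iH hs))); last exact: (mP [:: e0]).
by apply: eq_esum => a h; apply: (bP [::]).
Qed.

(** Here the first letter is decomposed as well. The branch of the empty word is a default that is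
    never reached. *)
Lemma nf_balanced1 (Psi : seq E -> P) e w : mlin Psi -> balanced Psi ->
  nf (e :: w) (fun x hs => Psi (if hs is h :: hs' then iA x * iH h :: map iH hs' else [::])) =
  Psi (e :: w).
Proof.
move=> mP bP /=; rewrite -(nf_balanced _ _ mP bP); apply: eq_nf => x hs _.
by rewrite (@esum_eval P (fun e => Psi (e :: map iH hs))) //; apply: mlin_head.
Qed.

Lemma nf_is_balanced F : mlF F -> balanced (fun w => nf w F).
Proof.
move=> mF u; elim: u F mF => [|e0 u IH] F mF e a e' v; last first.
  by rewrite [LHS]/= [RHS]/=; apply: IH; apply: mlF_step.
rewrite ![[::] ++ _]/= [LHS]/= [RHS]/=; apply: eq_nf => x hs _.
rewrite -[iA a * e' * _]mulrA esum_mulA.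
  by apply: eq_esum => b h; rewrite inAM mulrA.
split=> [h|b].
  apply: (lin_comp (esum_linl (mlF_bil (h :: hs) mF))) => c y z.
  by rewrite linearP mulrDr algZr.
by apply: lin_bigsum => p; apply: (mF.2 _ [:: p.2]).
Qed.
End Val2.
End NormalForm.

(** * The differential on words *)

Lemma opp_sub_lin (k : comPzRingType) (P : lmodType k) (c : k) (p q r s : P) :
  - (c *: p + q) - (c *: r + s) = c *: (- p - r) + (- q - s).
Proof. by rewrite scalerBr scalerN !opprD addrACA. Qed.

Section LeftDifferential.
Context (k : comPzRingType) (A E : algebra k) (iA : {linear A -> E}).
Hypothesis iAM : forall a b, iA (a * b) = iA a * iA b.

Section Val.
Context (P : lmodType k).
Implicit Types (Psi : seq E -> seq A -> P).

(* The alternating sum of the contractions of the word w of E and of the term where the first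
   letter of a is absorbed by the last letter of w (closed formula: [ldiff_sum]). *)
Fixpoint ldiff Psi (w : seq E) (a : seq A) : P :=
  match w with
  | [::] => 0
  | e :: w1 => match w1 with
    | [::] => if a is a1 :: a' then Psi [:: e * iA a1] a' else 0
    | e' :: w' => - Psi (e * e' :: w') a - ldiff (fun u => Psi (e :: u)) w1 a
    end
  end.

Lemma ldiff_cons Psi e e' w a :
  ldiff Psi (e :: e' :: w) a = - Psi (e * e' :: w) a - ldiff (fun u => Psi (e :: u)) (e' :: w) a.
Proof. by []. Qed.

Lemma eq_ldiff Psi Psi' w a :
    (forall w' b, (0 < size w')%N -> (size w' + size b).+1 = (size w + size a)%N ->
      Psi w' b = Psi' w' b) ->
  ldiff Psi w a = ldiff Psi' w a.
Proof.
elim: w Psi Psi' => [|e [|e' w] IH] Psi Psi' E1 //.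
  by case: a {IH} E1 => [|a1 a] E1 //=; apply: E1 => //=; rewrite addnS.
rewrite !ldiff_cons E1 //; congr (_ - _); apply: IH => w' b w'0 s.
by apply: E1 => //=; rewrite !addSn s.
Qed.

Lemma ldiff_lin w a : lin (fun Psi : seq E -> seq A -> P => ldiff Psi w a).
Proof.
elim: w => [|e [|e' w] IH] c F G.
- by rewrite scaler0 addr0.
- by case: a {IH} => [|a1 a] //=; rewrite scaler0 addr0.
rewrite !ldiff_cons (IH c (fun u => F (e :: u)) (fun u => G (e :: u))).
exact: opp_sub_lin.
Qed.

Lemma ldiff0 w a : ldiff (fun _ _ => 0) w a = 0.
Proof. exact: (lin0 (@ldiff_lin w a)). Qed.

Lemma ldiff_mulr Psi e e' w a :
  ldiff Psi (e * e' :: w) a =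
  ldiff (fun u => Psi (if u is x :: v then e * x :: v else [::])) (e' :: w) a.
Proof.
by case: w => [|e2 w]; [case: a => [|a1 a]|]; rewrite /= ?mulrA.
Qed.

Fixpoint rmul (w : seq E) (a : A) : seq E :=
  match w with
  | [::] => [::]
  | e :: w' => if w' is [::] then [:: e * iA a] else e :: rmul w' a
  end.

(** All pairs of terms cancel as in a bar complex, except two successive absorptions: their partner
    would be the contraction of [a1] and [a2], which belongs to [rbar] and not to [ldiff]. *)
Lemma ldiff_ldiff Psi w a : ldiff (ldiff Psi) w a =
  if a is a1 :: a2 :: a' then (if w is [::] then 0 else Psi (rmul w (a1 * a2)) a') else 0.
Proof.
elim: w Psi => [|e [|e' w] IH] Psi; first by case: a => [|a1 [|]].
  by case: a {IH} => [|a1 [|a2 a]] //=; rewrite iAM mulrA.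
rewrite ldiff_cons.
(* Splitting off the contraction of the kept letter [e] with its neighbour produces, by
   [ldiff_mulr], the term that cancels [ldiff Psi (e * e' :: w) a]. *)
have -> : ldiff (fun u => ldiff Psi (e :: u)) (e' :: w) a =
  ldiff (fun u b => - Psi (if u is x :: v then e * x :: v else [::]) b
     - ldiff (fun v => Psi (e :: v)) u b) (e' :: w) a.
  by apply: eq_ldiff => -[|x v] b.
have /linB -> := @ldiff_lin (e' :: w) a.
have /linN -> := @ldiff_lin (e' :: w) a.
rewrite -ldiff_mulr (IH (fun v => Psi (e :: v))) opprB opprK addrCA addNr addr0.
by case: a {IH} => [|a1 [|a2 a]].
Qed.

Lemma ldiff_mlinl Psi : (forall a, mlin (Psi^~ a)) -> forall a, mlin (fun w => ldiff Psi w a).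
Proof.
move=> mP a u; elim: u Psi mP => [|e u IH] Psi mP v c x y; rewrite ?cat0s.
  case: v => [|e v].
    case: a => [|a1 a]; rewrite /= ?scaler0 ?addr0 //.
    by rewrite mulrDl -algZl; exact: (mP a [::] [::] c _ _).
  rewrite !ldiff_cons mulrDl -algZl (mlin_head _ (mP a)).
  have -> : ldiff (fun u => Psi (c *: x + y :: u)) (e :: v) a =
     ldiff (c *: (fun u => Psi (x :: u)) + (fun u => Psi (y :: u))) (e :: v) a.
    by apply: eq_ldiff => w' b _ _; apply: (mlin_head w' (mP b)).
  by rewrite ldiff_lin opp_sub_lin.
have mP' b : mlin (fun u => Psi (e :: u) b) := mlin_cons e (mP b).
case: u IH => [|e' u] IH; rewrite !cat_cons !ldiff_cons.
  have := IH _ mP' v c x y; rewrite !cat0s => ->.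
  rewrite mulrDr -algZr (mlin_head _ (mP a)).
  exact: opp_sub_lin.
have := IH _ mP' v c x y; rewrite !cat_cons => ->.
rewrite (mP a (e * e' :: u)).
exact: opp_sub_lin.
Qed.

Lemma ldiff_mlinr Psi : (forall a, mlin (Psi^~ a)) -> (forall w, mlin (Psi w)) ->
  forall w, mlin (ldiff Psi w).
Proof.
move=> mP mP2 w; elim: w Psi mP mP2 => [|e [|e' w] IH] Psi mP mP2.
- exact: mlin_const0.
- move=> [|a1 u] v; last exact: mP2.
  move=> c x y /=; rewrite linearP mulrDr -algZr; exact: (mP v [::] [::] c _ _).
- move=> u v c x y; rewrite !ldiff_cons mP2 (IH (fun u => Psi (e :: u))) //; last first.
    by move=> b; exact: (mlin_cons e (mP b)).
  exact: opp_sub_lin.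
Qed.

Definition balanced_in (Psi : seq E -> P) := forall u e a e' v,
  Psi (u ++ e * iA a :: e' :: v) = Psi (u ++ e :: iA a * e' :: v).

Lemma ldiff_balanced Psi : (forall a, balanced_in (Psi^~ a)) ->
  forall a, balanced_in (fun w => ldiff Psi w a).
Proof.
move=> bP a u; elim: u Psi bP => [|e1 u IH] Psi bP e x e' v.
  rewrite !cat0s !ldiff_cons mulrA; congr (_ - _).
  rewrite ldiff_mulr; apply: eq_ldiff => -[|z w'] b // _ _.
  exact: (bP b [::]).
have bP' b : balanced_in (fun w => Psi (e1 :: w) b).
  by move=> u' e2 y e3 w'; apply: (bP b (e1 :: u')).
have := IH _ bP' e x e' v.
case: u IH => [|e2 u] IH; rewrite ?cat_cons ?cat0s !ldiff_cons => -> //.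
  by congr (_ - _); congr (- _); rewrite mulrA; apply: (bP a [::]).
by congr (_ - _); congr (- _); apply: (bP a (_ :: u)).
Qed.
End Val.
End LeftDifferential.

(** * Terms acting from the right: the bar differential of A and the twists by H *)

Section RightDifferential.
Context (k : comPzRingType) (A H E : algebra k) (X : free_extension A H E).
Context (M : lmodType k) (S : bimodule_on E M).
Local Notation iA := (inA X).
Local Notation iH := (inH X).
Local Notation "m ∘ x" := (ract S x m) (at level 40).

Definition mface (g : seq A -> M) (x : A) (y : seq A) : M :=
  if y is y1 :: y' then g (x * y1 :: y') else g [::] ∘ iA x.

(** The Hochschild differential of [A] without its left-action term (closed formula in
    [rbar_sum]). *)
Fixpoint rbar (g : seq A -> M) (a : seq A) : M :=
  if a is x :: y then - mface g x y - rbar (fun z => g (x :: z)) y else 0.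

Lemma mface_lin x y : lin (fun g => mface g x y).
Proof. by move=> c g h; case: y => [|y1 y] //=; rewrite linearP. Qed.
Lemma rbar_lin a : lin (fun g => rbar g a).
Proof.
elim: a => [|x a IH] c F G; first by rewrite scaler0 addr0.
rewrite /= mface_lin (IH c (fun z => F (x :: z)) (fun z => G (x :: z))).
exact: opp_sub_lin.
Qed.
Lemma rbar0 a : rbar (fun _ => 0) a = 0.
Proof. exact: (lin0 (@rbar_lin a)). Qed.
Lemma eq_rbar g h a : (forall b, (size b).+1 = size a -> g b = h b) -> rbar g a = rbar h a.
Proof.
elim: a g h => [|x y IH] g h gh //=; congr (- _ - _).
  by case: y gh {IH} => [|y1 y] gh /=; rewrite gh.
by apply: IH => b sb; apply: gh; rewrite /= sb.
Qed.

Lemma rbar_rbar g a : rbar (rbar g) a = 0.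
Proof.
elim: a g => [|x [|y a] IH] g //; first by rewrite /= !(linear0, oppr0, addr0).
have E1 : rbar (fun z => rbar g (x :: z)) (y :: a) =
    - rbar (mface g x) (y :: a) - rbar (rbar (fun z => g (x :: z))) (y :: a).
  by rewrite -(linN (@rbar_lin _)) -(linB (@rbar_lin _)).
have E2 : mface (mface g x) y a = mface g (x * y) a.
  by case: a {IH E1} => [|z a] /=; rewrite ?mulrA // inAM ractM.
by rewrite [LHS]/= -/(rbar (fun z => rbar g (x :: z)) (y :: a)) E1 IH subr0 [rbar (mface g x) _]/= E2
  opprK addNr.
Qed.

(* [twist h g a] carries all the letters of h through a and lets their product act on the
   value of g from the right; it is the generating term of the maps dhat_l, l = size h
   ([twist_act_word], [twist_Fmap]). The counter n makes the recursion structural. *)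
Fixpoint twist_rec (n : nat) (h : seq H) (g : seq A -> M) (a : seq A) : M :=
  if n is n'.+1 then
    match h, a with
    | [:: x], [::] => g [::] ∘ iH x
    | _, _ => ldiff iA (fun w b => nf X w (fun x hs => twist_rec n' hs (fun y => g (x :: y)) b)) (map iH h) a
    end
  else 0.
Definition twist h g a := twist_rec (size h + size a) h g a.
(** The element of [A] that the normal form pushes out on the left becomes the first argument of
    [g]. *)
Definition twist_nf g (w : seq E) (b : seq A) : M :=
  nf X w (fun x hs => twist hs (fun y => g (x :: y)) b).

Lemma twist_nfE g w b : twist_nf g w b = nf X w (fun x hs => twist hs (fun y => g (x :: y)) b).
Proof. by []. Qed.

Lemma twist_base x g : twist [:: x] g [::] = g [::] ∘ iH x.
Proof. by []. Qed.

Definition is_base (h : seq H) (a : seq A) := (size h == 1) && nilp a.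

(** Each unfolding shortens the two words together by one letter, which is why the sum of their
    lengths suffices as counter. *)
Lemma twistE h g a : ~~ is_base h a -> twist h g a = ldiff iA (twist_nf g) (map iH h) a.
Proof.
case: h => [|x h]; first by rewrite /twist; case: (_ + _)%N.
move=> nb; rewrite /twist [(_ + _)%N]/= /=.
transitivity (ldiff iA (fun w b => nf X w (fun x hs => twist_rec (size h + size a) hs (fun y => g (x :: y)) b))
  (map iH (x :: h)) a).
  by case: h nb => [|x' h]; case: a.
apply: eq_ldiff => w' b w0 /=; rewrite size_map addSn => -[s].
by apply: eq_nf => y hs sh; rewrite -s -sh.
Qed.

Lemma twist_rec_lin n h a : lin (fun g => twist_rec n h g a).
Proof.
elim: n h a => [|n IH] h a c F G /=; first by rewrite scaler0 addr0.
suff L : ldiff iA (fun w b => nf X w (fun x hs => twist_rec n hs (fun y => (c *: F + G) (x :: y)) b))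
  (map iH h) a
  = c *: ldiff iA (fun w b => nf X w (fun x hs => twist_rec n hs (fun y => F (x :: y)) b)) (map iH h) a
  + ldiff iA (fun w b => nf X w (fun x hs => twist_rec n hs (fun y => G (x :: y)) b)) (map iH h) a.
  by case: h L => [|x [|y h]] //; case: a => [|a1 a] //= _; rewrite linearP.
rewrite -ldiff_lin; apply: eq_ldiff => w b _ _.
rewrite -[RHS]nf_linF; apply: eq_nf => x hs _.
exact: (IH hs b c (fun y => F (x :: y)) (fun y => G (x :: y))).
Qed.
Lemma twist_lin h a : lin (fun g => twist h g a).
Proof. exact: twist_rec_lin. Qed.
Lemma twist0 h a : twist h (fun _ => 0) a = 0.
Proof. exact: (lin0 (@twist_lin h a)). Qed.

(** Each unfolding pushes out one letter and shortens the words by one, down to total length 1; so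
    [g] is evaluated only in length [size h + size a - 1], the degree r + l - 1 in which F^(l)_r
    takes its values. *)
Lemma eq_twist h g g' a : (forall b, (size b).+1 = (size h + size a)%N -> g b = g' b) ->
  twist h g a = twist h g' a.
Proof.
move sz: (size h + size a)%N => n; elim: n h g g' a sz => [|n IH] h g g' a s gg.
  by rewrite /twist s.
case: (boolP (is_base h a)) => [|nb].
  rewrite /is_base; case: h s gg => [|x [|y h]] //; case: a => [|//] /= [<-] gg _.
  by rewrite !twist_base gg.
rewrite !twistE //; apply: eq_ldiff => w b w0; rewrite size_map s => -[s'].
apply: eq_nf => x hs sh; apply: IH; first by rewrite sh.
by move=> c sc; apply: gg; rewrite /= sc.
Qed.

Lemma mlin_comp_lin (V P Q : lmodType k) (F : P -> Q) (g : seq V -> P) : lin F -> mlin g ->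
  mlin (fun w => F (g w)).
Proof. by move=> LF mg u v; apply: lin_comp LF (mg u v). Qed.

Lemma cons_lin (g : seq A -> M) : mlin g -> lin (fun x y => g (x :: y)).
Proof. by move=> mg; apply: lin_fun => y; apply: mlin_head. Qed.

Lemma mlin_map (V W : lmodType k) (iV : {linear V -> W}) (g : seq W -> M) :
  mlin g -> mlin (fun w => g (map iV w)).
Proof. by move=> mg u v c x y; rewrite !map_cat /= linearP mg. Qed.

(** The counter is kept fixed because the recursion runs on it. The two claims go together:
    multilinearity in [a] after an unfolding uses both of them for the shorter twists. *)
Lemma twist_rec_mlin n g : mlin g ->
  (forall a, mlin (fun h => twist_rec n h g a)) /\ (forall h, mlin (twist_rec n h g)).
Proof.
elim: n g => [|n IH] g mg; first by split=> *; apply: mlin_const0.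
pose Psi w b := nf X w (fun x hs => twist_rec n hs (fun y => g (x :: y)) b).
have mF b : mlF (fun x hs => twist_rec n hs (fun y => g (x :: y)) b).
  split=> [hs|x]; last exact: (IH _ (mlin_cons x mg)).1.
  exact: (lin_comp (@twist_rec_lin n hs b) (cons_lin mg)).
have m1 b : mlin (Psi^~ b) by apply: nf_mlin.
have m2 w : mlin (Psi w).
  move=> u v c x y; rewrite /Psi -nf_linF; apply: eq_nf => z hs _.
  exact: ((IH _ (mlin_cons z mg)).2 hs u v).
have recE h a : ~~ is_base h a -> twist_rec n.+1 h g a = ldiff iA Psi (map iH h) a.
  by case: h => [|x [|y h]]; case: a.
have B h1 x h2 a y : is_base (h1 ++ x :: h2) a = is_base (h1 ++ y :: h2) a.
  by rewrite /is_base !size_cat.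
split=> [a u v c x y|h u v c x y].
  case: (boolP (is_base (u ++ (c *: x + y) :: v) a)) => Bu.
    move: Bu; rewrite /is_base; case: u => [|z [|z' u]] //; case: v => [|z' v] //; case: a => [|a1 a] //= _.
    by rewrite linearP linearP.
  rewrite !recE -?(B _ (c *: x + y)) //.
  exact: (mlin_map iH (ldiff_mlinl iA m1 a) u v c x y).
rewrite !recE; try by rewrite /is_base andbC; case: u.
exact: ldiff_mlinr.
Qed.

Lemma twist_rec_mlF n g b : mlin g -> mlF (fun x hs => twist_rec n hs (fun y => g (x :: y)) b).
Proof.
move=> mg; split=> [hs|x]; last exact: (twist_rec_mlin _ (mlin_cons x mg)).1.
exact: (lin_comp (@twist_rec_lin n hs b) (cons_lin mg)).
Qed.

Lemma twist_mlinh g a : mlin g -> mlin (fun h => twist h g a).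
Proof.
move=> mg u v c x y; rewrite /twist !size_cat /=.
exact: ((twist_rec_mlin _ mg).1 a u v).
Qed.
Lemma twist_mlina g h : mlin g -> mlin (twist h g).
Proof.
move=> mg u v c x y; rewrite /twist !size_cat /=.
exact: ((twist_rec_mlin _ mg).2 h u v).
Qed.
Lemma twist_mlF g b : mlin g -> mlF (fun x hs => twist hs (fun y => g (x :: y)) b).
Proof.
move=> mg; split=> [hs|x]; last exact: twist_mlinh (mlin_cons x mg).
exact: (lin_comp (@twist_lin hs b) (cons_lin mg)).
Qed.
Lemma twist_nf_mlinl g b : mlin g -> mlin (fun w => twist_nf g w b).
Proof. by move=> mg; apply/nf_mlin/twist_mlF. Qed.
Lemma twist_nf_mlinr g w : mlin g -> mlin (twist_nf g w).
Proof.
move=> mg u v c x y; rewrite /twist_nf -nf_linF; apply: eq_nf => z hs _.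
exact: (twist_mlina hs (mlin_cons z mg) u v).
Qed.
Lemma twist_nf_balanced g b : mlin g -> balanced X (fun w => twist_nf g w b).
Proof. by move=> mg; apply/nf_is_balanced/twist_mlF. Qed.

(** The word [h] is cut in two in every way and its tail twisted past [a]; the uncut word
    contributes [rbar] (closed formula in [rdiff_sum]). *)
Fixpoint rdiff (phi : seq H -> seq A -> M) (h : seq H) (a : seq A) : M :=
  if h is x :: h' then twist h (phi [::]) a - rdiff (fun u => phi (x :: u)) h' a
  else rbar (phi [::]) a.

Lemma rdiff_lin h a : lin (fun phi : seq H -> seq A -> M => rdiff phi h a).
Proof.
elim: h => [|x h IH] c F G /=; first exact: rbar_lin.
rewrite twist_lin (IH c (fun u => F (x :: u)) (fun u => G (x :: u))).
by rewrite scalerBr opprD addrACA.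
Qed.
Lemma rdiff0 h a : rdiff (fun _ _ => 0) h a = 0.
Proof. exact: (lin0 (@rdiff_lin h a)). Qed.

Lemma eq_rdiff phi psi h a :
    (forall u b, (size u + size b).+1 = (size h + size a)%N -> phi u b = psi u b) ->
  rdiff phi h a = rdiff psi h a.
Proof.
elim: h phi psi => [|x h IH] phi psi E1 /=.
  by apply: eq_rbar => b sb; apply: E1; rewrite -sb.
congr (_ - _); first by apply: eq_twist => b sb; apply: E1.
by apply: IH => u b s; apply: E1; rewrite /= addSn s.
Qed.
End RightDifferential.

(** * The square of the right-hand part and its commutation with contractions *)

Section RightSquare.
Context (k : comPzRingType) (A H E : algebra k) (X : free_extension A H E).
Context (M : lmodType k) (S : bimodule_on E M).
Local Notation iA := (inA X).
Local Notation iH := (inH X).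
Local Notation "m ∘ x" := (ract S x m) (at level 40).
Local Notation twist := (twist X S).
Local Notation twist_nf := (twist_nf X S).
Local Notation rbar := (rbar X S).
Local Notation mface := (mface X S).
Local Notation rdiff := (rdiff X S).
Local Notation ldiff := (ldiff iA).

Definition ml2 (V W : lmodType k) (phi : seq V -> seq W -> M) :=
  (forall b, mlin (phi^~ b)) /\ (forall u, mlin (phi u)).

Lemma ml2_cons (V W : lmodType k) (phi : seq V -> seq W -> M) x :
  ml2 phi -> ml2 (fun u => phi (x :: u)).
Proof. by move=> [m1 m2]; split=> [b|u]; [exact: (mlin_cons x (m1 b))|exact: m2]. Qed.

Lemma rbar_mlin g : mlin g -> mlin (rbar g).
Proof.
move=> mg u; elim: u g mg => [|y u IH] g mg v c x1 x2.
  rewrite /=.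
  have -> : rbar (fun z => g (c *: x1 + x2 :: z)) v =
     rbar (c *: (fun z => g (x1 :: z)) + (fun z => g (x2 :: z))) v.
    by apply: eq_rbar => b _; apply: mlin_head.
  rewrite (rbar_lin X S v) -[RHS]opp_sub_lin; congr (- _ - _).
  case: v => [|y v] /=; first by rewrite linearP linearP.
  by rewrite mulrDl -algZl mlin_head.
rewrite [LHS]/= (IH _ (mlin_cons y mg)) -opp_sub_lin; congr (- _ - _).
case: u {IH} => [|z u] /=; last exact: (mg (_ :: u)).
by rewrite mulrDr -algZr mlin_head.
Qed.

Lemma rdiff_mlinh phi a : ml2 phi -> mlin (fun h => rdiff phi h a).
Proof.
move=> mphi u; elim: u phi mphi => [|y u IH] phi mphi v c x1 x2; last first.
  rewrite /= (IH _ (ml2_cons y mphi)) scalerBr opprD addrACA.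
  by congr (_ + _); apply: (twist_mlinh X S a (mphi.2 [::]) (y :: u)).
rewrite /= (twist_mlinh X S a (mphi.2 [::]) [::]).
have -> : (fun u => phi (c *: x1 + x2 :: u)) = c *: (fun u => phi (x1 :: u)) + (fun u => phi (x2 :: u)).
  by apply: funext => u; apply: funext => b; apply: (mlin_head u (mphi.1 b)).
by rewrite rdiff_lin scalerBr opprD addrACA.
Qed.

Lemma rdiff_mlina phi h : ml2 phi -> mlin (rdiff phi h).
Proof.
elim: h phi => [|x h IH] phi mphi /=; first exact: rbar_mlin (mphi.2 _).
move=> u v c x1 x2 /=.
by rewrite (twist_mlina X S _ (mphi.2 _)) (IH _ (ml2_cons x mphi)) scalerBr opprD addrACA.
Qed.

(** [rdiff] for functions on words of [E]: the first letter is kept as a coefficient and collects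
    what the normal form of the others pushes to the left. *)
Definition rdiff_nf (Psi : seq E -> seq A -> M) (w : seq E) (a : seq A) : M :=
  if w is e0 :: w' then
    nf X w' (fun x hs => rdiff (fun u => Psi (e0 * iA x :: map iH u)) hs a)
  else 0.

Lemma ml2_in (Psi : seq E -> seq A -> M) e : ml2 Psi -> ml2 (fun u => Psi (e :: map iH u)).
Proof.
move=> [m1 m2]; split=> [b|u]; last exact: m2.
exact: (mlin_map iH (mlin_cons e (m1 b))).
Qed.

Lemma rdiff_mlF Psi e0 a : ml2 Psi ->
  mlF (fun x hs => rdiff (fun u => Psi (e0 * iA x :: map iH u)) hs a).
Proof.
move=> mP; split=> [hs|x]; last by apply: rdiff_mlinh; apply: ml2_in.
apply: (lin_comp (rdiff_lin X S hs a)) => c x y.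
apply: funext => u; apply: funext => b; rewrite linearP mulrDr -algZr.
exact: (mlin_head (map iH u) (mP.1 b)).
Qed.

(** Contractions and twists anticommute up to the defect [ldiff (ldiff Psi)]. In [total_total] this
    defect cancels the square of the left-hand part, which does not vanish by itself. *)
Lemma rdiff_ldiff Psi e0 h a : ml2 Psi -> (forall b, balanced X (Psi^~ b)) ->
  rdiff (fun u => ldiff Psi (e0 :: map iH u)) h a =
  - ldiff (rdiff_nf Psi) (e0 :: map iH h) a - ldiff (ldiff Psi) (e0 :: map iH h) a.
Proof.
elim: h Psi e0 => [|x h IH] Psi e0 mP bP.
  rewrite [map iH [::]]/= ldiff_ldiff; last exact: inAM.
  case: a => [|y a]; first by rewrite /= !oppr0 addr0.
  rewrite [LHS]/= addrC; congr (- _ - _); first by rewrite /= inA1 mulr1.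
  by case: a => [|y1 a] /=; rewrite ?linear0 // inAM mulrA.
rewrite [LHS]/=.
have -> : (fun u => ldiff Psi (e0 :: map iH (x :: u))) =
    - (fun u => Psi (e0 * iH x :: map iH u)) - (fun u => ldiff (fun v => Psi (e0 :: v)) (iH x :: map iH u)).
  by [].
have Rlin := rdiff_lin X S h a.
rewrite (linB Rlin) (linN Rlin) IH; last 2 first.
- exact: (ml2_cons e0 mP).
- by move=> b; exact: (balanced_cons e0 (bP b)).
rewrite [map iH (x :: h)]/= ldiff_cons.
have -> : rdiff_nf Psi (e0 * iH x :: map iH h) a = rdiff (fun u => Psi (e0 * iH x :: map iH u)) h a.
  by rewrite [LHS]/= nf_inH ?inA1 ?mulr1 //; apply: rdiff_mlF.
rewrite ldiff_ldiff; last exact: inAM.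
rewrite [X in _ = _ - X](ldiff_ldiff (inAM X)).
set R0 := rdiff _ _ _; set DD := (match a with [::] => 0 | _ :: _ => _ end).
(* With the induction hypothesis for [Psi] prefixed by [e0], only the twist by the whole word
   [x :: h] is left to account for. *)
suff Eq : twist (x :: h) (ldiff Psi [:: e0]) a =
    ldiff (fun u => rdiff_nf Psi (e0 :: u)) (iH x :: map iH h) a
    + ldiff (rdiff_nf (fun v => Psi (e0 :: v))) (iH x :: map iH h) a.
  move: Eq; set L1 := ldiff (fun u => rdiff_nf Psi (e0 :: u)) _ _.
  set L2 := ldiff (rdiff_nf _) _ _ => ->.
  by rewrite !opprB !opprK -(addrA (- L2)) -(addrA L1) addNKr (addrC (- DD)) addrA.
rewrite -[RHS]addrC -[X in X + _]scale1r -ldiff_lin.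
transitivity (ldiff (twist_nf (ldiff Psi [:: e0])) (map iH (x :: h)) a).
  case: (boolP (is_base (x :: h) a)) => [|nb]; last exact: twistE.
  by rewrite /is_base; case: (h) => //; case: (a) => // _; rewrite twist_base linear0.
apply: eq_ldiff => -[//|e1 w] b _ _.
(* [F2] is what [rdiff] subtracts from its twist by the whole word. Adding and subtracting it turns
   that twist into [rdiff_nf Psi], while by balancedness the normal form of [F2] itself is
   [rdiff_nf] of [Psi] prefixed by [e0]. *)
pose F2 (y : A) (hs : seq H) :=
  if hs is z :: hs' then rdiff (fun u => Psi (e0 * iA y :: iH z :: map iH u)) hs' b else 0.
have -> : twist_nf (ldiff Psi [:: e0]) (e1 :: w) b =
    1 *: nf X (e1 :: w) F2 + rdiff_nf Psi [:: e0, e1 & w] b.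
  rewrite -nf_linF; apply: eq_nf => y [//|z hs] _.
  change (twist (z :: hs) (Psi [:: e0 * iA y]) b = 1 *: F2 y (z :: hs) + (twist (z :: hs) (Psi [:: e0 *
    iA y]) b - F2 y (z :: hs))).
  by rewrite scale1r addrC subrK.
rewrite -[RHS]/(1 *: rdiff_nf (fun v => Psi (e0 :: v)) (e1 :: w) b + rdiff_nf Psi [:: e0, e1 & w] b).
congr (1 *: _ + _); apply: (@eq_nf _ _ _ _ X _ w) => y hs _.
pose G e := rdiff (fun u => Psi (e0 :: e :: map iH u)) hs b.
have LG : lin G.
  apply: (lin_comp (rdiff_lin X S hs b)) => c e e'; apply: funext => u; apply: funext => b'.
  exact: (mlin_head (map iH u) (mlin_cons e0 (mP.1 b'))).
rewrite -[RHS]/(G (e1 * iA y)) -(esum_eval X _ LG); apply: eq_esum => x' z.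
congr (rdiff _ _ _); apply: funext => u; apply: funext => b'.
exact: (bP b' [::]).
Qed.

Definition base_term (g : seq A -> M) (w : seq E) (b : seq A) : M :=
  if (w, b) is ([:: e], [::]) then g [::] ∘ e else 0.

Lemma twistE_base g h a :
  twist h g a = ldiff (twist_nf g) (map iH h) a + base_term g (map iH h) a.
Proof.
case: (boolP (is_base h a)) => [|nb].
  by rewrite /is_base; case: h => [|x [|y h]] //; case: a => // _; rewrite twist_base add0r.
rewrite twistE //; suff -> : base_term g (map iH h) a = 0 by rewrite addr0.
by case: h nb => [|x [|y h]] //; case: a.
Qed.

(** Multiplying the emitted letter into the next one amounts to one step of [ldiff]: the right-hand
    side is balanced in [w], and on a first letter [iA x * iH h] followed by letters of [H] the
    claim is the recursion of [twist]. *)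
Lemma nf_twist_mface g w a : mlin g ->
  nf X w (fun x hs => twist hs (mface g x) a) = ldiff (twist_nf g) w a + base_term g w a.
Proof.
move=> mg; case: w => [|e w].
  by rewrite addr0 [LHS]/= twistE_base /= addr0.
pose Psi w := ldiff (twist_nf g) w a + base_term g w a.
have mPsi : mlin Psi.
  move=> u v; apply: lin_add; first exact: (ldiff_mlinl iA (fun b => twist_nf_mlinl X S b mg) a u v).
  rewrite /base_term; case: u => [|x [|y u]]; case: v => [|z v]; try exact: lin_zero.
  by case: (a) => [|a1 b]; [move=> c x y; rewrite /= linearP|exact: lin_zero].
have bPsi : balanced X Psi.
  move=> u e1 x e' v; congr (_ + _).
    exact: (ldiff_balanced (fun b => twist_nf_balanced X S b mg) a).
  by case: u => [|y [|z u]].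
rewrite -[RHS]/(Psi (e :: w)) -(nf_balanced1 _ _ mPsi bPsi).
apply: eq_nf => x [//|h hs] _.
rewrite twistE_base /Psi [map iH _]/= ldiff_mulr; congr (_ + _).
  apply: eq_ldiff => -[//|e' w'] b _ _; rewrite /twist_nf nf_mulA //.
  exact: twist_mlF.
by case: hs => [|h' hs]; case: (a) => //; rewrite /base_term /= ractM.
Qed.

Lemma nf_twist_rdiff g e w b : mlin g ->
  nf X (e :: w) (fun y hs => if hs is x :: h then
     rdiff (fun u => twist (x :: u) (fun z => g (y :: z))) h b else 0) =
  rdiff_nf (twist_nf g) (e :: w) b.
Proof.
move=> mg; apply: (@eq_nf _ _ _ _ X _ w) => x hs _.
transitivity (rdiff (\sum_(p <- eterms X (e * iA x)) (fun u => twist (p.2 :: u) (fun z => g (p.1 :: z)))) hs b).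
  by rewrite (lin_sum (rdiff_lin X S hs b)).
apply: eq_rdiff => u b' _.
rewrite -[RHS]/(nf X (map iH u) (fun y h => esum X (e * iA x * iA y) _)).
rewrite nf_inH; last exact: mlF_step (twist_mlF X S b' mg).
by rewrite inA1 mulr1 /esum; elim/big_rec2: _ => // p _ y _ <-.
Qed.

(** Read through the maps F, these are the relations between them on which the vanishing of the
    square rests. The induction is on the total length, since twists unfold into twists of shorter
    words. *)
Lemma twist_rbar g x h a : mlin g -> twist (x :: h) (rbar g) a = rdiff (fun u => twist (x :: u) g) h a.
Proof.
move sz: (size h + size a)%N => n; elim: n g x h a sz => [|n IH] g x h a sz mg.
  by move/eqP: sz; rewrite addn_eq0 !size_eq0 => /andP[/eqP -> /eqP ->]; rewrite twist_base linear0.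
rewrite twistE; last first.
  by rewrite /is_base; case: (h) sz => //; case: (a).
set hh := map iH _.
(* The emitted letter is either multiplied into its successor, which is [nf_twist_mface], or left in
   place, which is the induction hypothesis. *)
have -> : ldiff (twist_nf (rbar g)) hh a =
   - ldiff (fun w b => ldiff (twist_nf g) w b + base_term g w b) hh a - ldiff (rdiff_nf (twist_nf g)) hh a.
  rewrite -(linN (ldiff_lin iA hh a)) -(linB (ldiff_lin iA hh a)).
  apply: eq_ldiff => -[//|e w] b _; rewrite /hh size_map /= !addSn sz => -[sw].
  change (twist_nf (rbar g) (e :: w) b =
     - (ldiff (twist_nf g) (e :: w) b + base_term g (e :: w) b) - rdiff_nf (twist_nf g) (e :: w) b).
  rewrite -nf_twist_mface // -nf_twist_rdiff // -(linN (nf_linF X (e :: w))) -(linB (nf_linF X (e :: w))).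
  apply: eq_nf => y [//|x' h'] [sh'].
  change (twist (x' :: h') (rbar g \o cons y) b = - twist (x' :: h') (mface g y) b -
    rdiff (fun u : seq H => twist (x' :: u) (fun z => g (y :: z))) h' b).
  rewrite -IH; last exact: mlin_cons.
    by rewrite -(linN (twist_lin X S (x' :: h') b)) -(linB (twist_lin X S (x' :: h') b)).
  by rewrite sh' -sw.
have -> : (fun u => twist (x :: u) g) =
  (fun u b => ldiff (twist_nf g) (iH x :: map iH u) b) + (fun u => base_term g (iH x :: map iH u)).
  by apply: funext => u; apply: funext => b; rewrite twistE_base.
rewrite (linD (rdiff_lin X S h a)) rdiff_ldiff; last 2 first.
- by split=> [b|u]; [apply: twist_nf_mlinl|apply: twist_nf_mlinr].
- by move=> b; apply: twist_nf_balanced.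
rewrite (linD (ldiff_lin iA hh a) (ldiff (twist_nf g)) (base_term g)) opprD.
suff -> : - ldiff (base_term g) hh a = rdiff (fun u => base_term g (iH x :: map iH u)) h a.
  by rewrite -/hh (addrC (- ldiff (rdiff_nf _) _ _)) addrAC.
(* Base terms see words of total length one only, so for longer words both sides vanish. *)
rewrite {}/hh; case: n sz {IH} => [|n] sz; last first.
  rewrite (_ : ldiff _ _ _ = 0); last first.
    rewrite -(ldiff0 iA M (map iH (x :: h)) a); apply: eq_ldiff => w b _.
    rewrite size_map /= addSn sz.
    by case: w => [|e [|e' w]]; case: b.
  rewrite oppr0 -[LHS](rdiff0 X S h a); apply: eq_rdiff => u b.
  by rewrite sz; case: u => [|u0 u]; case: b.
case: h sz => [|y [|z h]] //; case: a => [|a1 [|a2 a]] //= _.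
  by rewrite /base_term /= subr0 ractM.
by rewrite /base_term /= !subr0 opprK ractM.
Qed.

Lemma rdiff_rdiff phi h a : (forall u, mlin (phi u)) -> rdiff (rdiff phi) h a = 0.
Proof.
elim: h phi => [|x h IH] phi mphi /=; first exact: rbar_rbar.
rewrite twist_rbar //.
have -> : (fun u => rdiff phi (x :: u)) = (fun u => twist (x :: u) (phi [::])) - rdiff (fun u => phi (x :: u)).
  by [].
rewrite (linB (rdiff_lin X S h a)) IH; last by move=> u; apply: mphi.
by rewrite subr0 subrr.
Qed.

End RightSquare.

Section Functoriality.
Context (k : comPzRingType) (A H E : algebra k) (X : free_extension A H E).
Context (M M' : lmodType k) (S : bimodule_on E M) (S' : bimodule_on E M').
Context (T : {linear M -> M'}).
Local Notation iA := (inA X).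
Local Notation iH := (inH X).

Lemma nf_map w F : T (nf X w F) = nf X w (fun x hs => T (F x hs)).
Proof.
elim: w F => [|e w IH] F //=; rewrite IH; apply: eq_nf => x hs _.
by rewrite /esum linear_sum.
Qed.
Lemma ldiff_map Psi w a : T (ldiff iA Psi w a) = ldiff iA (fun u b => T (Psi u b)) w a.
Proof.
elim: w Psi => [|e [|e' w] IH] Psi; rewrite ?linear0 //.
  by case: a {IH} => [|a1 a]; rewrite ?linear0.
by rewrite !ldiff_cons linearB linearN IH.
Qed.

Hypothesis TR : forall e m, T (ract S e m) = ract S' e (T m).

Lemma rbar_map g a : T (rbar X S g a) = rbar X S' (fun b => T (g b)) a.
Proof.
elim: a g => [|x y IH] g /=; rewrite ?linear0 // linearB linearN IH; congr (- _ - _).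
by case: y {IH} => [|y1 y] /=.
Qed.
Lemma twist_map h g a : T (twist X S h g a) = twist X S' h (fun b => T (g b)) a.
Proof.
rewrite /twist; move: (size h + size a)%N => n; elim: n h g a => [|n IH] h g a /=; first by rewrite linear0.
have L : T (ldiff iA (fun w b => nf X w (fun x hs => twist_rec X S n hs (fun y => g (x :: y)) b)) (map iH h) a)
  = ldiff iA (fun w b => nf X w (fun x hs => twist_rec X S' n hs (fun y => T (g (x :: y))) b)) (map iH h) a.
  rewrite ldiff_map; apply: eq_ldiff => w b _ _; rewrite nf_map; apply: eq_nf => x hs _; exact: IH.
by case: h L => [|x [|y h]]; case: a => [|a1 a].
Qed.
Lemma rdiff_map phi h a : T (rdiff X S phi h a) = rdiff X S' (fun u b => T (phi u b)) h a.
Proof.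
elim: h phi => [|x h IH] phi /=; first exact: rbar_map.
by rewrite linearB IH twist_map.
Qed.
End Functoriality.

(** * The total differential and its square *)

Section TotalDifferential.
Context (k : comPzRingType) (A H E : algebra k) (X : free_extension A H E).
Local Notation iA := (inA X).
Local Notation iH := (inH X).

Section Square.
Context (M : lmodType k) (S : bimodule_on E M).
Implicit Types (phi psi : seq H -> seq A -> M).

(* The left E-linear extension of phi, E ⊗_A (E^n over A) ⊗ A^r -> M, so that the terms of
   the differential that act from the left become contractions of words of E. *)
Definition lext (phi : seq H -> seq A -> M) (w : seq E) (a : seq A) : M :=
  if w is e0 :: w' then lact S e0 (nf X w' (fun x hs => lact S (iA x) (phi hs a))) else 0.

(* The differential of the complex [xhat] up to the signs [sg] ([dhat_total]), without
   Sweedler indices. *)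
Definition total (phi : seq H -> seq A -> M) (h : seq H) (a : seq A) : M :=
  ldiff iA (lext phi) (1 :: map iH h) a + rdiff X S phi h a.

Lemma totalE phi h a : total phi h a = ldiff iA (lext phi) (1 :: map iH h) a + rdiff X S phi h a.
Proof. by []. Qed.

Lemma lext_mlF phi a : ml2 phi -> mlF (fun x hs => lact S (iA x) (phi hs a)).
Proof.
move=> [m1 m2]; split=> [hs|x]; last exact: (mlin_comp_lin (linear_lin (lact S (iA x))) (m1 a)).
by move=> c x y; rewrite !linearP.
Qed.

Lemma lext_mulr phi e e' w a : lext phi (e * e' :: w) a = lact S e (lext phi (e' :: w) a).
Proof. by rewrite /= lactM. Qed.

Lemma lext_ml2 phi : ml2 phi -> ml2 (lext phi).
Proof.
move=> mphi; split=> [b|[|e w]]; last 2 first.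
- exact: mlin_const0.
- apply: (mlin_comp_lin (linear_lin (lact S e))) => u v c x y.
  rewrite -nf_linF; apply: eq_nf => z hs _ /=.
  rewrite -[RHS]/(c *: lact S (iA z) (phi hs (u ++ x :: v)) + lact S (iA z) (phi hs (u ++ y :: v))).
  by rewrite (mphi.2 hs) linearP.
apply: mlinP => [w|e].
  by move=> c x y; rewrite /= linearP.
apply: (mlin_comp_lin (linear_lin (lact S e))).
exact: nf_mlin (lext_mlF b mphi).
Qed.

Lemma lext_balanced phi a : ml2 phi -> balanced X ((lext phi)^~ a).
Proof.
move=> mphi [|e0 u] e x e' v; last first.
  by rewrite !cat_cons /= (nf_is_balanced X (lext_mlF a mphi) u e x e' v).
rewrite !cat0s lext_mulr; congr (lact S e _).
rewrite /lext nf_mulA; last exact: lext_mlF.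
by rewrite nf_map; apply: eq_nf => y hs _ /=; rewrite inAM lactM.
Qed.

Lemma lext_in phi e h a : ml2 phi -> lext phi (e :: map iH h) a = lact S e (phi h a).
Proof.
move=> mphi; rewrite /= nf_inH; last exact: lext_mlF.
by rewrite inA1 lact1.
Qed.

(** [total] itself is evaluated only after a leading 1; iterating it needs its left-linear
    extension, which balancedness computes on all words of [E]. The twists pass through the left
    action because the two actions on [M] commute. *)
Lemma lext_total phi e w a : ml2 phi ->
  lext (total phi) (e :: w) a = ldiff iA (lext phi) (e :: w) a + rdiff_nf X S (lext phi) (e :: w) a.
Proof.
move=> mphi.
have L e1 hs : lact S e1 (ldiff iA (lext phi) (1 :: map iH hs) a) = ldiff iA (lext phi) (e1 :: map iH hs) a.
  by rewrite -[in RHS](mulr1 e1) ldiff_mulr ldiff_map; apply: eq_ldiff => -[|x v] b // _ _; rewrite lext_mulr.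
rewrite -[ldiff _ _ (e :: w) a](@nf_balanced _ _ _ _ X _ (fun w => ldiff iA (lext phi) w a) e w); last 2 first.
- exact: (ldiff_mlinl iA (lext_ml2 mphi).1 a).
- exact: (@ldiff_balanced _ _ _ iA _ (lext phi) (fun b => lext_balanced b mphi) a).
rewrite [lext _ _ _]/= nf_map -[X in X + _]scale1r -nf_linF.
apply: eq_nf => x hs _.
rewrite -[RHS]/(1 *: ldiff iA (lext phi) (e * iA x :: map iH hs) a + _) scale1r -L -lactM linearD;
  congr (_ + _).
rewrite (@rdiff_map _ _ _ _ X M M S S (lact S (e * iA x))); last by move=> e' m; apply: lact_ract.
by apply: eq_rdiff => u b _; rewrite lext_in.
Qed.

Lemma total_total phi h a : ml2 phi -> total (total phi) h a = 0.
Proof.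
move=> mphi; rewrite {1}/total.
have -> : ldiff iA (lext (total phi)) (1 :: map iH h) a =
   ldiff iA (ldiff iA (lext phi)) (1 :: map iH h) a + ldiff iA (rdiff_nf X S (lext phi)) (1 :: map iH h) a.
  rewrite -(linD (ldiff_lin iA (1 :: map iH h) a)); apply: eq_ldiff => -[|e w] b // _ _.
  exact: lext_total.
have -> : total phi = (fun u => ldiff iA (lext phi) (1 :: map iH u)) + rdiff X S phi by [].
rewrite (linD (rdiff_lin X S h a)) rdiff_rdiff ?addr0; last exact: mphi.2.
rewrite rdiff_ldiff; last 2 first.
- exact: lext_ml2.
- by move=> b; apply: lext_balanced.
by rewrite -opprD [X in _ - X]addrC subrr.
Qed.

Lemma total_ml2 phi : ml2 phi -> ml2 (total phi).
Proof.
move=> mphi; split=> [b|u].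
  have m1 : mlin (fun u => ldiff iA (lext phi) (1 :: map iH u) b).
    exact: (mlin_map iH (mlin_cons (1 : E) (ldiff_mlinl iA (lext_ml2 mphi).1 b))).
  by move=> h1 h2; apply: lin_add; [apply: m1|apply: rdiff_mlinh].
have m2 := ldiff_mlinr iA (lext_ml2 mphi).1 (lext_ml2 mphi).2 (1 :: map iH u).
by move=> a1 a2; apply: lin_add; [apply: m2|apply: rdiff_mlina].
Qed.

Lemma lext_lin w a : lin (fun phi => lext phi w a).
Proof.
case: w => [|e w] c F G; first by rewrite scaler0 addr0.
rewrite /= -linearP -nf_linF; congr (lact S e _); apply: eq_nf => x hs _.
by rewrite linearP.
Qed.
Lemma total_lin h a : lin (fun phi => total phi h a).
Proof.
move=> c F G; rewrite /total rdiff_lin scalerDr addrACA -ldiff_lin; congr (_ + _).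
by apply: eq_ldiff => w b _ _; apply: lext_lin.
Qed.

Lemma eq_total phi psi h a :
    (forall u b, (size u + size b).+1 = (size h + size a)%N -> phi u b = psi u b) ->
  total phi h a = total psi h a.
Proof.
move=> E1; congr (_ + _); last exact: eq_rdiff.
apply: eq_ldiff => -[//|e w] b _ /=; rewrite size_map !addSn => -[s].
by congr (lact S e _); apply: eq_nf => x hs sh; rewrite E1 // sh.
Qed.
Lemma total0 h a : total (fun _ _ => 0) h a = 0.
Proof. exact: (lin0 (@total_lin h a)). Qed.
End Square.
End TotalDifferential.

(** * Normalization *)

Section Normalization.
Context (k : comPzRingType) (A H E : algebra k) (X : free_extension A H E).
Context (M : lmodType k) (S : bimodule_on E M).
Implicit Types (phi : seq H -> seq A -> M) (g : seq A -> M) (Psi : seq E -> seq A -> M).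
Local Notation iA := (inA X).
Local Notation iH := (inH X).
Local Notation twist := (twist X S).
Local Notation rbar := (rbar X S).
Local Notation rdiff := (rdiff X S).
Local Notation ldiff := (ldiff iA).
Local Notation total := (total X S).
Local Notation lext := (lext X S).

Definition nrm (B : algebra k) (g : seq B -> M) := forall u v, g (u ++ 1 :: v) = 0.
Lemma nrm_cons (B : algebra k) (g : seq B -> M) x : nrm g -> nrm (fun w => g (x :: w)).
Proof. by move=> N u v; apply: (N (x :: u)). Qed.

Lemma cons_zero g : nrm g -> (fun y => g (1 :: y)) = (fun _ => 0).
Proof. by move=> N; apply: funext => y; apply: (N [::]). Qed.

Lemma rbar_nrm1 g v : nrm g -> rbar g (1 :: v) = - g v.
Proof.
move=> N; rewrite /= cons_zero // rbar0 subr0.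
by case: v => [|y v] /=; rewrite ?mul1r ?inA1 ?ract1.
Qed.
Lemma rbar_nrm g x u v : nrm g -> rbar g (x :: u ++ 1 :: v) = 0.
Proof.
elim: u g x => [|y u IH] g x N; have N' := nrm_cons x N.
  by rewrite -[LHS]/(- g (x * 1 :: v) - rbar (fun z => g (x :: z)) (1 :: v)) rbar_nrm1 // mulr1 opprK addNr.
rewrite -[LHS]/(- g (x * y :: u ++ 1 :: v) - rbar (fun z => g (x :: z)) (y :: u ++ 1 :: v)).
by rewrite (N (_ :: u)) IH // !(oppr0, subr0, addr0).
Qed.

(** Absorbing the leading 1 of [a] returns the word itself; every other term keeps that 1 and
    vanishes. *)
Lemma ldiff_nrm1 Psi e w v : (forall w, nrm (Psi w)) ->
  ldiff Psi (e :: w) (1 :: v) = (-1) ^+ size w *: Psi (e :: w) v.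
Proof.
elim: w Psi e => [|e' w IH] Psi e N; first by rewrite /= inA1 mulr1 scale1r.
rewrite ldiff_cons (N _ [::]) (IH (fun w => Psi (e :: w))); last by move=> w'; apply: N.
by rewrite oppr0 add0r exprS mulN1r scaleNr.
Qed.
Lemma ldiff_nrm Psi w x u v : (forall w, nrm (Psi w)) -> ldiff Psi w (x :: u ++ 1 :: v) = 0.
Proof.
elim: w Psi => [|e [|e' w] IH] Psi N //; first exact: N.
rewrite ldiff_cons (N _ (x :: u)) (IH (fun w => Psi (e :: w))) ?(oppr0, subr0, addr0) // => w'; exact: N.
Qed.

Lemma twist_rec_nrma n g h : mlin g -> nrm g -> nrm (twist_rec X S n h g).
Proof.
elim: n h g => [|n IH] h g mg N u v //.
pose Psi w b := nf X w (fun x hs => twist_rec X S n hs (fun y => g (x :: y)) b).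
have NPsi w : nrm (Psi w).
  move=> b1 b2; rewrite -(nf0 X M w); apply: eq_nf => x hs _.
  exact: (IH hs _ (mlin_cons x mg) (nrm_cons x N)).
have -> : twist_rec X S n.+1 h g (u ++ 1 :: v) = ldiff Psi (map iH h) (u ++ 1 :: v).
  by case: h => [|x [|y h]]; case: u.
case: u => [|x u]; last exact: ldiff_nrm.
case: h => [|x h] //; rewrite cat0s [map _ _]/= ldiff_nrm1 // /Psi -/(map iH (x :: h)) nf_inH.
  rewrite (cons_zero N) (_ : twist_rec _ _ _ _ _ _ = 0) ?scaler0 //.
  exact: (lin0 (@twist_rec_lin _ _ _ _ X _ S n (x :: h) v)).
exact: twist_rec_mlF.
Qed.
Lemma twist_nrma g h : mlin g -> nrm g -> nrm (twist h g).
Proof. by move=> mg N u v; apply: twist_rec_nrma. Qed.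

(** Contractions away from the unit leave it in place, where it counts as a letter of [A]; those
    that swallow it leave a word of [H]; absorption into a final unit gives a letter of [A]. A word
    of one letter is excluded because its twist survives ([twist_unit]). *)
Lemma ldiff_unit Psi (h1 h2 : seq H) a : (1 < size (h1 ++ 1%R :: h2)%SEQ)%N ->
    (forall u x v b, (1 < size (u ++ iA x :: v))%N -> Psi (u ++ iA x :: v) b = 0) ->
    (forall h b, Psi (map iH h) b = 0) ->
  ldiff Psi (map iH (h1 ++ 1 :: h2)) a = 0.
Proof.
elim: h1 Psi => [|x h1 IH] Psi s N1 N2.
  case: h2 s => // y h2 _; rewrite [map _ _]/= inH1 ldiff_cons mul1r.
  rewrite (N2 (y :: h2)) (@eq_ldiff _ _ _ iA _ _ (fun _ _ => 0)) ?ldiff0 ?(oppr0, subr0, addr0) // =>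
    -[//|z w] b _ _.
  by rewrite -(inA1 X); apply: (N1 [::]).
case: h1 IH s => [|y h1] IH s.
  rewrite [map _ _]/= inH1 ldiff_cons mulr1 (N2 (x :: h2)).
  case: h2 IH s => [|z h2] IH s.
    by case: (a) => [|a1 b]; rewrite /= ?(oppr0, subr0, addr0) // mul1r (N1 [:: iH x]) // !(oppr0,
      subr0, addr0).
  rewrite ldiff_cons mul1r (N2 [:: x, z & h2]).
  rewrite (@eq_ldiff _ _ _ iA _ _ (fun _ _ => 0)) ?ldiff0 ?(oppr0, subr0, addr0) // => -[//|z' w] b _ _.
  by rewrite -(inA1 X); apply: (N1 [:: iH x]).
rewrite !cat_cons [map _ _]/= ldiff_cons map_cat [map _ (1 :: _)]/= inH1 -(inA1 X).
rewrite (N1 (iH x * iH y :: map iH h1)); last by rewrite /= size_cat addnS.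
rewrite inA1 -(inH1 X) -[_ :: map iH h1 ++ _]/(map iH (y :: h1) ++ map iH (1 :: h2)) -map_cat.
rewrite (IH (fun w => Psi (iH x :: w))) ?(oppr0, subr0, addr0) //.
- by rewrite /= size_cat addnS.
- by move=> u z v b _; apply: (N1 (iH x :: u)); rewrite /= size_cat addnS.
- by move=> h b; apply: (N2 (x :: h)).
Qed.

Lemma twist_rec_nrmh n g h1 h2 a : mlin g -> nrm g -> (1 < size (h1 ++ 1%R :: h2)%SEQ)%N ->
  twist_rec X S n (h1 ++ 1 :: h2) g a = 0.
Proof.
elim: n g h1 h2 a => [|n IH] g h1 h2 a mg N s //.
pose Psi w b := nf X w (fun x hs => twist_rec X S n hs (fun y => g (x :: y)) b).
have -> : twist_rec X S n.+1 (h1 ++ 1 :: h2) g a = ldiff Psi (map iH (h1 ++ 1 :: h2)) a.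
  by case: h1 s => [|x [|y h1]] //; case: h2.
apply: ldiff_unit => // [u x v b suv|h b].
  apply: nf_letterA => [|y hs1 hs2 s1 s2]; first exact: twist_rec_mlF.
  apply: IH; [exact: mlin_cons|exact: nrm_cons|].
  by move: suv; rewrite !size_cat /= s1 s2.
rewrite /Psi nf_inH; last exact: twist_rec_mlF.
by rewrite cons_zero //; apply: (lin0 (@twist_rec_lin _ _ _ _ X _ S n h b)).
Qed.
Lemma twist_nrmh g h1 h2 a : mlin g -> nrm g -> (1 < size (h1 ++ 1%R :: h2)%SEQ)%N ->
  twist (h1 ++ 1 :: h2) g a = 0.
Proof. exact: twist_rec_nrmh. Qed.

(** The only twist by a word with a unit that survives; in [total_nrm2] it cancels the contraction
    of a final unit with the letter before it. *)
Lemma twist_unit g a : mlin g -> twist [:: 1] g a = g a.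
Proof.
elim: a g => [|x a IH] g mg; first by rewrite twist_base inH1 ract1.
rewrite twistE // [LHS]/= inH1 mul1r -[RHS](IH (fun y => g (x :: y))); last exact: mlin_cons.
rewrite twist_nfE /= inA1 mulr1 -[iA x]mulr1 -(inH1 X) esum_in //.
exact: (mlF_bil [::] (twist_mlF X S a mg)).
Qed.

Definition nrm2 phi := (forall b, nrm (phi^~ b)) /\ (forall u, nrm (phi u)).

Lemma nrm2_cons phi x : nrm2 phi -> nrm2 (fun u => phi (x :: u)).
Proof. by move=> [N1 N2]; split=> [b|u]; [apply: (nrm_cons x (N1 b))|apply: N2]. Qed.

Lemma cons_zero2 phi : nrm2 phi -> (fun u => phi (1 :: u)) = (fun _ _ => 0).
Proof. by move=> [N _]; apply: funext => u; apply: funext => b; apply: (N b [::]). Qed.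

Lemma rdiff_nrmh phi u v a : ml2 phi -> nrm2 phi ->
  rdiff phi (u ++ 1 :: v) a = if v is [::] then (-1) ^+ size u *: phi u a else 0.
Proof.
elim: u phi => [|x u IH] phi mphi N.
  rewrite /= cons_zero2 // rdiff0 subr0 scale1r.
  case: v => [|y v]; first exact: twist_unit (mphi.2 _).
  exact: (@twist_nrmh _ [::]) (mphi.2 _) (N.2 _) _.
rewrite /= (@twist_nrmh _ (x :: u)) ?sub0r; [|exact: mphi.2|exact: N.2|by rewrite /= size_cat addnS].
rewrite IH; [|exact: (ml2_cons x mphi)|exact: (nrm2_cons x N)].
by case: (v) => [|y v']; rewrite ?oppr0 // exprS mulN1r scaleNr.
Qed.

(** A unit inside the word is contracted to the left and to the right with opposite signs; a final
    unit has only one neighbour. *)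
Lemma ldiff_nrmh Psi e0 u v a :
    (forall e u x v b, Psi (e :: u ++ iA x :: v) b = 0) ->
  ldiff Psi (e0 :: u ++ 1 :: v) a = if v is [::] then - ((-1) ^+ size u *: Psi (e0 :: u) a) else 0.
Proof.
elim: u e0 Psi => [|e u IH] e0 Psi N.
  rewrite cat0s ldiff_cons mulr1; case: v => [|e v].
    case: (a) => [|a1 b]; rewrite /= scale1r ?subr0 //.
    by rewrite mul1r (N _ [::]) subr0.
  rewrite ldiff_cons mul1r opprB opprK addrCA addNr addr0.
  rewrite (@eq_ldiff _ _ _ iA _ _ (fun _ _ => 0)) ?ldiff0 // => w b _ _.
  by rewrite -(inA1 X); apply: (N _ [::]).
rewrite cat_cons ldiff_cons -{1}(inA1 X) N IH.
  by case: (v) => [|e' v']; rewrite ?(oppr0, subr0, addr0) // ?add0r exprS mulN1r scaleNr.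
by move=> e' u' x v' b; apply: (N e0 (e' :: u')).
Qed.

Lemma lext_letterA phi e u x v b : ml2 phi -> nrm2 phi -> lext phi (e :: u ++ iA x :: v) b = 0.
Proof.
move=> mphi N; rewrite /= nf_letterA ?linear0 //; first exact: lext_mlF.
by move=> a hs1 hs2 _ _; rewrite N.1 linear0.
Qed.

(** A final unit of [h] and an initial unit of [a] each leave one term in either half of [total],
    and the two terms cancel. This makes the differential descend to normalized cochains. *)
Lemma total_nrm2 phi : ml2 phi -> nrm2 phi -> nrm2 (total phi).
Proof.
move=> mphi N; split=> [b|h] u v; rewrite /total.
  rewrite map_cat [map iH (1 :: v)]/= inH1 ldiff_nrmh; last first.
    by move=> *; apply: lext_letterA.
  rewrite rdiff_nrmh //; case: v => [|y v]; rewrite ?addr0 //.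
  by rewrite lext_in // lact1 size_map addNr.
have N2 w : nrm (lext phi w).
  move=> b1 b2; case: w => [|e w] //=; rewrite (_ : nf X _ _ = 0) ?linear0 //.
  by rewrite -(nf0 X M w); apply: eq_nf => x hs _; rewrite N.2 linear0.
have R0 : rdiff phi h (u ++ 1 :: v) = if u is [::] then - ((-1) ^+ size h *: phi h v) else 0.
  elim: h phi mphi N {N2} => [|x h IH] phi mphi N.
    by case: u => [|y u]; [rewrite [LHS]rbar_nrm1 ?scale1r|rewrite [LHS]rbar_nrm] => //; apply: N.2.
  rewrite /= (twist_nrma _ (mphi.2 _) (N.2 _)) IH; [|exact: ml2_cons|exact: nrm2_cons].
  by case: (u) => [|y u']; rewrite ?(oppr0, subr0, addr0) // ?sub0r exprS mulN1r scaleNr.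
rewrite R0; case: u {R0} => [|x u]; last by rewrite ldiff_nrm ?addr0.
by rewrite cat0s ldiff_nrm1 // lext_in // lact1 size_map subrr.
Qed.
End Normalization.

(** * Crossed products as free extensions *)

Section TensorSum.
Context (k : comPzRingType) (V W P : lmodType k) (F : V -> W -> P).
Hypotheses (F1 : forall w, lin (F^~ w)) (F2 : forall v, lin (F v)).

(** Turns a sum over the chosen expression of a tensor into the value of a linear map, so that the
    choice drops out. *)
Lemma tensor_sum_ex : exists L : {linear tensor V W -> P},
  (forall v w, L (v ⊗ w) = F v w) /\ forall x, L x = \sum_(p <- tensor_terms x) F p.1 p.2.
Proof.
have BL : lin (fun v => lin_pack (F2 v)).
  by move=> c x y; apply: linear_ext => w; apply: (F1 w).
have E v w : tensor_lift (lin_pack BL) (v ⊗ w) = F v w by rewrite tensor_liftE.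
exists (tensor_lift (lin_pack BL)); split=> [//|x].
by rewrite {1}(tensor_termsE x) linear_sum; apply: eq_bigr => p _; apply: E.
Qed.

Lemma tensor_sum_pure v w : \sum_(p <- tensor_terms (v ⊗ w)) F p.1 p.2 = F v w.
Proof. by have [L [L1 L2]] := tensor_sum_ex; rewrite -L2 L1. Qed.
Lemma tensor_sum_lin : lin (fun x => \sum_(p <- tensor_terms x) F p.1 p.2).
Proof. by have [L [L1 L2]] := tensor_sum_ex; move=> c x y; rewrite -!L2 linearP. Qed.
End TensorSum.

(** * Sums over Sweedler components *)

Section Comultiplication.
Context (k : comPzRingType) (H : hopf_algebra k).

Section Val.
Context (P : lmodType k).

Definition csum (h : H) (F : H -> H -> P) : P := \sum_(p <- tensor_terms (hopf_comul H h)) F p.1 p.2.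

Definition bil2 (F : H -> H -> P) := (forall y, lin (F^~ y)) /\ (forall x, lin (F x)).

Lemma eq_csum h F G : (forall x y, F x y = G x y) -> csum h F = csum h G.
Proof. by move=> FG; apply: eq_bigr => p _; apply: FG. Qed.
Lemma csum_lin F : bil2 F -> lin (fun h => csum h F).
Proof. by move=> [F1 F2]; apply: lin_comp (tensor_sum_lin F1 F2) (linear_lin (hopf_comul H)). Qed.
Lemma csum1 F : bil2 F -> csum 1 F = F 1 1.
Proof. by move=> [F1 F2]; rewrite /csum hopf_comul1 tensor_sum_pure. Qed.
Lemma csum_counitl G h : lin G -> csum h (fun x y => (hopf_counit H x : k) *: G y) = G h.
Proof.
move=> LG; rewrite -[in RHS](hopf_counitl h) (lin_sum LG).
by apply: eq_bigr => p _; rewrite linZ.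
Qed.
Lemma csum_counitr G h : lin G -> csum h (fun x y => (hopf_counit H y : k) *: G x) = G h.
Proof.
move=> LG; rewrite -[in RHS](hopf_counitr h) (lin_sum LG).
by apply: eq_bigr => p _; rewrite linZ.
Qed.
End Val.

Lemma csum_linF (P : lmodType k) h : lin (fun F : H -> H -> P => csum h F).
Proof. by move=> c F G; rewrite /csum scaler_sumr -big_split. Qed.

Lemma csumM (P : lmodType k) (F : H -> H -> P) g h : bil2 F ->
  csum (g * h) F = csum g (fun g1 g2 => csum h (fun h1 h2 => F (g1 * h1) (g2 * h2))).
Proof.
move=> [F1 F2]; have [L [L1 L2]] := tensor_sum_ex F1 F2.
rewrite /csum hopf_comulM -L2 linear_sum; apply: eq_bigr => p _.
by rewrite linear_sum; apply: eq_bigr => q _; apply: L1.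
Qed.

Lemma csum_coassoc (P : lmodType k) (F : H -> H -> H -> P) h :
    (forall y z, lin (fun x => F x y z)) -> (forall x z, lin (fun y => F x y z)) ->
    (forall x y, lin (fun z => F x y z)) ->
  csum h (fun p q => csum q (F p)) = csum h (fun p q => csum p (fun p1 p2 => F p1 p2 q)).
Proof.
move=> L1 L2 L3.
pose G x (t : tensor H H) := \sum_(q <- tensor_terms t) F x q.1 q.2.
have G1 t : lin (G^~ t) by apply: lin_bigsum => q.
have G2 x : lin (G x) by apply: tensor_sum_lin.
have [L [LE _]] := tensor_sum_ex G1 G2.
have := congr1 L (hopf_coassoc h); rewrite !linear_sum => E.
rewrite /csum; transitivity (\sum_(p <- tensor_terms (hopf_comul H h)) L (p.1 ⊗ hopf_comul H p.2)).
  by apply: eq_bigr => p _; rewrite LE.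
rewrite E; apply: eq_bigr => p _; rewrite linear_sum; apply: eq_bigr => q _.
by rewrite LE /G tensor_sum_pure.
Qed.
End Comultiplication.

Section CrossedProductFree.
Context (k : comPzRingType) (H : hopf_algebra k) (A : algebra k).
Context (act : {linear H -> {linear A -> A}}) (f : {linear tensor H H -> A}).
Context (Hact : weak_action act) (E : crossed_product act f).

Definition cp_inA (a : A) : E := (a : A) ⊗ (1 : H).
Definition cp_inH (h : H) : E := (1 : A) ⊗ (h : H).
Fact cp_inA_linear : linear cp_inA.
Proof. by move=> c x y; rewrite /cp_inA tpureDl tpureZl. Qed.
Fact cp_inH_linear : linear cp_inH.
Proof. by move=> c x y; rewrite /cp_inH tpureDr tpureZr. Qed.
HB.instance Definition _ := GRing.isLinear.Build k A E *:%R cp_inA cp_inA_linear.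
HB.instance Definition _ := GRing.isLinear.Build k H E *:%R cp_inH cp_inH_linear.

Lemma tpure_linl (V W : lmodType k) (w : W) : lin (fun v : V => v ⊗ w).
Proof. by move=> c x y; rewrite tpureDl tpureZl. Qed.
Lemma tpure_linr (V W : lmodType k) (v : V) : lin (fun w : W => v ⊗ w).
Proof. by move=> c x y; rewrite tpureDr tpureZr. Qed.

Lemma lmulA_ex (a : A) : exists L : {linear tensor A H -> tensor A H}, forall b h, L (b ⊗ h) = (a * b) ⊗ h.
Proof.
have [|b|L [LE _]] := @tensor_sum_ex k A H _ (fun b h => (a * b) ⊗ h).
- by move=> h c x y; rewrite mulrDr -algZr tpureDl tpureZl.
- exact: tpure_linr.
by exists L.
Qed.

Local Notation mulE x y := (cp_mul E x y).

Lemma act1 h : act h 1 = (hopf_counit H h : k) *: (1 : A).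
Proof. by case: Hact. Qed.
Lemma act_unit a : act 1 a = a.
Proof. by case: Hact. Qed.
Lemma act_mul h a b : act h (a * b) = csum h (fun x y => act x a * act y b).
Proof. by case: Hact => ->. Qed.

(** The product (c # y)(1 # l) with the action on 1 already evaluated; the unit laws of [E]
    determine it when [y] or [l] is 1. *)
Definition cp_ker (c : A) (y l : H) : tensor A H :=
  csum y (fun y1 z => csum l (fun l1 l2 => (c * f (y1 ⊗ l1)) ⊗ (z * l2))).

Lemma cp_mul_ker a h b l : mulE ((a : A) ⊗ (h : H)) ((b : A) ⊗ (l : H)) =
  csum h (fun x y => cp_ker (a * act x b) y l).
Proof. by rewrite cp_mulE. Qed.

Lemma f_linl (y : H) : lin (fun x : H => f (x ⊗ y)).
Proof. by move=> c x z; rewrite tpureDl tpureZl linearP. Qed.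
Lemma f_linr (x : H) : lin (fun y : H => f (x ⊗ y)).
Proof. by move=> c y z; rewrite tpureDr tpureZr linearP. Qed.

Let inner_bil c y1 z : bil2 (fun l1 l2 : H => (c * f (y1 ⊗ l1)) ⊗ (z * l2)).
Proof.
split=> [l2|l1].
- apply: lin_comp (@tpure_linl A H _) _; apply: lin_comp (mulr_lin _) (f_linr _).
- by apply: lin_comp (@tpure_linr A H _) (mulr_lin _).
Qed.
Let outer_bil c l : bil2 (fun y1 z : H => csum l (fun l1 l2 => (c * f (y1 ⊗ l1)) ⊗ (z * l2))).
Proof.
split=> [z|y1]; apply: lin_bigsum => p.
- apply: lin_comp (@tpure_linl A H _) _; apply: lin_comp (mulr_lin _) (f_linl _).
- by apply: lin_comp (@tpure_linr A H _) (mulr_linr _).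
Qed.

Lemma cp_ker_linm c l : lin (fun y => cp_ker c y l).
Proof. exact/csum_lin/outer_bil. Qed.
Lemma cp_ker_linl y l : lin (fun c => cp_ker c y l).
Proof.
apply: lin_bigsum => p; apply: lin_bigsum => q.
by apply: lin_comp (@tpure_linl A H _) _; apply: mulr_linr.
Qed.
Lemma cp_ker_mul c y l b h : cp_ker 1 y l = (b : A) ⊗ (h : H) -> cp_ker c y l = (c * b) ⊗ h.
Proof.
have [L LE] := lmulA_ex c; move=> K1; rewrite -LE -K1 /cp_ker linear_sum.
apply: eq_bigr => p _; rewrite linear_sum; apply: eq_bigr => q _.
by rewrite LE mul1r.
Qed.

(** This takes the place of the condition f(h, 1) = ε(h), which is not a field of [crossed_product]
    but is contained in the right unit law. *)
Lemma cp_ker1r c y : cp_ker c y 1 = c ⊗ y.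
Proof.
rewrite (@cp_ker_mul c y 1 1 y) ?mulr1 // -[RHS](cp_mul1r E) cp_mul_ker.
rewrite -[LHS](csum_counitl _ (cp_ker_linm 1 1)); apply: eq_csum => x z.
by rewrite act1 mul1r (linZ (cp_ker_linl _ _)).
Qed.

Let act_ker_bil a b l : bil2 (fun x y : H => cp_ker (a * act x b) y l).
Proof.
split=> [y|x]; last exact: cp_ker_linm.
apply: lin_comp (cp_ker_linl y l) _; apply: lin_comp (mulr_lin a) _.
by move=> c x z; rewrite linearP.
Qed.

Lemma cp_ker1l c l : cp_ker c 1 l = c ⊗ l.
Proof.
rewrite (@cp_ker_mul c 1 l 1 l) ?mulr1 // -[RHS](cp_mul1l E) cp_mul_ker.
by rewrite csum1 // act_unit mulr1.
Qed.

Lemma mul_inA_tensor a b l : cp_inA a * ((b ⊗ l : tensor A H) : E) = (a * b) ⊗ l.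
Proof.
rewrite -[LHS]/(mulE (a ⊗ (1 : H)) (b ⊗ l)) cp_mul_ker csum1 // act_unit.
exact: cp_ker1l.
Qed.

Lemma mul_inA_inH a h : cp_inA a * cp_inH h = (a ⊗ h : tensor A H).
Proof. by rewrite mul_inA_tensor mulr1. Qed.

Lemma mul_inH_inA h a : cp_inH h * cp_inA a = csum h (fun x y => cp_inA (act x a) * cp_inH y).
Proof.
rewrite -[LHS]/(mulE ((1 : A) ⊗ (h : H)) (a ⊗ (1 : H))) cp_mul_ker.
by apply: eq_csum => x y; rewrite mul1r cp_ker1r mul_inA_inH.
Qed.

Lemma mul_inH_inH h l : cp_inH h * cp_inH l =
  csum h (fun x y => csum l (fun l1 l2 => cp_inA (f (x ⊗ l1)) * cp_inH (y * l2))).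
Proof.
rewrite -[LHS]/(mulE ((1 : A) ⊗ (h : H)) ((1 : A) ⊗ (l : H))) cp_mul_ker.
transitivity (cp_ker 1 h l).
  rewrite -[RHS](csum_counitl _ (cp_ker_linm 1 l)); apply: eq_csum => x z.
  by rewrite act1 mul1r (linZ (cp_ker_linl _ _)).
by apply: eq_csum => x y; apply: eq_csum => l1 l2; rewrite mul1r mul_inA_inH.
Qed.

Lemma cp_inA_mul a b : cp_inA (a * b) = cp_inA a * cp_inA b.
Proof. by rewrite mul_inA_tensor. Qed.

Fact cp_sum e : e = \sum_(p <- tensor_terms (e : tensor A H)) cp_inA p.1 * cp_inH p.2.
Proof.
rewrite [LHS](tensor_termsE (e : tensor A H)).
by apply: eq_bigr => p _; rewrite mul_inA_inH.
Qed.
Fact cp_esumE (P : lmodType k) (F : A -> H -> P) :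
  (forall h, lin (F^~ h)) -> (forall a, lin (F a)) ->
  forall a h, \sum_(p <- tensor_terms (cp_inA a * cp_inH h : tensor A H)) F p.1 p.2 = F a h.
Proof. by move=> F1 F2 a h; rewrite mul_inA_inH tensor_sum_pure. Qed.

Definition cp_free : free_extension A H E :=
  @FreeExtension k A H E cp_inA cp_inH (fun e => tensor_terms (e : tensor A H))
    erefl erefl cp_inA_mul cp_sum (fun P F F1 F2 => tensor_sum_lin F1 F2) cp_esumE.
End CrossedProductFree.
Arguments cp_free : simpl never.

(** * Comultiplication of words *)

Section SweedlerWords.
Context (k : comPzRingType) (H : hopf_algebra k).

Section Val.
Context (P : lmodType k).
Implicit Types (e : seq H -> seq H -> P).

(** Equal to [sweedler2] ([sweedler2_s2]), but recursive letter by letter and thus open to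
    induction. *)
Fixpoint s2 (h : seq H) e : P :=
  if h is x :: h' then csum x (fun p q => s2 h' (fun u v => e (p :: u) (q :: v))) else e [::] [::].

Lemma eq_s2 h e e' : (forall u v, size u = size h -> size v = size h -> e u v = e' u v) -> s2 h e = s2 h e'.
Proof.
elim: h e e' => [|x h IH] e e' ee /=; first exact: ee.
by apply: eq_csum => p q; apply: IH => u v su sv; apply: ee; rewrite /= (su, sv).
Qed.
Lemma s2_linF h : lin (fun e => s2 h e).
Proof.
elim: h => [|x h IH] c F G //=; rewrite -csum_linF; apply: eq_csum => p q.
exact: (IH c (fun u v => F (p :: u) (q :: v)) (fun u v => G (p :: u) (q :: v))).
Qed.
Lemma s2_lin (V : lmodType k) h (e : V -> seq H -> seq H -> P) :
  (forall u v, lin (fun x => e x u v)) -> lin (fun x => s2 h (e x)).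
Proof.
move=> L c x y; rewrite -s2_linF; apply: eq_s2 => u v _ _; exact: L.
Qed.
Lemma s2_mlin e : (forall v, mlin (e^~ v)) -> (forall u, mlin (e u)) -> mlin (fun h => s2 h e).
Proof.
move=> m1 m2 h1; elim: h1 e m1 m2 => [|x h1 IH] e m1 m2 h2 /=.
  apply: csum_lin; split=> [q|p].
    by apply: s2_lin => u v; exact: (m1 (q :: v) [::] u).
  by apply: s2_lin => u v; exact: (m2 (p :: u) [::] v).
apply: lin_bigsum => p; apply: IH => [v|u].
  by move=> u1 u2; exact: (m1 (p.2 :: v) (p.1 :: u1) u2).
by move=> u1 u2; exact: (m2 (p.1 :: u) (p.2 :: u1) u2).
Qed.

Lemma sweedler2_s2 h e : sweedler2 h e = s2 h e.
Proof.
rewrite /sweedler2.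
suff E (e' : seq (seq H) -> P) : sweedler_word 2 h e' = s2 h (fun u v => e' [:: u; v]) by rewrite E.
elim: h e' => [|x h IH] e' //.
rewrite -[LHS]/(csum x (fun p q => sweedler_word 2 h (fun R => e' [seq y.1 :: y.2 | y <- zip [:: p; q] R]))).
by apply: eq_csum => p q; rewrite IH.
Qed.
End Val.

Lemma csum_fun2 (P : lmodType k) (T U : Type) x (G : H -> H -> T -> U -> P) u v :
  (csum x G : T -> U -> P) u v = csum x (fun p q => G p q u v).
Proof. by rewrite /csum; elim/big_rec2: _ => // p _ y _ <-. Qed.

Lemma csum_fun1 (P : lmodType k) (T : Type) x (G : H -> H -> T -> P) u :
  (csum x G : T -> P) u = csum x (fun p q => G p q u).
Proof. by rewrite /csum; elim/big_rec2: _ => // p _ y _ <-. Qed.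

Lemma lin_csum (P Q : lmodType k) (T : P -> Q) x (G : H -> H -> P) :
  lin T -> T (csum x G) = csum x (fun p q => T (G p q)).
Proof. by move=> L; rewrite /csum (lin_sum L). Qed.

Lemma s2_csum (P : lmodType k) h x (G : H -> H -> seq H -> seq H -> P) :
  s2 h (fun u v => csum x (fun p q => G p q u v)) = csum x (fun p q => s2 h (G p q)).
Proof.
rewrite -(lin_csum x G (@s2_linF P h)); apply: eq_s2 => u v _ _.
by rewrite csum_fun2.
Qed.

Lemma lin_s2 (P Q : lmodType k) (T : P -> Q) h (e : seq H -> seq H -> P) :
  lin T -> T (s2 h e) = s2 h (fun u v => T (e u v)).
Proof.
move=> L; elim: h e => [|x h IH] e //=; rewrite (lin_csum _ _ L).
by apply: eq_csum => p q; apply: IH.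
Qed.

Lemma s2_coassoc (P : lmodType k) h (e : seq H -> seq H -> seq H -> P) :
    (forall q v, mlin (fun p => e p q v)) -> (forall p v, mlin (fun q => e p q v)) ->
    (forall p q, mlin (fun v => e p q v)) ->
  s2 h (fun u v => s2 u (fun p q => e p q v)) = s2 h (fun p r => s2 r (fun q v => e p q v)).
Proof.
elim: h e => [|x h IH] e m1 m2 m3 //=.
transitivity (csum x (fun x1 x2 => csum x1 (fun p q =>
    s2 h (fun u v => s2 u (fun p' q' => e (p :: p') (q :: q') (x2 :: v)))))).
  by apply: eq_csum => x1 x2; rewrite s2_csum.
rewrite -(@csum_coassoc k H P (fun p q x2 =>
    s2 h (fun u v => s2 u (fun p' q' => e (p :: p') (q :: q') (x2 :: v))))).
- apply: eq_csum => x1 x2; rewrite s2_csum; apply: eq_csum => p q.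
  apply: (IH (fun a b c => e (x1 :: a) (p :: b) (q :: c))).
  + by move=> b v; apply: (mlin_cons x1 (m1 _ _)).
  + by move=> b v; apply: (mlin_cons p (m2 _ _)).
  + by move=> b v; apply: (mlin_cons q (m3 _ _)).
- by move=> y z; do 2!apply: s2_lin => ? ?; apply: (mlin_head _ (m1 _ _)).
- by move=> y z; do 2!apply: s2_lin => ? ?; apply: (mlin_head _ (m2 _ _)).
- by move=> y z; do 2!apply: s2_lin => ? ?; apply: (mlin_head _ (m3 _ _)).
Qed.

(** The counit of a tensor power of [H]. *)
Fixpoint eps (h : seq H) : k := if h is x :: h' then (hopf_counit H x : k) * eps h' else 1.

Lemma s2_counitl (P : lmodType k) h (e : seq H -> P) : mlin e ->
  s2 h (fun u v => eps u *: e v) = e h.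
Proof.
elim: h e => [|x h IH] e me /=; first by rewrite scale1r.
rewrite -[RHS](csum_counitl x (mlin_head h me)); apply: eq_csum => p q.
rewrite -(IH _ (mlin_cons q me)).
rewrite (lin_s2 (T := fun z => (hopf_counit H p : k) *: z)); last exact: lin_scale.
by apply: eq_s2 => u v _ _; rewrite scalerA.
Qed.
Lemma s2_counitr (P : lmodType k) h (e : seq H -> P) : mlin e ->
  s2 h (fun u v => eps v *: e u) = e h.
Proof.
elim: h e => [|x h IH] e me /=; first by rewrite scale1r.
rewrite -[RHS](csum_counitr x (mlin_head h me)); apply: eq_csum => p q.
rewrite -(IH _ (mlin_cons p me)).
rewrite (lin_s2 (T := fun z => (hopf_counit H q : k) *: z)); last exact: lin_scale.
by apply: eq_s2 => u v _ _; rewrite scalerA.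
Qed.

Lemma sweedler_word0 (P : lmodType k) h (e : seq (seq H) -> P) : sweedler_word 0 h e = eps h *: e [::].
Proof.
elim: h e => [|x h IH] e /=; first by rewrite scale1r.
by rewrite IH /= scalerA.
Qed.

Lemma sweedler_word1 (P : lmodType k) h (e : seq (seq H) -> P) : sweedler_word 1 h e = e [:: h].
Proof. by elim: h e => [|x h IH] e //=; rewrite IH. Qed.

Lemma sweedler_linF (P : lmodType k) n x : lin (fun e : seq H -> P => sweedler n x e).
Proof.
case: n => [|n] c F G; first by rewrite /= scalerDr !scalerA mulrC.
elim: n x F G => [|n IH] x F G //.
transitivity (csum x (c *: (fun p q => sweedler n.+1 q (fun w => F (p :: w))) +
    (fun p q => sweedler n.+1 q (fun w => G (p :: w))))); last exact: csum_linF.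
rewrite -[LHS]/(csum x (fun p q => sweedler n.+1 q (fun w => (c *: F + G) (p :: w)))).
apply: eq_csum => p q.
exact: (IH q (fun w => F (p :: w)) (fun w => G (p :: w))).
Qed.

Lemma lin_sweedler (P Q : lmodType k) (T : P -> Q) n x (e : seq H -> P) :
  lin T -> T (sweedler n x e) = sweedler n x (fun w => T (e w)).
Proof.
move=> L; case: n => [|n]; first by rewrite /= linZ.
elim: n x e => [|n IH] x e //.
rewrite -[LHS]/(T (csum x (fun p q => sweedler n.+1 q (fun w => e (p :: w))))) (lin_csum _ _ L).
rewrite -[RHS]/(csum x (fun p q => sweedler n.+1 q (fun w => T (e (p :: w))))).
by apply: eq_csum => p q; rewrite IH.
Qed.
Lemma lin_sweedler_word (P Q : lmodType k) (T : P -> Q) n h (e : seq (seq H) -> P) :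
  lin T -> T (sweedler_word n h e) = sweedler_word n h (fun R => T (e R)).
Proof.
move=> L; elim: h e => [|x h IH] e //=; rewrite lin_sweedler //.
by congr (sweedler n x _); apply: funext => w; rewrite IH.
Qed.

(** [sweedler_word] splits each letter completely before going to the next; here the first
    components of all letters are split off together, the form that coassociativity of words
    needs. *)
Lemma sweedler_wordS (P : lmodType k) n h (e : seq (seq H) -> P) :
  sweedler_word n.+2 h e = s2 h (fun u v => sweedler_word n.+1 v (fun R => e (u :: R))).
Proof.
elim: h e => [|x h IH] e //.
rewrite -[LHS]/(csum x (fun p q => sweedler n.+1 q (fun w => sweedler_word n.+2 h
  (fun R => e [seq y.1 :: y.2 | y <- zip (p :: w) R])))).
apply: eq_csum => p q.
transitivity (sweedler n.+1 q (fun w => s2 h (fun u v => sweedler_word n.+1 v (fun R => e ((p :: u) ::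
  [seq y.1 :: y.2 | y <- zip w R]))))).
  by congr (sweedler n.+1 q _); apply: funext => w; rewrite IH.
pose G w u v := sweedler_word n.+1 v (fun R => e ((p :: u) :: [seq y.1 :: y.2 | y <- zip w R])).
rewrite -[LHS]/(sweedler n.+1 q (fun w => s2 h (G w))).
rewrite -(lin_sweedler n.+1 q (G : seq H -> (seq H -> seq H -> P)) (@s2_linF P h)).
apply: eq_s2 => u v _ _; rewrite {}/G.
have V (T U : Type) (G : seq H -> T -> U -> P) a b : (sweedler n.+1 q G
  : T -> U -> P) a b = sweedler n.+1 q (fun w => G w a b).
  by rewrite (lin_sweedler (T := fun g : T -> U -> P => g a b)).
by rewrite V.
Qed.
End SweedlerWords.

(** * Normal forms of words in a crossed product *)

Section CrossedWords.
Context (k : comPzRingType) (H : hopf_algebra k) (A : algebra k).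
Context (act : {linear H -> {linear A -> A}}) (f : {linear tensor H H -> A}).
Context (Hact : weak_action act) (E : crossed_product act f).
Local Notation X := (cp_free Hact E).
Local Notation iA := (inA X).
Local Notation iH := (inH X).

Lemma act_linh (a : A) : lin (fun h : H => act h a).
Proof. by move=> c x y; rewrite linearP. Qed.

Lemma act_bar_lin u : lin (fun a : A => act_bar act a u).
Proof.
elim: u => [|h u IH] //=.
exact: (lin_comp (linear_lin (act h)) IH).
Qed.
Lemma act_bar_mlin (a : A) : mlin (act_bar act a).
Proof.
move=> u v; elim: u => [|h u IH]; first exact: act_linh.
exact: (lin_comp (linear_lin (act h)) IH).
Qed.

Section Val.
Context (P : lmodType k).
Implicit Types (F : A -> seq H -> P).

(** The hinge between the two languages: [con_s2] reads it as the cocycle term f(...) raised to the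
    preceding letters, [con_nf] as the product of two adjacent letters in [E]. *)
Fixpoint con (j : nat) (h : seq H) F : P :=
  match j, h with
  | 0, x :: y :: h' => csum x (fun p q => csum y (fun r s => F (f (p ⊗ r)) (q * s :: h')))
  | j'.+1, x :: h' => csum x (fun p q => con j' h' (fun y u => F (act p y) (q :: u)))
  | _, _ => 0
  end.

Lemma con_linF j h : lin (fun F => con j h F).
Proof.
elim: j h => [|j IH] [|x h] c F G; rewrite ?scaler0 ?addr0 //.
  case: h => [|y h] /=; rewrite ?scaler0 ?addr0 //.
  by rewrite -csum_linF; apply: eq_csum => p q; rewrite -[RHS]csum_linF.
rewrite /= -csum_linF; apply: eq_csum => p q.
exact: (IH h c (fun y u => F (act p y) (q :: u)) (fun y u => G (act p y) (q :: u))).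
Qed.

Lemma eq_con j h F G : (forall y u, (size u).+1 = size h -> F y u = G y u) -> con j h F = con j h G.
Proof.
elim: j h F G => [|j IH] [|x h] F G FG //=.
  by case: h FG => [|y h] FG //; do 2!apply: eq_csum => ? ?; apply: FG.
by apply: eq_csum => p q; apply: IH => y u su; apply: FG; rewrite /= su.
Qed.

Lemma con_lin (V : lmodType k) j h (F : V -> A -> seq H -> P) :
  (forall y u, lin (fun x => F x y u)) -> lin (fun x => con j h (F x)).
Proof. by move=> L c x y; rewrite -con_linF; apply: eq_con => z u _; apply: L. Qed.

Lemma con_csum j h x (G : H -> H -> A -> seq H -> P) :
  con j h (fun y u => csum x (fun p q => G p q y u)) = csum x (fun p q => con j h (G p q)).
Proof.
rewrite -(lin_csum x G (@con_linF j h)); apply: eq_con => y u _.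
by rewrite csum_fun2.
Qed.

Lemma con_mlin j F : mlF F -> mlin (fun h => con j h F).
Proof.
elim: j F => [|j IH] F mF.
  case=> [|x [|y h]] v /=.
  - case: v => [|y v]; first exact: lin_zero.
    apply: csum_lin; split=> [q|p]; apply: lin_bigsum => r.
      by apply: (lin_comp (mF.1 _)) => c x z; rewrite tpureDl tpureZl linearP.
    by apply: (lin_comp (mlin_head _ (mF.2 _))) => c x z; rewrite mulrDl -algZl.
  - apply: lin_bigsum => p; apply: csum_lin; split=> [q|r].
      by apply: (lin_comp (mF.1 _)) => c z z'; rewrite tpureDr tpureZr linearP.
    by apply: (lin_comp (mlin_head _ (mF.2 _))) => c z z'; rewrite mulrDr -algZr.
  - by do 2!apply: lin_bigsum => ?; apply: (mF.2 _ (_ :: _)).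
case=> [|x h] v /=.
  apply: csum_lin; split=> [q|p]; apply: con_lin => y u.
    exact: (lin_comp (mF.1 _) (act_linh y)).
  exact: mlin_head (mF.2 _).
apply: lin_bigsum => p; apply: IH; split=> [u|y].
  exact: (lin_comp (mF.1 _) (linear_lin (act p.1))).
exact: (mlin_cons _ (mF.2 _)).
Qed.

Lemma con_s2 j h F : (j.+1 < size h)%N ->
  con j h F = s2 (take j.+2 h) (fun u v => F (cocycle_at act f j u) (contract j v ++ drop j.+2 h)).
Proof.
elim: j h F => [|j IH] [|x h] F //=.
  by case: h => [|y h] //= _; rewrite take0 drop0 /=.
move=> jh; apply: eq_csum => p q.
by rewrite IH //=; case: h {jh} => [|y h].
Qed.

Lemma esum_mul_inH x (y : A) (F : A -> H -> P) : (forall h, lin (F^~ h)) -> (forall a, lin (F a)) ->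
  esum X (iH x * iA y) F = csum x (fun p q => F (act p y) q).
Proof.
move=> L1 L2; rewrite [iH x * iA y](mul_inH_inA Hact E x y).
rewrite (lin_csum x (fun p q => cp_inA E (act p y) * cp_inH E q) (T := fun e => esum X e F));
  last exact: esum_linl.
by apply: eq_csum => p q; apply: esum_in.
Qed.

Lemma nf_cons_inH x w F : mlF F ->
  nf X (iH x :: w) F = csum x (fun p q => nf X w (fun y hs => F (act p y) (q :: hs))).
Proof.
move=> mF.
rewrite -(lin_csum x (fun p q y hs => F (act p y) (q :: hs)) (T := fun G => nf X w G)); last exact: nf_linF.
apply: (@eq_nf _ _ _ _ X _ w) => y hs _; rewrite csum_fun2 esum_mul_inH //.
- by move=> h; apply: mF.1.
- by move=> a; apply: mlin_head (mF.2 _).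
Qed.

Lemma mlF_act F p q : mlF F -> mlF (fun y hs => F (act p y) (q :: hs)).
Proof.
move=> mF; split=> [u|y].
  exact: (lin_comp (mF.1 _) (linear_lin (act p))).
exact: (mlin_cons _ (mF.2 _)).
Qed.

(** Commuting [x] to the left past the letters of [h], starting with the last one, by the rule h a =
    a^(h^(1)) h^(2) of [E], is the iterated action [act_bar]. *)
Lemma pass_nf x h F : mlF F -> (0 < size h)%N ->
  s2 h (fun u v => F (act_bar act x u) v) = nf X (rmul iA (map iH h) x) F.
Proof.
elim: h F => [|y [|z h] IH] F mF // _.
  rewrite -[RHS]/(esum X (iH y * iA x * iA 1) (fun a h => F a [:: h])) inA1 mulr1 esum_mul_inH //.
  - by move=> h; apply: mF.1.
  - by move=> a; apply: mlin_head (mF.2 _).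
rewrite -[rmul _ _ _]/(iH y :: rmul iA (map iH (z :: h)) x) nf_cons_inH //.
by apply: eq_csum => p q; rewrite -IH //; apply: mlF_act.
Qed.

Lemma con_nf j h F : mlF F -> (j.+1 < size h)%N ->
  con j h F = nf X (contract j (map iH h)) F.
Proof.
elim: j h F => [|j IH] [|x h] F mF //.
  case: h => [|y h] // _; rewrite -[contract _ _]/([:: iH x * iH y & drop 0 (map iH h)]) drop0.
  rewrite -[RHS]/(nf X (map iH h) (fun b hs => esum X (iH x * iH y * iA b) (fun a h' => F a (h' :: hs)))).
  rewrite nf_inH; last exact: mlF_step.
  rewrite inA1 mulr1 [iH x * iH y](mul_inH_inH Hact E x y).
  pose T e := esum X e (fun a h' => F a (h' :: h)).
  have LT : lin T by apply/esum_linl/mlF_bil.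
  rewrite -[RHS]/(T _) (lin_csum _ _ LT); apply: eq_csum => p q.
  rewrite (lin_csum _ _ LT); apply: eq_csum => r s.
  by rewrite /T (esum_in X _ _ (mlF_bil h mF)).
move=> jh; rewrite -[contract _ _]/(iH x :: contract j (map iH h)) nf_cons_inH //.
by apply: eq_csum => p q; rewrite -IH //; apply: mlF_act.
Qed.
End Val.

Lemma lin_con (P Q : lmodType k) (T : P -> Q) j h (F : A -> seq H -> P) :
  lin T -> T (con j h F) = con j h (fun y u => T (F y u)).
Proof.
move=> L; elim: j h F => [|j IH] [|x h] F /=; rewrite ?(lin0 L) //.
  case: h => [|y h] /=; rewrite ?(lin0 L) // (lin_csum _ _ L); apply: eq_csum => p q.
  by rewrite (lin_csum _ _ L).
by rewrite (lin_csum _ _ L); apply: eq_csum => p q; apply: IH.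
Qed.

(** Since comultiplication is multiplicative, contracting and then splitting a word is splitting it
    and contracting both halves; only the left half produces a value of [f], the right one is
    contracted by the product of [H]. *)
Lemma s2_con (P : lmodType k) j w (F : A -> seq H -> seq H -> P) :
    (forall u v, lin (fun y => F y u v)) -> (forall y v, mlin (fun u => F y u v)) ->
    (forall y u, mlin (fun v => F y u v)) -> (j.+1 < size w)%N ->
  s2 w (fun u v => con j u (fun y u' => F y u' (contract j v))) =
  con j w (fun y w' => s2 w' (F y)).
Proof.
elim: j w F => [|j IH] [|x w] F m1 m2 m3 //.
  case: w => [|y w] // _.
  pose S p p' p2 q q' q2 := s2 w (fun u v => F (f (p ⊗ q)) (p' * q' :: u) (p2 * q2 :: v)).
  have S1 p' p2 q q' q2 : lin (fun p => S p p' p2 q q' q2).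
    by apply: s2_lin => u v; apply: (lin_comp (m1 _ _)) => c a b; rewrite tpureDl tpureZl linearP.
  have S4 p p' p2 q' q2 : lin (fun q => S p p' p2 q q' q2).
    by apply: s2_lin => u v; apply: (lin_comp (m1 _ _)) => c a b; rewrite tpureDr tpureZr linearP.
  have S2 p p2 q q' q2 : lin (fun p' => S p p' p2 q q' q2).
    by apply: s2_lin => u v; apply: (lin_comp (mlin_head _ (m2 _ _)) (mulr_linr _)).
  have S5 p p' p2 q q2 : lin (fun q' => S p p' p2 q q' q2).
    by apply: s2_lin => u v; apply: (lin_comp (mlin_head _ (m2 _ _)) (mulr_lin _)).
  have S3 p p' q q' q2 : lin (fun p2 => S p p' p2 q q' q2).
    by apply: s2_lin => u v; apply: (lin_comp (mlin_head _ (m3 _ _)) (mulr_linr _)).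
  have S6 p p' p2 q q' : lin (fun q2 => S p p' p2 q q' q2).
    by apply: s2_lin => u v; apply: (lin_comp (mlin_head _ (m3 _ _)) (mulr_lin _)).
  (* Both letters are split into three components; coassociativity regroups them so that [csumM]
     recognises the comultiplication of the product of the last parts. *)
  transitivity (csum x (fun p1 p2 => csum p1 (fun p p' =>
     csum y (fun q s => csum s (fun q' q2 => S p p' p2 q q' q2))))).
    apply: eq_csum => p1 p2; rewrite -[LHS]/(csum y (fun q1 q2 => s2 w (fun u v => csum p1 (fun p p' =>
      csum q1 (fun q q' => F (f (p ⊗ q)) (p' * q' :: u) (contract 0 [:: p2, q2 & v])))))).
    transitivity (csum y (fun q1 q2 => csum p1 (fun p p' => csum q1 (fun q q' => S p p' p2 q q' q2)))).
      apply: eq_csum => q1 q2; rewrite (@s2_csum k H P w p1 (fun p p' u v =>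
        csum q1 (fun q q' => F (f (p ⊗ q)) (p' * q' :: u) (contract 0 [:: p2, q2 & v])))).
      apply: eq_csum => p p'.
      rewrite (@s2_csum k H P w q1 (fun q q' u v => F (f (p ⊗ q)) (p' * q' :: u) (contract 0 [:: p2, q2 & v]))).
      apply: eq_csum => q q'; apply: eq_s2 => u v _ _.
      by rewrite /contract /= drop0.
    transitivity (csum p1 (fun p p' => csum y (fun q1 q2 => csum q1 (fun q q' => S p p' p2 q q' q2)))).
      by rewrite /csum exchange_big.
    by apply: eq_csum => p p'; rewrite -csum_coassoc.
  rewrite -(@csum_coassoc k H P (fun p p' p2 => csum y (fun q s => csum s (fun q' q2 => S p p' p2 q q' q2)))).
  - apply: eq_csum => p r.
    transitivity (csum y (fun q s => csum r (fun p' p2 => csum s (fun q' q2 => S p p' p2 q q' q2)))).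
      by rewrite /csum exchange_big.
    apply: eq_csum => q s; rewrite [RHS]/= csumM //; split=> [z|z]; apply: s2_lin => u v.
      exact: mlin_head (m2 _ _).
    exact: mlin_head (m3 _ _).
  - by move=> a b; do 2!apply: lin_bigsum => ?; apply: S1.
  - by move=> a b; do 2!apply: lin_bigsum => ?; apply: S2.
  - by move=> a b; do 2!apply: lin_bigsum => ?; apply: S3.
move=> jw; rewrite [RHS]/=.
transitivity (csum x (fun x1 x2 => csum x1 (fun p q => con j w (fun y h' => s2 h' (fun u v => F (act p
  y) (q :: u) (x2 :: v)))))).
  apply: eq_csum => x1 x2.
  rewrite -[LHS]/(s2 w (fun u v => csum x1 (fun p q => con j u (fun y u' => F (act p y) (q :: u') (x2
    :: contract j v))))).
  rewrite (@s2_csum k H P w x1 (fun p q u v => con j u (fun y u' => F (act p y) (q :: u') (x2 ::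
    contract j v)))).
  apply: eq_csum => p q.
  rewrite -(IH w (fun y u v => F (act p y) (q :: u) (x2 :: v))) //.
  - by move=> u v; apply: (lin_comp (m1 _ _) (linear_lin (act p))).
  - by move=> y v; apply: (mlin_cons q (m2 _ _)).
  - by move=> y u; apply: (mlin_cons x2 (m3 _ _)).
rewrite -(@csum_coassoc k H P (fun p q x2 => con j w (fun y h' => s2 h' (fun u v => F (act p y) (q ::
  u) (x2 :: v))))).
- by apply: eq_csum => p r; rewrite con_csum.
- by move=> y z; apply: con_lin => a u; apply: s2_lin => b c; apply: (lin_comp (m1 _ _) (act_linh a)).
- by move=> y z; apply: con_lin => a u; apply: s2_lin => b c; apply: (mlin_head _ (m2 _ _)).
- by move=> y z; apply: con_lin => a u; apply: s2_lin => b c; apply: (mlin_head _ (m3 _ _)).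
Qed.
End CrossedWords.

(** * The maps F *)

Section LdiffSum.
Context (k : comPzRingType) (A E : algebra k) (iA : {linear A -> E}) (P : lmodType k).

Lemma ldiff_sum (Psi : seq E -> seq A -> P) w a :
  ldiff iA Psi w a = \sum_(j < (size w).-1) (-1) ^+ j.+1 *: Psi (contract j w) a
    + (if (w, a) is (_ :: _, x :: a') then (-1) ^+ (size w).-1 *: Psi (rmul iA w x) a' else 0).
Proof.
elim: w Psi => [|e [|e' w] IH] Psi; first by rewrite big_ord0 addr0.
  by rewrite big_ord0 add0r; case: a {IH} => [|x a]; rewrite //= scale1r.
rewrite ldiff_cons (IH (fun u => Psi (e :: u))) opprD addrA; congr (_ + _).
  rewrite [RHS]big_ord_recl -sumrN; congr (_ + _).
    by rewrite expr1 scaleN1r /contract /= drop0.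
  by apply: eq_bigr => j _; rewrite [in RHS]exprS mulN1r scaleNr.
by case: a {IH} => [|x a]; rewrite ?oppr0 // [in RHS]exprS mulN1r scaleNr.
Qed.
End LdiffSum.

Section Products.
Context (k : comPzRingType) (B : algebra k).

Lemma prod_mlin : mlin (fun v : seq B => \prod_(x <- v) x).
Proof.
move=> u v c x y; rewrite !big_cat !big_cons /= mulrDl -algZl.
exact: mulr_lin.
Qed.
Lemma prod_contract j (v : seq B) : (j.+1 < size v)%N -> \prod_(x <- contract j v) x = \prod_(x <- v) x.
Proof.
elim: j v => [|j IH] [|x v] //.
  by case: v => [|y v] // _; rewrite /contract /= drop0 !big_cons mulrA.
move=> jv; rewrite -[contract _ _]/(x :: contract j v) !big_cons IH //.
Qed.
End Products.

Section Prefix.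
Context (k : comPzRingType) (A : algebra k).
Local Notation fam := (forall n, tpow (bar A) n).

Lemma pre1_lin (T : fam) n : lin (fun y => pre [:: y] T n).
Proof.
case: n => [|n] /=; first exact: lin_zero.
by move=> c x y; rewrite linearP tpureDl tpureZl.
Qed.
Lemma pre1_linT (V : lmodType k) y n (T : V -> fam) : (forall n, lin (fun x => T x n)) ->
  lin (fun x => pre [:: y] (T x) n).
Proof.
move=> L; case: n => [|n] /=; first exact: lin_zero.
by move=> c u v; rewrite L tpureDr tpureZr.
Qed.
Lemma pre_mlin (T : fam) n : mlin (fun w => pre w T n).
Proof.
move=> u; elim: u n => [|x u IH] n v c y z; rewrite ?cat0s.
  by case: n => [|n] /=; [rewrite scaler0 addr0|rewrite linearP tpureDl tpureZl].
case: n => [|n] /=; first by rewrite scaler0 addr0.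
by rewrite IH tpureDr tpureZr.
Qed.
Lemma pre_linT (V : lmodType k) w n (T : V -> fam) : (forall n, lin (fun x => T x n)) ->
  lin (fun x => pre w (T x) n).
Proof.
elim: w n => [|y w IH] n L; first exact: L.
case: n => [|n] /=; first exact: lin_zero.
by move=> c u v; rewrite IH // tpureDr tpureZr.
Qed.
Lemma word_mlin n : mlin (fun w : seq A => word n w).
Proof. exact: pre_mlin. Qed.
End Prefix.

(** * Actions on words of A, and a letter-by-letter form of the maps F *)

Section ActWord.
Context (k : comPzRingType) (H : hopf_algebra k) (A : algebra k).
Context (act : {linear H -> {linear A -> A}}) (f : {linear tensor H H -> A}).
Local Notation act_word := (act_word act).
Local Notation act_bar := (act_bar act).
Local Notation con := (con act f).

Lemma act_word_nil (P : lmodType k) h (e : seq A -> P) : act_word [::] h e = eps h *: e [::].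
Proof. by rewrite /Defs.act_word sweedler_word0. Qed.

(** For a one-letter word the recursion ends at the empty word, whose counits undo the extra
    splitting of [h]. *)
Lemma act_word_cons (P : lmodType k) x a h (e : seq A -> P) : mlin e ->
  act_word (x :: a) h e = s2 h (fun u v => act_word a v (fun b => e (act_bar x u :: b))).
Proof.
move=> me; case: a => [|y a]; last exact: sweedler_wordS.
rewrite /Defs.act_word sweedler_word1 /= -(s2_counitr h (e := fun u => e [:: act_bar x u])); last first.
  exact: (mlin_comp_lin (mlin_head [::] me) (act_bar_mlin act x)).
by apply: eq_s2 => u v _ _; rewrite sweedler_word0.
Qed.

Lemma lin_act_word (P Q : lmodType k) (T : P -> Q) a h (e : seq A -> P) : lin T ->
  T (act_word a h e) = act_word a h (fun b => T (e b)).
Proof. by move=> L; rewrite /Defs.act_word lin_sweedler_word. Qed.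

Lemma act_word_linF (P : lmodType k) a h : lin (fun e : seq A -> P => act_word a h e).
Proof.
rewrite /Defs.act_word => c F G.
have S n : lin (fun e : seq (seq H) -> P => sweedler_word n h e).
  elim: h => [|x h IH] // c' F' G' /=.
  rewrite -sweedler_linF; congr (sweedler n x _); apply: funext => w.
  exact: (IH c' (fun R => F' [seq p.1 :: p.2 | p <- zip w R]) (fun R => G' [seq p.1 :: p.2 | p <- zip w R])).
exact: (S (size a) c (fun R => F [seq act_bar p.1 p.2 | p <- zip a R]) (fun R => G [seq act_bar p.1 p.2
  | p <- zip a R])).
Qed.

Lemma eps_mlin (P : lmodType k) (m : P) : mlin (fun u : seq H => eps u *: m).
Proof.
move=> u; elim: u => [|x u IH] v c y z /=; last by rewrite -!scalerA IH scalerDr !scalerA mulrCA !mulrA.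
by rewrite linearP /= mulrDl scalerDl !scalerA /GRing.scale /= mulrA.
Qed.

Lemma act_word_mlin (P : lmodType k) a (e : seq A -> P) : mlin e -> mlin (fun h => act_word a h e).
Proof.
elim: a e => [|x a IH] e me.
  by rewrite (_ : (fun h => _) = (fun h => eps h *: e [::])) //; [apply: eps_mlin|apply: funext => h;
    apply: act_word_nil].
rewrite (_ : (fun h => _) = (fun h => s2 h (fun u v => act_word a v (fun b => e (act_bar x u :: b)))));
  last first.
  by apply: funext => h; apply: act_word_cons.
apply: s2_mlin => [v|u]; last exact: IH (mlin_cons _ me).
have L : lin (fun y => act_word a v (fun b => e (y :: b))).
  by apply: (lin_comp (@act_word_linF P a v)); apply: lin_fun => b; apply: mlin_head.
exact: (mlin_comp_lin L (act_bar_mlin act x)).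
Qed.

(* F^(m+1), including F^(1)(h ⊗ a) = a^h for m = 0, by a recursion that splits off one letter
   of a at a time instead of all the initial segments of a as in [Fmap]. *)
Fixpoint Fm (m : nat) : seq A -> seq H -> forall n, tpow (bar A) n :=
  fix Fa (a : seq A) (h : seq H) (n : nat) : tpow (bar A) n :=
    (if a is x :: a' then (-1) ^+ m *: s2 h (fun u v => pre [:: act_bar x u] (Fa a' v) n)
     else if m is 0 then (if h is [:: z] then (hopf_counit H z : k) *: word n [::] else 0) else 0)
    + (if m is m'.+1 then \sum_(j < m) (-1) ^+ j.+1 *: con j h (fun y h' => pre [:: y] (Fm m' a h') n)
       else 0).

Definition Fm_pass m a h n := if a is x :: a' then
    (-1) ^+ m *: s2 h (fun u v => pre [:: act_bar x u] (Fm m a' v) n)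
  else if m is 0 then (if h is [:: z] then (hopf_counit H z : k) *: word n [::] else 0) else 0.
Definition Fm_con m a h n := if m is m'.+1 then
    \sum_(j < m) (-1) ^+ j.+1 *: con j h (fun y h' => pre [:: y] (Fm m' a h') n) else 0.
Lemma FmE m a h n : Fm m a h n = Fm_pass m a h n + Fm_con m a h n.
Proof. by case: m => [|m]; case: a. Qed.

Lemma mlF_pre1 (T : seq H -> forall n, tpow (bar A) n) n :
  (forall n, mlin (fun h => T h n)) -> mlF (fun y h => pre [:: y] (T h) n).
Proof.
move=> mT; split=> [h|y]; first exact: pre1_lin.
by move=> u v; apply: pre1_linT => n'; apply: mT.
Qed.

Lemma Fm_mlin m a n : mlin (fun h => Fm m a h n).
Proof.
elim: m a n => [|m IH] a n.
  elim: a n => [|x a IHa] n.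
    move=> [|z u] v c y z' /=; rewrite !addr0; last by case: u; rewrite /= ?scaler0 ?addr0.
    case: v => [|v0 v]; last by rewrite scaler0 addr0.
    by rewrite linearP scalerDl scalerA.
  move=> u v; apply: lin_add; last exact: lin_zero.
  apply: lin_scale; move: u v; apply: s2_mlin => [v|u].
    exact: (mlin_comp_lin (pre1_lin _ _) (act_bar_mlin act x)).
  by move=> v1 v2; apply: pre1_linT => n'; apply: IHa.
elim: a n => [|x a IHa] n u v.
  apply: lin_add; first exact: lin_zero.
  apply: lin_bigsum => j; apply: lin_scale.
  by apply: con_mlin; apply: mlF_pre1 => n'; apply: IH.
apply: lin_add; last first.
  apply: lin_bigsum => j; apply: lin_scale.
  by apply: con_mlin; apply: mlF_pre1 => n'; apply: IH.
apply: lin_scale; move: u v; apply: s2_mlin => [v|u].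
  exact: (mlin_comp_lin (pre1_lin _ _) (act_bar_mlin act x)).
by move=> v1 v2; apply: pre1_linT => n'; apply: IHa.
Qed.
End ActWord.

(** * The twist expressed by the maps F *)

Section TwistFmap.
Context (k : comPzRingType) (H : hopf_algebra k) (A : algebra k).
Context (act : {linear H -> {linear A -> A}}) (f : {linear tensor H H -> A}).
Context (Hact : weak_action act) (E : crossed_product act f).
Context (M : lmodType k) (S : bimodule_on E M).
Local Notation X := (cp_free Hact E).
Local Notation iA := (inA X).
Local Notation iH := (inH X).
Local Notation twist := (twist X S).
Local Notation con := (con act f).
Local Notation Fm := (Fm act f).
Local Notation act_bar := (act_bar act).
Local Notation prodw v := (\prod_(x <- v) x).

Lemma word_lin_mlin n (L : {linear tpow (bar A) n -> M}) : mlin (fun w => L (word n w)).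
Proof. exact: (mlin_comp_lin (linear_lin L) (@word_mlin k A n)). Qed.

Let eval n (L : {linear tpow (bar A) n -> M}) (t : tpow (bar A) n) (v : seq H) : M :=
  ract S (iH (prodw v)) (L t).
Let evalL n L v : lin (fun t => @eval n L t v).
Proof. by move=> c x y; rewrite /eval !linearP. Qed.
Let evalm n L t : mlin (@eval n L t).
Proof.
apply: (mlin_comp_lin (F := fun h => ract S (iH h) (L t))); last exact: prod_mlin.
by move=> c x y; rewrite !linearP.
Qed.

(** The prefixed letter is hidden in the functional [L], which is why [L] and its degree are
    quantified in the hypothesis. *)
Lemma twist_Fm_pre m a w n (L : {linear tpow (bar A) n -> M}) y :
    (forall n (L : {linear tpow (bar A) n -> M}),
      s2 w (fun u v => eval L (Fm m a u n) v) = twist w (fun y => L (word n y)) a) ->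
  s2 w (fun u v => eval L (pre [:: y] (Fm m a u) n) v) = twist w (fun z => L (word n (y :: z))) a.
Proof.
move=> IH; case: n L => [|n] L.
  transitivity (s2 w (fun _ _ => 0 : M)).
    by apply: eq_s2 => u v _ _; rewrite /eval !linear0.
  rewrite (lin0 (@s2_linF k H M w)) -[LHS](twist0 X S w a); congr (twist w _ a).
  by apply: funext => z; rewrite [word _ _]/= linear0.
have LL : lin (fun t : tpow (bar A) n => L ((qclass (scalars A) y : bar A) ⊗ t)).
  by move=> c t t'; rewrite tpureDr tpureZr linearP.
exact: (IH n (lin_pack LL)).
Qed.

Lemma twist_mlF_word n (L : {linear tpow (bar A) n -> M}) a :
  mlF (fun x hs => twist hs (fun y => L (word n (x :: y))) a).
Proof. exact: (twist_mlF X S a (word_lin_mlin L)). Qed.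

Lemma twist_Fm_pass m x a w n (L : {linear tpow (bar A) n -> M}) : (0 < size w)%N ->
    (forall r n (L : {linear tpow (bar A) n -> M}), size r = size w ->
      s2 r (fun u v => eval L (Fm m a u n) v) = twist r (fun y => L (word n y)) a) ->
  s2 w (fun u v => eval L (s2 u (fun p q => pre [:: act_bar x p] (Fm m a q) n)) v) =
  twist_nf X S (fun y => L (word n y)) (rmul iA (map iH w) x) a.
Proof.
move=> w0 IH; rewrite /twist_nf -(pass_nf Hact E x (twist_mlF_word L a)) //.
transitivity (s2 w (fun u v => s2 u (fun p q => eval L (pre [:: act_bar x p] (Fm m a q) n) v))).
  by apply: eq_s2 => u v _ _; rewrite (lin_s2 _ _ (evalL L v)).
rewrite s2_coassoc.
- apply: eq_s2 => p r _ sr; apply: twist_Fm_pre => n' L'; exact: IH.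
- move=> q v; apply: (mlin_comp_lin (F := fun y => eval L (pre [:: y] (Fm m a q) n) v) _ (act_bar_mlin act x)).
  exact: (lin_comp (evalL L v) (pre1_lin _ _)).
- move=> p v; apply: (mlin_comp_lin (evalL L v)) => u1 u2.
  by apply: pre1_linT => n'; apply: Fm_mlin.
- by move=> p q; apply: evalm.
Qed.

Lemma twist_Fm_con m a w n (L : {linear tpow (bar A) n -> M}) : size w = m.+2 ->
    (forall r n (L : {linear tpow (bar A) n -> M}), size r = m.+1 ->
      s2 r (fun u v => eval L (Fm m a u n) v) = twist r (fun y => L (word n y)) a) ->
  s2 w (fun u v => eval L (Fm_con act f m.+1 a u n) v) =
  \sum_(j < m.+1) (-1) ^+ j.+1 *: twist_nf X S (fun y => L (word n y)) (contract j (map iH w)) a.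
Proof.
move=> sw IH.
transitivity (\sum_(j < m.+1) (-1) ^+ j.+1 *: s2 w (fun u v => con j u (fun y h => eval L (pre [:: y]
  (Fm m a h) n) v))).
  transitivity (s2 w (\sum_(j < m.+1) (fun u v => (-1) ^+ j.+1 *: con j u (fun y h => eval L (pre [::
    y] (Fm m a h) n) v)))).
    apply: eq_s2 => u v _ _; rewrite !fct_sumE /Fm_con (lin_sum (evalL L v)).
    apply: eq_bigr => j _; rewrite (linZ (evalL L v)); congr (_ *: _).
    by rewrite (lin_con act f _ _ _ (evalL L v)).
  rewrite (lin_sum (@s2_linF k H M w)); apply: eq_bigr => j _.
  by rewrite -(linZ (@s2_linF k H M w)).
apply: eq_bigr => j _; congr (_ *: _).
have jw : (j.+1 < size w)%N by rewrite sw ltnS ltn_ord.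
rewrite /twist_nf -(@con_nf _ _ _ _ _ Hact E _ _ _ _ (twist_mlF_word L a)) //.
(* The product of the letters of [v] does not change under contraction, so [v] may be contracted
   along with [u], as [s2_con] requires. *)
transitivity (s2 w (fun u v => con j u (fun y h => eval L (pre [:: y] (Fm m a h) n) (contract j v)))).
  by apply: eq_s2 => u v _ sv; apply: eq_con => y h _; rewrite /eval prod_contract // sv.
rewrite (s2_con act f (F := fun y u v => eval L (pre [:: y] (Fm m a u) n) v)) //.
- apply: eq_con => y u su; apply: twist_Fm_pre => n' L'; apply: IH.
  by move: su; rewrite sw => -[].
- by move=> u v; apply: (lin_comp (evalL L v) (pre1_lin _ _)).
- move=> y v; apply: (mlin_comp_lin (evalL L v)) => u1 u2.
  by apply: pre1_linT => n'; apply: Fm_mlin.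
Qed.

(** Both sides obey the same recursion: the absorption in [ldiff] corresponds to [Fm_pass], its
    contractions to [Fm_con]. What remains of the letters of [H] after passing [a] is multiplied
    together and acts on the value. *)
Lemma twist_Fm m a w n (L : {linear tpow (bar A) n -> M}) : size w = m.+1 ->
  s2 w (fun u v => ract S (iH (prodw v)) (L (Fm m a u n))) = twist w (fun y => L (word n y)) a.
Proof.
have split_Fm m' a' w' n' (L' : {linear tpow (bar A) n' -> M}) :
    s2 w' (fun u v => eval L' (Fm m' a' u n') v) =
    s2 w' (fun u v => eval L' (Fm_con act f m' a' u n') v) + s2 w' (fun u v => eval L' (Fm_pass act f
      m' a' u n') v).
  rewrite -(linD (@s2_linF k H M w')); apply: eq_s2 => u v _ _.
  by rewrite FmE addrC (linD (evalL L' v)).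
have pass m' x a' w' n' (L' : {linear tpow (bar A) n' -> M}) :
    s2 w' (fun u v => eval L' (Fm_pass act f m' (x :: a') u n') v) =
    (-1) ^+ m' *: s2 w' (fun u v => eval L' (s2 u (fun p q => pre [:: act_bar x p] (Fm m' a' q) n')) v).
  rewrite -(linZ (@s2_linF k H M w')); apply: eq_s2 => u v _ _.
  by rewrite (linZ (evalL L' v)).
have zero (w' : seq H) : s2 w' (fun _ _ => 0 : M) = 0 by rewrite (lin0 (@s2_linF k H M w')).
elim: m a w n L => [|m IHm].
  elim=> [|x a IH] [|z [|//]] // n L _.
    rewrite twist_base -[LHS]/(csum z (fun p q => eval L (Fm 0 [::] [:: p] n) [:: q])).
    pose G y := ract S (iH y) (L (word n [::])).
    have LG : lin G by move=> c y y'; rewrite /G !linearP.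
    rewrite -[RHS]/(G z) -(csum_counitl z LG); apply: eq_csum => p q.
    by rewrite /eval /G big_seq1 /= addr0 !linearZ.
  rewrite -[LHS]/(s2 [:: z] (fun u v => eval L (Fm 0 (x :: a) u n) v)) split_Fm pass twist_Fm_pass //.
    rewrite twistE // ldiff_sum big_ord0; congr (_ + _).
    by rewrite -(zero [:: z]); apply: eq_s2 => u v _ _; rewrite (lin0 (evalL L v)).
elim=> [|x a IH] w n L sw.
  rewrite -[LHS]/(s2 w (fun u v => eval L (Fm m.+1 [::] u n) v)) split_Fm twist_Fm_con //; last first.
    by move=> r n' L' sr; apply: IHm.
  rewrite twistE; last by rewrite /is_base sw.
  rewrite ldiff_sum size_map sw; congr (_ + _).
  rewrite (_ : s2 _ _ = 0); first by case: (map _ w).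
  by rewrite -[RHS](zero w); apply: eq_s2 => u v _ _; rewrite (lin0 (evalL L v)).
rewrite -[LHS]/(s2 w (fun u v => eval L (Fm m.+1 (x :: a) u n) v)) split_Fm twist_Fm_con //; last first.
  by move=> r n' L' sr; apply: IHm.
rewrite pass twist_Fm_pass ?sw //.
rewrite twistE; last by rewrite /is_base sw.
rewrite ldiff_sum size_map sw; congr (_ + _).
by case: w sw.
Qed.
End TwistFmap.

(** * The letter-by-letter recursion agrees with the defining one *)

Section FmapRecursion.
Context (k : comPzRingType) (H : hopf_algebra k) (A : algebra k).
Context (act : {linear H -> {linear A -> A}}) (f : {linear tensor H H -> A}).
Local Notation con := (con act f).
Local Notation Fm := (Fm act f).
Local Notation act_bar := (act_bar act).
Local Notation act_word := (act_word act).

Section Pas.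
Context (P : lmodType k).
(** The word [a] carried past [h]: the first components of [h] act on it, the second ones remain. *)
Definition pas (a : seq A) (h : seq H) (G : seq A -> seq H -> P) : P :=
  s2 h (fun h1 h' => act_word a h1 (fun b => G b h')).

Lemma pas_nil h G : (forall b, mlin (G b)) -> pas [::] h G = G [::] h.
Proof.
move=> mG; rewrite -[RHS](s2_counitl h (mG [::])); apply: eq_s2 => u v _ _.
exact: act_word_nil.
Qed.

Lemma pas_cons x a h G : (forall b, mlin (G b)) -> (forall h', mlin (G^~ h')) ->
  pas (x :: a) h G = s2 h (fun u v => pas a v (fun b h' => G (act_bar x u :: b) h')).
Proof.
move=> m1 m2.
transitivity (s2 h (fun h1 h' => s2 h1 (fun u q => act_word a q (fun b => G (act_bar x u :: b) h')))).
  by apply: eq_s2 => u v _ _; rewrite act_word_cons.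
rewrite s2_coassoc //.
- move=> q v; have L : lin (fun y => act_word a q (fun b => G (y :: b) v)).
    by apply: (lin_comp (@act_word_linF k H A act P a q)); apply: lin_fun => b; apply: (mlin_head b (m2 v)).
  exact: (mlin_comp_lin L (act_bar_mlin act x)).
- by move=> p v; apply: act_word_mlin; apply: (mlin_cons _ (m2 v)).
- move=> p q u v; apply: (lin_comp (@act_word_linF k H A act P a q)); apply: lin_fun => b.
  exact: m1.
Qed.

Lemma eq_act_word a h (e e' : seq A -> P) : e =1 e' -> act_word a h e = act_word a h e'.
Proof. by move=> /funext ->. Qed.
Lemma eq_pas a h G G' : (forall b h', size h' = size h -> G b h' = G' b h') -> pas a h G = pas a h G'.
Proof. by move=> GG; apply: eq_s2 => u v _ sv; apply: eq_act_word => b; apply: GG. Qed.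
End Pas.

Lemma lin_pas (P Q : lmodType k) (T : P -> Q) a h G : lin T ->
  T (pas a h G) = pas a h (fun b h' => T (G b h')).
Proof. by move=> L; rewrite /pas (lin_s2 _ _ L); apply: eq_s2 => u v _ _; rewrite (lin_act_word _ _ _ _ L). Qed.

Definition unrolled m a h n : tpow (bar A) n :=
  \sum_(j < m.+1) \sum_(i < (size a).+1) (-1) ^+ (i * m.+1 + j.+1) *:
    pas (take i a) h (fun b h' => con j h' (fun y h'' => pre (rcons b y) (Fm m (drop i a) h'') n)).

Lemma unrolled_mlF m a b n : mlF (fun y h'' => pre (rcons b y) (Fm m a h'') n).
Proof.
split=> [h|y u v].
  by move=> c y z; rewrite -!cats1 (pre_mlin _ n b [::]).
by apply: pre_linT => n'; apply: Fm_mlin.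
Qed.
Lemma unrolled_ml1 m a b n j : mlin (fun h' => con j h' (fun y h'' => pre (rcons b y) (Fm m a h'') n)).
Proof. exact/con_mlin/unrolled_mlF. Qed.
Lemma unrolled_ml2 m a h n j : mlin (fun b => con j h (fun y h'' => pre (rcons b y) (Fm m a h'') n)).
Proof.
move=> u v; apply: con_lin => z w c x y; rewrite !rcons_cat !rcons_cons.
exact: pre_mlin.
Qed.

(** Repeating the pass step until the first contraction moves an initial segment of [a] to the left.
    Each of its i letters costs the sign (-1)^(m + 1), and summing over i gives the double sum that
    defines F. *)
Lemma Fm_unrolled m a h n : Fm m.+1 a h n = unrolled m a h n.
Proof.
have con0 a' : Fm_con act f m.+1 a' h n = \sum_(j < m.+1) (-1) ^+ j.+1 *:
    pas [::] h (fun b h' => con j h' (fun y h'' => pre (rcons b y) (Fm m a' h'') n)).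
  by apply: eq_bigr => j _; rewrite pas_nil // => b; apply: unrolled_ml1.
elim: a h n con0 => [|x a IH] h n con0; rewrite FmE con0.
  rewrite add0r; apply: eq_bigr => j _; rewrite big_ord1 /=.
  by rewrite mul0n add0n.
rewrite /unrolled.
transitivity (\sum_(j < m.+1) ((-1) ^+ j.+1 *:
    pas [::] h (fun b h' => con j h' (fun y h'' => pre (rcons b y) (Fm m (x :: a) h'') n)) +
  \sum_(i < (size a).+1) (-1) ^+ (i.+1 * m.+1 + j.+1) *:
    pas (x :: take i a) h (fun b h' => con j h' (fun y h'' => pre (rcons b y) (Fm m (drop i a) h'')
      n)))); last first.
  by apply: eq_bigr => j _; rewrite [in RHS]big_ord_recl.
rewrite big_split /= addrC; congr (_ + _).
transitivity (s2 h (fun u v => (-1) ^+ m.+1 *: pre [:: act_bar x u] (unrolled m a v) n)).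
  rewrite (linZ (@s2_linF k H _ h)); congr (_ *: _); apply: eq_s2 => u v _ _.
  case: (n) => [|n'] //.
  rewrite -[LHS]/((qclass (scalars A) (act_bar x u) : bar A) ⊗ Fm m.+1 a v n').
  rewrite IH // => a'; apply: eq_bigr => j _.
  by rewrite pas_nil // => b; apply: unrolled_ml1.
pose Q j i u v := pas (take i a) v (fun b h' => con j h' (fun y h'' => pre (rcons (act_bar x u :: b) y)
  (Fm m (drop i a) h'') n)).
transitivity (s2 h (\sum_(j < m.+1) \sum_(i < (size a).+1) (-1) ^+ (i.+1 * m.+1 + j.+1) *: Q j i)).
  apply: eq_s2 => u v _ _; rewrite !fct_sumE.
  case: n {con0} @Q => [|n'] Q.
    rewrite /= scaler0 big1 // => j _; rewrite !fct_sumE big1 // => i _.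
    rewrite -[LHS]/(_ *: Q j i u v) (_ : Q j i u v = 0) ?scaler0 //.
    rewrite /Q; transitivity (pas (take i a) v (fun _ _ => 0 : k^o)).
      apply: eq_pas => b h' _; transitivity (con j h' (fun _ _ => 0 : k^o)); first exact: eq_con.
      exact: (lin0 (@con_linF k H A act f _ j h')).
    rewrite /pas; transitivity (s2 v (fun _ _ => 0 : k^o)); last exact: (lin0 (@s2_linF k H _ v)).
    by apply: eq_s2 => p q _ _; exact: (lin0 (@act_word_linF k H A act _ _ p)).
  have LT : lin (fun t : tpow (bar A) n' => (qclass (scalars A) (act_bar x u) : bar A) ⊗ t).
    by move=> c t t'; rewrite tpureDr tpureZr.
  rewrite [pre _ _ _]/= /unrolled (lin_sum LT) scaler_sumr; apply: eq_bigr => j _.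
  rewrite !fct_sumE (lin_sum LT) scaler_sumr; apply: eq_bigr => i _.
  rewrite (linZ LT) scalerA -exprD addnA -mulSn -[RHS]/(_ *: Q j i u v); congr (_ *: _).
  rewrite (lin_pas _ _ _ LT); apply: eq_pas => b h' _.
  by rewrite (lin_con act f _ _ _ LT).
rewrite (lin_sum (@s2_linF k H _ h)); apply: eq_bigr => j _.
rewrite (lin_sum (@s2_linF k H _ h)); apply: eq_bigr => i _.
rewrite (linZ (@s2_linF k H _ h)) pas_cons //.
- by move=> b; apply: unrolled_ml1.
- by move=> h'; apply: unrolled_ml2.
Qed.

Lemma Fm0 a z n : Fm 0 a [:: z] n = act_word a [:: z] (fun b => word n b).
Proof.
elim: a z n => [|x a IH] z n.
  by rewrite act_word_nil /= addr0 mulr1.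
rewrite act_word_cons; last exact: word_mlin.
rewrite FmE addr0 /Fm_pass scale1r; apply: eq_csum => p q.
case: n => [|n].
  by rewrite [LHS]/= -[LHS](lin0 (@act_word_linF k H A act _ a [:: q])).
have LT : lin (fun t : tpow (bar A) n => (qclass (scalars A) (act p x) : bar A) ⊗ t).
  by move=> c t t'; rewrite tpureDr tpureZr.
rewrite -[LHS]/((qclass (scalars A) (act p x) : bar A) ⊗ Fm 0 a [:: q] n).
by rewrite IH (lin_act_word _ _ _ _ LT).
Qed.

Lemma pre_Fm0 a b z n : pre b (Fm 0 a [:: z]) n = act_word a [:: z] (fun c => word n (b ++ c)).
Proof.
elim: b n => [|y b IH] n; first exact: Fm0.
case: n => [|n].
  by rewrite [LHS]/= -[LHS](lin0 (@act_word_linF k H A act _ a [:: z])).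
have LT : lin (fun t : tpow (bar A) n => (qclass (scalars A) y : bar A) ⊗ t).
  by move=> c t t'; rewrite tpureDr tpureZr.
rewrite -[LHS]/((qclass (scalars A) y : bar A) ⊗ pre b (Fm 0 a [:: z]) n).
by rewrite IH (lin_act_word _ _ _ _ LT).
Qed.

Lemma act_word_csum (P : lmodType k) a u x (G : H -> H -> seq A -> P) :
  act_word a u (fun b => csum x (fun p q => G p q b)) = csum x (fun p q => act_word a u (G p q)).
Proof.
rewrite -(lin_csum x G (@act_word_linF k H A act P a u)); apply: eq_act_word => b.
by rewrite csum_fun1.
Qed.
Lemma act_word_s2 (P : lmodType k) a u h (G : seq H -> seq H -> seq A -> P) :
  act_word a u (fun b => s2 h (fun p q => G p q b)) = s2 h (fun p q => act_word a u (G p q)).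
Proof.
rewrite -(lin_s2 h G (@act_word_linF k H A act P a u)); apply: eq_act_word => b.
by rewrite (lin_s2 (T := fun g : seq A -> P => g b)).
Qed.

(** For empty [a] the map F^(2) involves f(h_1, h_2) alone; on the side of [unrolled] the leftover
    components of both letters carry counits, which restore it. *)
Lemma F2_unrolled a h n : size h = 2 -> F2 act f h a n = unrolled 0 a h n.
Proof.
case: h => [|h0 [|h1 []]] // _; rewrite /unrolled big_ord1.
case: a => [|x a].
  rewrite big_ord1 mul0n add0n expr1 scaleN1r; congr (- _).
  rewrite pas_nil; last by move=> b; apply: (unrolled_ml1 0 [::] b n 0).
  transitivity (csum h0 (fun p q => (hopf_counit H q : k) *: csum h1 (fun r s =>
      (hopf_counit H s : k) *: word n [:: f (p ⊗ r)]))).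
    have W : lin (fun y : A => word n [:: y]) := mlin_head [::] (@word_mlin k A n).
    rewrite (csum_counitr h0 (G := fun p => csum h1 (fun r s => (hopf_counit H s
      : k) *: word n [:: f (p ⊗ r)]))).
      rewrite (csum_counitr h1 (G := fun r => word n [:: f (h0 ⊗ r)])) //.
      by apply: (lin_comp W) => c y z; rewrite tpureDr tpureZr linearP.
    apply: lin_bigsum => p; apply: lin_scale; apply: (lin_comp W) => c y z.
    by rewrite tpureDl tpureZl linearP.
  apply: eq_csum => p q; rewrite -(linZ (@csum_linF k H _ h1)); apply: eq_csum => r s.
  rewrite -[RHS]/(pre [:: f (p ⊗ r)] (Fm 0 [::] [:: q * s]) n) pre_Fm0 act_word_nil /= mulr1.
  by rewrite hopf_counitM -[LHS]/(_ *: (_ *: _)) scalerA.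
apply: eq_bigr => i _; rewrite muln1 addn1; congr (_ *: _).
rewrite /sweedler3 sweedler_wordS; apply: eq_s2 => u [|v0 [|v1 []]] // _ _.
rewrite -[LHS]/(sweedler2 [:: v0; v1] (fun h2 h3 => act_word (take i (x :: a)) u (fun b =>
  act_word (drop i (x :: a)) [:: h3`_0 * h3`_1] (fun c => word n (b ++ f (h2`_0 ⊗ h2`_1) :: c))))).
rewrite sweedler2_s2 [con 0 _]/=.
rewrite (act_word_csum _ _ v0 (fun p q b => csum v1 (fun r s =>
  pre (rcons b (f (p ⊗ r))) (Fm 0 (drop i (x :: a)) [:: q * s]) n))).
apply: eq_csum => p q; rewrite (act_word_csum _ _ v1 (fun r s b =>
  pre (rcons b (f (p ⊗ r))) (Fm 0 (drop i (x :: a)) [:: q * s]) n)).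
apply: eq_csum => r s; apply: eq_act_word => b; rewrite pre_Fm0.
by apply: eq_act_word => c; rewrite cat_rcons.
Qed.

(** The indices differ by one because [Fm] has the additional level F^(1). *)
Lemma Fmap_Fm m a h n : size h = m.+2 -> Fmap act f m h a n = Fm m.+1 a h n.
Proof.
rewrite Fm_unrolled; elim: m a h n => [|m IH] a h n sh; first exact: F2_unrolled.
have E1 j a' b h' : (j < m.+2)%N -> size h' = m.+3 ->
    sweedler2 (take j.+2 h') (fun u v => pre (rcons b (cocycle_at act f j u))
      (Fmap act f m (contract j v ++ drop j.+2 h') a') n) =
    con j h' (fun y h'' => pre (rcons b y) (Fm m.+1 a' h'') n).
  move=> jm sh'; rewrite sweedler2_s2.
  rewrite -(@con_s2 k H A act f _ j h' (fun y h'' => pre (rcons b y) (Fmap act f m h'' a') n)) ?sh' //.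
  apply: eq_con => y h''; rewrite sh' => -[sh'']; congr (pre _ _ n).
  by apply: functional_extensionality_dep => n'; rewrite IH // Fm_unrolled.
case: a => [|x a].
  apply: eq_bigr => j _; rewrite big_ord1 mul0n add0n pas_nil; last first.
    by move=> b; exact: (unrolled_ml1 m.+1 [::] b n j).
  by rewrite -(E1 j [::] [::]).
apply: eq_bigr => j _; apply: eq_bigr => i _; congr (_ *: _).
rewrite sweedler2_s2; apply: eq_s2 => h1 h' _ sh'.
rewrite sweedler2_s2 -act_word_s2; apply: eq_act_word => b.
by rewrite -(E1 j) ?sh' // sweedler2_s2.
Qed.
End FmapRecursion.

(** * Comparison with the complex of the statement *)

Section RightSums.
Context (k : comPzRingType) (A H E : algebra k) (X : free_extension A H E).
Context (M : lmodType k) (S : bimodule_on E M).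

Lemma rbar_sum g a : rbar X S g a = \sum_(i < (size a).-1) (-1) ^+ i.+1 *: g (contract i a)
  + (if a is _ :: _ then (-1) ^+ size a *: ract S (inA X a`_(size a).-1) (g (take (size a).-1 a)) else 0).
Proof.
elim: a g => [|x [|y a] IH] g; first by rewrite big_ord0 addr0.
  by rewrite big_ord0 add0r /= subr0 expr1 scaleN1r.
rewrite -[LHS]/(- g (x * y :: a) - rbar X S (fun z => g (x :: z)) (y :: a)) IH opprD addrA.
congr (_ + _); last by rewrite [in RHS]exprS mulN1r scaleNr.
rewrite [RHS]big_ord_recl -sumrN expr1 scaleN1r /contract /= drop0; congr (_ + _).
by apply: eq_bigr => j _; rewrite [in RHS]exprS mulN1r scaleNr.
Qed.

Lemma rdiff_sum phi h a : rdiff X S phi h a = (-1) ^+ size h *: rbar X S (phi h) a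
  + \sum_(i < size h) (-1) ^+ i *: twist X S (drop i h) (phi (take i h)) a.
Proof.
elim: h phi => [|x h IH] phi; first by rewrite big_ord0 addr0 /= scale1r.
rewrite /= IH big_ord_recl opprD addrCA drop0 /= scale1r -scaleNr exprS mulN1r; congr (_ + (_ + _)).
by rewrite -sumrN; apply: eq_bigr => i _; rewrite exprS mulN1r scaleNr.
Qed.
End RightSums.

Section WordFacts.
Context (k : comPzRingType) (B : algebra k).
Lemma word_size n (w : seq B) : size w != n -> word n w = 0.
Proof.
elim: n w => [|n IH] [|x w] //; rewrite /= eqSS => nw.
by rewrite /word /= -/(word n w) (IH w nw) tpure0r.
Qed.
Lemma word_nrm (P : lmodType k) n (L : tpow (bar B) n -> P) : lin L -> nrm (fun w : seq B => L (word n w)).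
Proof.
move=> LL u v; case: (eqVneq (size (u ++ (1 : B) :: v)) n) => [s|s].
  by rewrite word_normalized ?(lin0 LL) // -s size_cat.
by rewrite word_size // (lin0 LL).
Qed.
End WordFacts.

(** * Cochains as functions on pairs of words *)

Section CochainFunctions.
Context (k : comPzRingType) (H : hopf_algebra k) (A : algebra k) (M : lmodType k).

(** One function for all summands of a cochain, zero unless the lengths add up to n. For
    [size h > n] the index [inord (size h)] is a default, and then [word] of the wrong length is
    0. *)
Definition fn n (phi : xhat H A M n) (h : seq H) (a : seq A) : M :=
  xeval (xcomp phi (inord (size h))) h (word _ a).

Lemma fn_supp n (phi : xhat H A M n) h a : (size h + size a != n)%N -> fn phi h a = 0.
Proof.
move=> s; rewrite /fn /xeval.
case: (leqP (size h) n) => hn.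
  by rewrite (word_size (w := a)) ?tpure0r ?linear0 // inordK //; apply: contra_neq s; lia.
rewrite (word_size (w := h)) ?tpure0l ?linear0 //; apply/eqP => E.
by have := ltn_ord (inord (size h) : 'I_n.+1); rewrite -E; lia.
Qed.

Lemma fn_ml2 n (phi : xhat H A M n) : ml2 (fn phi).
Proof.
split=> [b u v c x y|u v w c x y]; rewrite /fn /xeval.
  rewrite !size_cat /= (word_mlin _ u v) tpureDl tpureZl linearP //.
by rewrite (word_mlin _ v w) tpureDr tpureZr linearP.
Qed.

Lemma fn_nrm2 n (phi : xhat H A M n) : nrm2 (fn phi).
Proof.
split=> [b u v|u v w]; rewrite /fn /xeval.
  rewrite size_cat /=.
  apply: (@word_nrm k H M _ (fun t => xcomp phi (inord (size u + (size v).+1)) (t ⊗ word _ b))).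
  by move=> c x y; rewrite tpureDl tpureZl linearP.
apply: (@word_nrm k A M _ (fun t => xcomp phi (inord (size u)) (word _ u ⊗ t))).
by move=> c x y; rewrite tpureDr tpureZr linearP.
Qed.

Lemma fn_lin n h a : lin (fun phi : xhat H A M n => fn phi h a).
Proof. by []. Qed.

Lemma fn_inj n (phi psi : xhat H A M n) :
  (forall h a, (size h + size a)%N = n -> fn phi h a = fn psi h a) -> phi = psi.
Proof.
move=> E1; apply: functional_extensionality_dep => s; apply: cochain_ext => h a sh sa.
have := E1 h a; rewrite /fn /xeval sh inord_val; apply.
by rewrite sa subnKC // -ltnS.
Qed.

Lemma cochain_lift s r (c : seq H -> seq A -> M) : ml2 c -> nrm2 c ->
  exists phi : cochains H A M s r, forall h a, size h = s -> size a = r -> phi (word s h ⊗ word r a) = c h a.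
Proof.
move=> mc nc.
have ex_a h : {L : {linear tpow (bar A) r -> M} | forall a, size a = r -> L (word r a) = c h a}.
  apply: cid; apply: word_lift => [u v x y z _|u v _]; first exact: mc.2.
  exact: nc.2.
pose La h := sval (ex_a h).
have LaE h a : size a = r -> La h (word r a) = c h a by apply: (svalP (ex_a h)).
have [L LE] : exists L : {linear tpow (bar H) s -> {linear tpow (bar A) r -> M}},
    forall h, size h = s -> L (word s h) = La h.
  apply: word_lift => [u v x y z _|u v _]; apply: word_ext => a sa.
    by rewrite /= !LaE //; apply: (mc.1 a).
  by rewrite /= LaE //; apply: nc.1.
exists (tensor_lift L) => h a sh sa.
by rewrite tensor_liftE LE // LaE.
Qed.

Lemma fn_ex n (c : seq H -> seq A -> M) : ml2 c -> nrm2 c ->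
    (forall h a, (size h + size a != n)%N -> c h a = 0) ->
  exists phi : xhat H A M n, fn phi = c.
Proof.
move=> mc nc sc.
pose ch (s : 'I_n.+1) := cid (cochain_lift s (n - s) mc nc).
exists (fun s => sval (ch s)); apply: funext => h; apply: funext => a.
have [s|s] := eqVneq (size h + size a)%N n; last by rewrite fn_supp // sc.
have hn : (size h < n.+1)%N by rewrite ltnS -s leq_addr.
rewrite /fn /xeval /xcomp; apply: (svalP (ch (inord (size h)))); rewrite inordK //.
by rewrite -s addKn.
Qed.
End CochainFunctions.

(** * Signs, and the identification of the given differential *)

Section Differential.
Context (k : comPzRingType) (H : hopf_algebra k) (A : algebra k).
Context (act : {linear H -> {linear A -> A}}) (f : {linear tensor H H -> A}).
Context (Hact : weak_action act) (E : crossed_product act f).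
Context (M : lmodType k) (S : bimodule_on E M).
Local Notation X := (cp_free Hact E).
Local Notation iA := (inA X).
Local Notation iH := (inH X).
Local Notation total := (total X S).
Local Notation lext := (lext X S).
Implicit Types (c : seq H -> seq A -> M).

Lemma sign_par (i j : nat) : odd i = odd j -> (-1) ^+ i = (-1) ^+ j :> k.
Proof. by move=> ij; rewrite -signr_odd ij signr_odd. Qed.

(* The sign (-1)^(rs + s) trades the factor (-1)^r of dhat_1 for the factor (-1)^s that the
   rows carry in [total]. *)
Definition sg n s : k := (-1) ^+ ((n - s) * s + s).
Definition tw n c h a : M := sg n (size h) *: c h a.

Lemma sgsg n s : sg n s * sg n s = 1.
Proof. by rewrite -exprD -[RHS](expr0 (-1)); apply: sign_par; lia. Qed.
Lemma twK n c : tw n (tw n c) = c.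
Proof. by apply: funext => h; apply: funext => a; rewrite /tw scalerA sgsg scale1r. Qed.

Lemma tw_ml2 n c : ml2 c -> ml2 (tw n c).
Proof.
move=> [m1 m2]; split=> [b|u] v w; last by apply: lin_scale; apply: m2.
by move=> z x y; rewrite /tw !size_cat /= m1 scalerDr !scalerA mulrC.
Qed.
Lemma tw_nrm2 n c : nrm2 c -> nrm2 (tw n c).
Proof. by move=> [N1 N2]; split=> [b|u] v w; rewrite /tw (N1, N2) scaler0. Qed.
Lemma tw_supp n c : (forall h a, (size h + size a != n)%N -> c h a = 0) ->
  forall h a, (size h + size a != n)%N -> tw n c h a = 0.
Proof. by move=> sc h a s; rewrite /tw sc // scaler0. Qed.

Lemma total_supp n c : (forall h a, (size h + size a != n)%N -> c h a = 0) ->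
  forall h a, (size h + size a != n.+1)%N -> total c h a = 0.
Proof.
move=> sc h a s; rewrite -(total0 X S h a); apply: eq_total => u b sub.
by apply: sc; move: s; rewrite -sub eqSS.
Qed.

(** The leading 1 contracted with the first letter of [h] gives the left action of that letter;
    contractions inside [h] give the cocycle terms of dhat_1, and the absorption gives the left term
    of dhat_0. *)
Lemma ldiff_lext_sum c h a : ml2 c ->
  ldiff iA (lext c) (1 :: map iH h) a =
  (if h is x :: h' then - lact S (iH x) (c h' a) else 0)
  + \sum_(i < (size h).-1) (-1) ^+ i *: con act f i h (fun y u => lact S (iA y) (c u a))
  + (if a is x :: a' then (-1) ^+ size h *: s2 h (fun u v => lact S (iA (act_bar act x u)) (c v a')) else 0).
Proof.
move=> mc; have lext1 w b : lext c (1 :: w) b = nf X w (fun x hs => lact S (iA x) (c hs b)).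
  exact: lact1.
rewrite ldiff_sum; congr (_ + _).
  case: h => [|x h]; first by rewrite !big_ord0 addr0.
  rewrite [size _]/= size_map big_ord_recl expr1 scaleN1r; congr (_ + _).
    rewrite -[contract 0 _]/(1 * iH x :: drop 0 (map iH h)) drop0 mul1r.
    by rewrite (lext_in X).
  apply: eq_bigr => i _; rewrite exprS mulN1r scaleNr exprS mulN1r scaleNr opprK; congr (_ *: _).
  rewrite -[contract _ _]/(1 :: contract i (map iH (x :: h))) lext1.
  rewrite -(@con_nf _ _ _ _ _ Hact E _ i (x :: h)) //; first exact: lext_mlF.
  by rewrite /= ltnS ltn_ord.
case: a => [//|x a]; rewrite [size _]/= size_map; congr (_ *: _).
case: h => [|y h].
  by rewrite -[rmul _ _ _]/[:: 1 * iA x] mul1r -[LHS]/(lact S (iA x) (lact S (iA 1) (c [::] a))) inA1 lact1.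
rewrite (pass_nf Hact E x (lext_mlF X S a mc)) //.
by rewrite -[rmul _ _ _]/(1 :: rmul iA (map iH (y :: h)) x) lext1.
Qed.

Lemma twist_Fmap n s' r' (phi : cochains H A M s' r') (w : seq H) h a :
    size w = n.+2 ->
  sweedler2 w (fun u v => ract S (iH (\prod_(x <- v) x)) (xeval phi h (Fmap act f n u a r'))) =
  twist X S w (fun y => xeval phi h (word r' y)) a.
Proof.
move=> sw; rewrite sweedler2_s2.
have LL : lin (fun t : tpow (bar A) r' => phi (word s' h ⊗ t)).
  by move=> c x y; rewrite tpureDr tpureZr linearP.
rewrite -[RHS]/(twist X S w (fun y => lin_pack LL (word r' y)) a) -(twist_Fm Hact S a (lin_pack LL) sw).
by apply: eq_s2 => u v su _; rewrite /xeval Fmap_Fm // su.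
Qed.

Lemma twist_act_word s' r' (phi : cochains H A M s' r') (z : H) h a :
  sweedler 2 z (fun x => act_word act a [:: x`_0] (fun b =>
     ract S (iH x`_1) (xeval phi h (word r' b)))) =
  twist X S [:: z] (fun y => xeval phi h (word r' y)) a.
Proof.
have LL : lin (fun t : tpow (bar A) r' => phi (word s' h ⊗ t)).
  by move=> c x y; rewrite tpureDr tpureZr linearP.
rewrite -[RHS]/(twist X S [:: z] (fun y => lin_pack LL (word r' y)) a).
rewrite -(@twist_Fm _ _ _ _ _ Hact E M S 0 a [:: z] r' (lin_pack LL) erefl).
rewrite -[LHS]/(csum z (fun p q => act_word act a [:: p] (fun b => ract S (iH q) (xeval phi h (word r' b))))).
rewrite -[RHS]/(csum z (fun p q => ract S (iH (\prod_(x <- [:: q]) x)) (lin_pack LL (Fm act f 0 a [:: p] r')))).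
apply: eq_csum => p q; rewrite Fm0 big_seq1.
have L2 : lin (fun t => ract S (iH q) (phi (word s' h ⊗ t))).
  by move=> c x y; rewrite LL linearP.
exact: esym (lin_act_word act a [:: p] (fun b => word r' b) L2).
Qed.

(** Term by term: dhat_0 is the absorption together with [rbar], dhat_1 consists of the other
    left-hand terms and the twist by the last letter, and dhat_l for l >= 2 is the twist by the last
    l letters. Beyond this, only parities have to be compared. *)
Lemma dhat_total n (phi : xhat H A M n) (s : 'I_n.+2) h a :
    size h = s -> size a = (n.+1 - s)%N ->
  \sum_(l < s.+1 | (0 < n.+1 - s + l)%N) dhat S l (xcomp phi (inord (s - l))) h a =
  tw n.+1 (total (tw n (fn phi))) h a.
Proof.
move=> sh sa; set c := fn phi; have mc : ml2 c := fn_ml2 phi.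
have sr : (s + size a = n.+1)%N by rewrite sa subnKC // -ltnS.
have xE l u t : (l <= s)%N -> (0 < n.+1 - s + l)%N -> size u = (s - l)%N ->
    xeval (xcomp phi (inord (s - l))) u (word _ t) = c u t.
  by move=> ls nl su; rewrite /c /fn su.
have s2Z h' z (e : seq H -> seq H -> M) : s2 h' (fun u v => z *: e u v) = z *: s2 h' e.
  by rewrite -(linZ (@s2_linF k H M h')).
have conZ j h' z (F : A -> seq H -> M) : con act f j h' (fun y u => z *: F y u) = z *: con act f j h' F.
  by rewrite -(linZ (@con_linF k H A act f M j h')).
have twZ i : (i <= s)%N -> tw n c (take i h) = (fun y => sg n i *: c (take i h) y).
  by move=> le_is; apply: funext => y; rewrite /tw size_takel // sh.
have par x y : odd x = odd y -> (-1) ^+ x = (-1) ^+ y :> k := @sign_par x y.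
rewrite {1}/tw totalE ldiff_lext_sum; last exact: tw_ml2.
rewrite rdiff_sum sh [X in _ *: (X + _)]addrC addrACA scalerDr.
rewrite big_mkcond big_ord_recl addn0 -sa.
congr (_ + _).
  case: a sr sa => [|x a] sr sa; first by rewrite /= scaler0 addr0 scaler0.
  have sn : (n - s)%N = size a by move: sr => /=; lia.
  have sg1 : sg n.+1 s * ((-1) ^+ s * sg n s) = 1.
    rewrite /sg -sa sn -!exprD -[RHS](expr0 (-1)); apply: par.
    by rewrite /= !(oddD, oddM, oddS); do 2!case: (odd _).
  have twh : tw n c h = (fun y => sg n s *: c h y) by have := twZ s (leqnn s); rewrite -sh take_size.
  rewrite twh (linZ (rbar_lin X S (x :: a))) -!scalerDr scalerA.
  have -> : s2 h (fun u v => lact S (iA (act_bar act x u)) (tw n c v a)) =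
      sg n s *: s2 h (fun u v => lact S (iA (act_bar act x u)) (c v a)).
    by rewrite -s2Z; apply: eq_s2 => u v _ sv; rewrite /tw sv sh linearZ.
  rewrite -scalerDr scalerA -mulrA sg1 scale1r rbar_sum.
  have y0 u t : size u = s -> xeval (xcomp phi (inord (s - 0))) u (word _ t) = c u t.
    by move=> su; apply: xE; rewrite ?subn0 // addn0 -sa.
  rewrite -[LHS]/(dhat0 S (xcomp phi (inord (s - 0))) h (x :: a)) /dhat0 sweedler2_s2.
  rewrite [X in _ = _ + X]addrC addrA; congr (_ + _ + _).
  - by apply: eq_s2 => u v _ sv; rewrite y0 ?sv.
  - by rewrite y0.
  - by apply: eq_bigr => i _; rewrite y0.
pose r := size a.
pose T l := (-1) ^+ (l.+1 * (r + s)) *: twist X S (drop (s - l.+1) h) (c (take (s - l.+1) h)) a.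
pose extra := (-1) ^+ r *: lact S (iH h`_0) (c (behead h) a) + \sum_(i < s.-1) (-1) ^+ (r + i.+1) *:
  con act f i h (fun y u => lact S (iA y) (c u a)).
have sgE l : (l < s)%N -> sg n (s - l.+1) = (-1) ^+ ((r + l) * (s - l.+1) + (s - l.+1)).
  by move=> ls; rewrite /sg; congr (_ ^+ (_ * _ + _)); rewrite /r; lia.
(* [T l] is the twist by the last [l.+1] letters; dhat_1, at index 0, has left-hand terms
   besides. *)
transitivity (\sum_(l < s) (T l + (if l == 0 :> nat then extra else 0))).
  apply: eq_bigr => -[l ls] _; rewrite (_ : nat_of_ord (lift ord0 (Ordinal ls)) = l.+1) // addnS ltnS leq0n.
  rewrite [nat_of_ord (Ordinal ls)]/=.
  have y1 u t : size u = (s - l.+1)%N -> xeval (xcomp phi (inord (s - l.+1))) u (word _ t) = c u t.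
    by move=> su; apply: xE; rewrite // addnS.
  have g1 : (fun y => xeval (xcomp phi (inord (s - l.+1))) (take (s - l.+1) h) (word _ y)) = c (take (s
    - l.+1) h).
    by apply: funext => y; rewrite y1 // size_takel // sh leq_subr.
  case: l ls y1 g1 => [|l] ls y1 g1; last first.
    rewrite addr0 -[LHS]/(dhat2 S l.+2 (xcomp phi (inord (s - l.+2))) h a) /dhat2 sh /T -/r; congr (_ *: _).
    by rewrite (@twist_Fmap l) ?g1 // size_drop sh subKn.
  rewrite eqxx -[LHS]/(dhat1 S (xcomp phi (inord (s - 1))) h a) /dhat1 sh -/r.
  rewrite addrAC addrC; congr (_ + (_ + _)).
  - rewrite /T mul1n; congr (_ *: _).
    have -> : drop (s - 1) h = [:: h`_(s - 1)].
      by rewrite (drop_nth 0) ?sh; [rewrite drop_oversize // sh|]; lia.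
    by rewrite -g1 -twist_act_word subn1.
  - by rewrite y1 // size_behead sh subn1.
  - apply: eq_bigr => i _; congr (_ *: _); have iw : (i.+1 < size h)%N.
      by have := ltn_ord i; rewrite sh; lia.
    rewrite con_s2 // sweedler2_s2; apply: eq_s2 => u v _ sv; rewrite y1 //.
    move: sv; rewrite /contract !size_cat /= !size_drop => sv.
    by rewrite size_takel sv size_takel //; move: iw; rewrite sh; lia.
rewrite big_split /= addrC scalerDr; congr (_ + _).
  case: h sh sa sr @T @extra twZ xE => [|x h] sh sa sr T extra twZ xE.
    by rewrite -sh big_ord0 add0r big1 ?scaler0 // => -[].
  have s0 : (0 < s)%N by rewrite -sh.
  rewrite (bigD1 (Ordinal s0)) //= big1 ?addr0; last first.
    by move=> l; rewrite -val_eqE /= => /negPf ->.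
  have sg1 i : (-1) ^+ (r + i.+1) = sg n.+1 s * ((-1) ^+ i * sg n s.-1).
    have := sgE 0 s0; rewrite subn1 => ->; rewrite /sg -sa -/r -!exprD; apply: par.
    have -> : nat_of_ord s = s.-1.+1 by rewrite prednK.
    by rewrite /= !(oddD, oddM, oddS) /=; do 3!case: (odd _).
  rewrite scalerDr; congr (_ + _).
    have := sg1 0; rewrite addn1 expr0 mul1r exprS mulN1r => E1.
    rewrite /tw (_ : size h = s.-1); last by rewrite -sh.
    by rewrite linearZ scalerN scalerA -E1 scaleNr opprK.
  rewrite scaler_sumr; apply: eq_bigr => i _; rewrite sg1 -scalerA -scalerA.
  congr (_ *: (_ *: _)); rewrite -conZ; apply: eq_con => y u su.
  by rewrite /tw (_ : size u = s.-1) ?linearZ // -sh -su.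
(* [rdiff_sum] is indexed by the cut point, the differential by the length of the tail. *)
rewrite scaler_sumr (reindex_inj rev_ord_inj); apply: eq_bigr => -[i si] _ /=.
rewrite scalerA /T; set l := (s - i.+1)%N.
have ls : (l < s)%N by rewrite /l; lia.
have := sgE l ls; have -> : (s - l.+1 = i)%N by rewrite /l; lia.
move=> sgi; rewrite twZ ?(ltnW si) //.
have -> : twist X S (drop i h) (fun y => sg n i *: c (take i h) y) a = sg n i *: twist X S (drop i h)
  (c (take i h)) a.
  exact: (linZ (twist_lin X S (drop i h) a)).
rewrite scalerA; congr (_ *: _).
rewrite sgi /sg -sa -/r -!exprD; apply: par.
have -> : nat_of_ord s = (i + l.+1)%N by rewrite /l; lia.
by rewrite /= !(oddD, oddM, oddS) /=; do 3!case: (odd _).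
Qed.
End Differential.

Section XDifferential.
Context (k : comPzRingType) (H : hopf_algebra k) (A : algebra k).
Context (act : {linear H -> {linear A -> A}}) (f : {linear tensor H H -> A}).
Context (Hact : weak_action act) (E : crossed_product act f).
Local Notation X := (cp_free Hact E).
Local Notation iA := (inA X).

Section OneModule.
Context (M : lmodType k) (S : bimodule_on E M).
Local Notation total := (total X S).
Implicit Types (c : seq H -> seq A -> M).

Lemma xdiff_ex n (phi : xhat H A M n) :
  exists psi : xhat H A M n.+1, fn psi = tw n.+1 (total (tw n (fn phi))).
Proof.
have m := tw_ml2 n (fn_ml2 phi); have N := tw_nrm2 n (fn_nrm2 phi).
apply: fn_ex.
- exact/tw_ml2/total_ml2.
- exact/tw_nrm2/total_nrm2.
- apply: tw_supp; apply: total_supp; apply: tw_supp; exact: fn_supp.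
Qed.
Definition xdiff_fun n (phi : xhat H A M n) : xhat H A M n.+1 := sval (cid (xdiff_ex phi)).
Lemma xdiff_funE n (phi : xhat H A M n) : fn (xdiff_fun phi) = tw n.+1 (total (tw n (fn phi))).
Proof. exact: (svalP (cid (xdiff_ex phi))). Qed.
Fact xdiff_linear n : linear (@xdiff_fun n).
Proof.
move=> c x y; apply: fn_inj => h a _; rewrite fn_lin !xdiff_funE /tw scalerA mulrC -scalerA -scalerDr.
congr (_ *: _); rewrite -total_lin; apply: eq_total => u b _.
rewrite -[RHS]/(c *: (sg k n (size u) *: fn x u b) + sg k n (size u) *: fn y u b).
by rewrite /tw fn_lin scalerDr !scalerA mulrC.
Qed.
HB.instance Definition _ n := GRing.isLinear.Build k (xhat H A M n) (xhat H A M n.+1) *:%R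
  (@xdiff_fun n) (@xdiff_linear n).
Definition xdiff n : {linear xhat H A M n -> xhat H A M n.+1} := @xdiff_fun n.
Lemma xdiffE n (phi : xhat H A M n) : fn (xdiff n phi) = tw n.+1 (total (tw n (fn phi))).
Proof. exact: xdiff_funE. Qed.

Lemma xdiffK n x : xdiff n.+1 (xdiff n x) = 0.
Proof.
apply: fn_inj => h a _; rewrite xdiffE xdiffE twK /tw total_total ?scaler0; last exact/tw_ml2/fn_ml2.
by rewrite (lin0 (@fn_lin _ _ _ _ n.+2 h a)).
Qed.

Lemma xdiff_is_dhat : is_dhat S xdiff.
Proof.
move=> n phi s h a sh sa; rewrite (dhat_total Hact S phi sh sa) -xdiffE /fn /xeval.
have -> : inord (size h) = s by rewrite sh inord_val.
by [].
Qed.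

Lemma xfil_fn i n (x : xhat H A M n) : xfil i n x <-> forall h a, (size h < i)%N -> fn x h a = 0.
Proof.
split=> [Fx h a hi|Fx s si].
  case: (leqP (size h) n) => hn; last by rewrite fn_supp //; apply/eqP; lia.
  by rewrite /fn /xeval Fx // inordK.
apply: cochain_ext => h a sh sa; have := Fx h a; rewrite /fn /xeval sh inord_val.
exact.
Qed.

(** In the lowest filtration degree where [c] lives, only terms that keep all letters of [h]
    contribute. This gives both the compatibility with the filtration and the first page. *)
Lemma total_lead c h a : ml2 c -> (forall u b, (size u < size h)%N -> c u b = 0) ->
  total c h a = (if a is x :: a' then (-1) ^+ size h *: s2 h (fun u v => lact S (iA (act_bar act x u))
    (c v a')) else 0)
   + (-1) ^+ size h *: rbar X S (c h) a.
Proof.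
move=> mc c0; rewrite totalE ldiff_lext_sum // rdiff_sum -[in RHS](add0r (if a is _ :: _ then _ else
  _)) -addrA -[in RHS]addrA.
congr (_ + (_ + _)); last first.
  rewrite big1 ?addr0 // => i _; rewrite (_ : c (take i h) = fun _ => 0) ?twist0 ?scaler0 //.
  by apply: funext => b; rewrite c0 // size_takel ?ltn_ord // ltnW.
rewrite big1 ?addr0 => [|i _].
  by case: h c0 => [|x h] c0 //; rewrite c0 // linear0 oppr0.
rewrite (@eq_con _ _ _ _ _ _ i h _ (fun _ _ => 0)); last by move=> y u su; rewrite c0 ?linear0 // -su.
by rewrite (lin0 (@con_linF k H A act f M i h)) scaler0.
Qed.

Lemma xdiff_fil i n x : xfil i n x -> xfil i n.+1 (xdiff n x).
Proof.
move=> /xfil_fn Fx; apply/xfil_fn => h a hi; rewrite xdiffE /tw total_lead; last 2 first.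
- exact/tw_ml2/fn_ml2.
- by move=> u b uh; rewrite Fx ?scaler0 // (ltn_trans uh).
rewrite (_ : (fun a => sg k n (size h) *: fn x h a) = fun _ => 0) ?rbar0 ?scaler0 ?addr0; last first.
  by apply: funext => b; rewrite Fx ?scaler0.
case: a => [|y a]; rewrite ?scaler0 //.
rewrite (@eq_s2 _ _ _ h _ (fun _ _ => 0)) ?(lin0 (@s2_linF k H M h)) ?scaler0 // => u v _ sv.
by rewrite Fx ?scaler0 ?linear0 // sv.
Qed.
End OneModule.
End XDifferential.

(** * The bimodules of the first page *)

Section HomBimodule.
Context (k : comPzRingType) (H : hopf_algebra k) (A : algebra k).
Context (act : {linear H -> {linear A -> A}}) (f : {linear tensor H H -> A}).
Context (Hact : weak_action act) (E : crossed_product act f).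
Context (M : lmodType k) (S : bimodule_on E M).
Local Notation iA := (cp_inA E).
Local Notation act_bar := (act_bar act).

Lemma s2_nrm (P : lmodType k) (e : seq H -> seq H -> P) h1 h2 :
    (forall v, mlin (e^~ v)) -> (forall u, mlin (e u)) ->
    (forall u v1 v2, e u (v1 ++ 1 :: v2) = 0) ->
  s2 (h1 ++ 1 :: h2) e = 0.
Proof.
elim: h1 e => [|x h1 IH] e m1 m2 N /=.
  rewrite csum1.
    by rewrite (@eq_s2 _ _ _ h2 _ (fun _ _ => 0)) ?(lin0 (@s2_linF k H P h2)) // => u v _ _; apply: (N _ [::]).
  split=> [q|p]; apply: s2_lin => u v; first exact: mlin_head (m1 _).
  exact: mlin_head (m2 _).
apply: big1 => p _; apply: IH => [v|u|u v1 v2]; last exact: (N _ (_ :: _)).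
  exact: mlin_cons (m1 _).
exact: mlin_cons (m2 _).
Qed.

Lemma act_bar_mul a b u : act_bar (a * b) u = s2 u (fun p q => act_bar a p * act_bar b q).
Proof.
elim: u => [|x u IH] //=.
rewrite IH (lin_s2 u _ (linear_lin (act x))) -s2_csum; apply: eq_s2 => p q _ _.
exact: act_mul.
Qed.
Lemma act_bar_one u : act_bar 1 u = eps u *: (1 : A).
Proof.
elim: u => [|x u IH] /=; first by rewrite scale1r.
by rewrite IH linearZ /= (act1 Hact) scalerA mulrC.
Qed.

Section Left.
Context (s : nat).
Local Notation N := (hom_mod (tpow (bar H) s) M).

Let lfun (a : A) (phi : N) (h : seq H) : M :=
  s2 h (fun u v => lact S (iA (act_bar a u)) (phi (word s v))).

Let lfun_lina phi h : lin (fun a => lfun a phi h).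
Proof.
apply: s2_lin => u v; apply: (lin_comp (F := fun a => lact S (iA a) (phi (word s v)))) (act_bar_lin act u).
by move=> c x y; rewrite !linearP.
Qed.
Let lfun_linphi a h : lin (fun phi => lfun a phi h).
Proof. by apply: s2_lin => u v c x y; rewrite /= linearP. Qed.
Let m1 a (phi : N) v : mlin (fun u => lact S (iA (act_bar a u)) (phi (word s v))).
Proof.
apply: (mlin_comp_lin (F := fun a => lact S (iA a) (phi (word s v)))) (act_bar_mlin act a).
by move=> c x y; rewrite !linearP.
Qed.
Let m2 a (phi : N) u : mlin (fun v => lact S (iA (act_bar a u)) (phi (word s v))).
Proof.
apply: (mlin_comp_lin (F := fun t => lact S (iA (act_bar a u)) (phi t))) (@word_mlin k H s).
by move=> c x y; rewrite !linearP.
Qed.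
Let lfun_mlin a phi : mlin (lfun a phi).
Proof. by apply: s2_mlin => [v|u]; [apply: m1|apply: m2]. Qed.

Let lfun_ex a phi : exists L : {linear tpow (bar H) s -> M}, forall w, size w = s -> L (word s w) =
  lfun a phi w.
Proof.
apply: word_lift => [u v c x y _|u v suv]; first exact: lfun_mlin.
rewrite /lfun; move: suv; rewrite addnS => suv.
(* The summand is cut off outside length s, the length in which [word_normalized] applies. *)
transitivity (s2 (u ++ 1 :: v) (fun p q => if size q == s then lact S (iA (act_bar a p)) (phi (word s
  q)) else 0)).
  by apply: eq_s2 => p q _ sq; rewrite sq size_cat /= addnS suv eqxx.
apply: s2_nrm => [q|p|p q1 q2].
- by case: (size q == s); [apply: m1|apply: mlin_const0].
- move=> q1 q2 c x y; rewrite !size_cat /=; case: eqP => _; last by rewrite scaler0 addr0.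
  exact: m2.
- case: eqP => // sq; rewrite word_normalized ?linear0 //.
  by move: sq; rewrite size_cat.
Qed.
Let lphi a phi : N := sval (cid (lfun_ex a phi)).
Let lphiE a phi w : size w = s -> lphi a phi (word s w) = lfun a phi w.
Proof. exact: (svalP (cid (lfun_ex a phi))). Qed.

Let lphi_lin a : lin (lphi a).
Proof. by move=> c x y; apply: word_ext => w sw; rewrite /= !lphiE // lfun_linphi. Qed.
Let lphi_lina : lin (fun a => lin_pack (lphi_lin a)).
Proof.
move=> c a b; apply: linear_ext => phi; apply: word_ext => w sw.
by rewrite /= !lphiE // lfun_lina.
Qed.

Let rfun (a : A) (phi : N) (t : tpow (bar H) s) : M := ract S (iA a) (phi t).
Let rfun_lin a phi : lin (rfun a phi). Proof. by move=> c x y; rewrite /rfun !linearP. Qed.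
Let rphi_lin a : lin (fun phi => lin_pack (rfun_lin a phi) : N).
Proof. by move=> c x y; apply: linear_ext => t; rewrite /= /rfun /= linearP. Qed.
Let rphi_lina : lin (fun a => lin_pack (rphi_lin a)).
Proof.
move=> c x y; apply: linear_ext => phi; apply: linear_ext => t.
by rewrite /= /rfun !linearP.
Qed.

(** The left action is associative because words of [H] act multiplicatively on products of [A]
    ([act_bar_mul]) and comultiplication of words is coassociative. *)
Lemma hom_bimodule_ex : exists N0 : bimodule_on A N, forall a (phi : N) h, size h = s ->
  (lact N0 a phi : N) (word s h) = sweedler2 h (fun u v => lact S (iA (act_bar a u)) (phi (word s v))) /\
  (ract N0 a phi : N) (word s h) = ract S (iA a) (phi (word s h)).
Proof.
unshelve eexists (@Bimodule k A N (lin_pack lphi_lina) (lin_pack rphi_lina) _ _ _ _ _).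
- move=> a b phi; apply: word_ext => w sw; rewrite /= !lphiE // /lfun.
  transitivity (s2 w (fun u v => s2 u (fun p q => lact S (iA (act_bar a p)) (lact S (iA (act_bar b q))
    (phi (word s v)))))).
    apply: eq_s2 => u v _ _; rewrite act_bar_mul.
    rewrite (lin_s2 (T := fun a => lact S (iA a) (phi (word s v)))); last by move=> c x y; rewrite !linearP.
    by apply: eq_s2 => p q _ _; rewrite (cp_inA_mul Hact E) lactM.
  rewrite s2_coassoc.
  + apply: eq_s2 => u v _ sv; rewrite lphiE ?sv // /lfun.
    by rewrite (lin_s2 _ _ (linear_lin (lact S (iA (act_bar a u))))).
  + move=> q v; apply: (mlin_comp_lin (F := fun a => lact S (iA a) (lact S (iA (act_bar b q)) (phi
    (word s v))))) (act_bar_mlin act a).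
    by move=> c x y; rewrite !linearP.
  + move=> p v; apply: (mlin_comp_lin (F := fun b => lact S (iA (act_bar a p)) (lact S (iA b) (phi
    (word s v))))) (act_bar_mlin act b).
    by move=> c x y; rewrite !linearP.
  + move=> p q; apply: (mlin_comp_lin (F := fun t => lact S (iA (act_bar a p)) (lact S (iA (act_bar b
    q)) (phi t)))) (@word_mlin k H s).
    by move=> c x y; rewrite !linearP.
- by move=> a b phi; apply: linear_ext => t; rewrite /= /rfun (cp_inA_mul Hact E) ractM.
- move=> phi; apply: word_ext => w sw; rewrite /= lphiE // /lfun.
  transitivity (s2 w (fun u v => eps u *: phi (word s v))).
    by apply: eq_s2 => u v _ _; rewrite act_bar_one !linearZ /= lact1.
  by rewrite s2_counitl //; apply: (mlin_comp_lin (linear_lin phi)); apply: word_mlin.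
- by move=> phi; apply: linear_ext => t; rewrite /= /rfun ract1.
- move=> a b phi; apply: word_ext => w sw; rewrite /= /rfun lphiE // /lfun.
  rewrite /= /rfun lphiE // (lin_s2 _ _ (linear_lin (ract S (iA b)))).
  by apply: eq_s2 => u v _ _; rewrite /= /rfun lact_ract.
move=> a phi h sh; split=> //.
by rewrite sweedler2_s2 -[RHS]/(lfun a phi h) -lphiE.
Qed.
End Left.

Lemma hom_bimodules_ex : exists N : forall s, bimodule_on A (hom_mod (tpow (bar H) s) M), is_hom_bimodule S N.
Proof.
exists (fun s => sval (cid (hom_bimodule_ex s))) => s a phi h sh.
exact: (svalP (cid (hom_bimodule_ex s)) a phi h sh).
Qed.
End HomBimodule.

(** * Dimension shifting *)

Section Isomorphisms.
Context (k : comPzRingType).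

Lemma linear_iso_sym (V W : lmodType k) : linear_iso V W -> linear_iso W V.
Proof.
move=> [g [h gK hK]].
have L : lin h by move=> c x y; apply: (can_inj gK); rewrite hK linearP !hK.
by exists (lin_pack L); exists g.
Qed.
Lemma linear_iso_trans (V W U : lmodType k) : linear_iso V W -> linear_iso W U -> linear_iso V U.
Proof.
move=> [g bg] [h bh]; have L : lin (fun x => h (g x)) by move=> c x y; rewrite !linearP.
by exists (lin_pack L); apply: bij_comp.
Qed.

(** Linear relations instead of maps: the lifts behind a connecting homomorphism are unique only
    modulo the denominators, and a relation requires no coherent choice of them. *)
Lemma subquot_rel_iso (V V' : lmodType k) (Z W : submod V) (Z' W' : submod V') (R : V -> V' -> Prop) :
    (forall c x y x' y', R x y -> R x' y' -> R (c *: x + x') (c *: y + y')) ->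
    (forall x, Z x -> exists2 y, Z' y & R x y) ->
    (forall y, Z' y -> exists2 x, Z x & R x y) ->
    (forall x y, Z x -> Z' y -> R x y -> W x <-> W' y) ->
  linear_iso (subquot Z W) (subquot Z' W').
Proof.
move=> RL Rt Rs RW.
pose y x (Zx : Z x) := s2val (cid2 (Rt x Zx)).
have yZ x (Zx : Z x) : Z' (y x Zx) := s2valP (cid2 (Rt x Zx)).
have yR x (Zx : Z x) : R x (y x Zx) := s2valP' (cid2 (Rt x Zx)).
pose g x (Zx : Z x) := sclass W' (yZ x Zx).
have RB x1 y1 x2 y2 : R x1 y1 -> R x2 y2 -> R (x1 - x2) (y1 - y2).
  by move=> R1 R2; rewrite [x1 - _]addrC [y1 - _]addrC -!scaleN1r; apply: RL.
have gL c x1 x2 Z1 Z2 Z3 : g (c *: x1 + x2) Z3 = c *: g x1 Z1 + g x2 Z2.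
  rewrite /g -sclassL; first exact: submodL.
  move=> Z4; apply/sclass_eq; have /(_ _ _) RW0 := RW 0.
  apply/(RW 0); [exact: submod0|exact: submodB| |exact: submod0].
  by rewrite -(subrr (c *: x1 + x2)); apply: RB => //; apply: RL.
have gW x Zx : W x -> g x Zx = 0.
  by move=> Wx; apply/sclass_eq0; apply/(RW x).
exists (@subquot_lift k V Z W _ g gL gW); apply: inj_surj_bij => [p q|q].
  case: (sclass_surj p) (sclass_surj q) => x1 [Z1 ->] [x2 [Z2 ->]].
  rewrite !subquot_liftE => /sclass_eq W12; apply/sclass_eq.
  by apply/(RW _ (y x1 Z1 - y x2 Z2)); [exact: submodB|exact: submodB|exact: RB|].
case: (sclass_surj q) => z [Zz ->]; have [x Zx Rx] := Rs z Zz.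
exists (sclass W Zx); rewrite subquot_liftE; apply/sclass_eq.
apply/(RW 0); [exact: submod0|exact: submodB| |exact: submod0].
by rewrite -(subrr x); apply: RB.
Qed.
End Isomorphisms.

(** * Connecting isomorphisms for an acyclic middle complex *)

Section LongExact.
Context (k : comPzRingType) (C' C C'' : nat -> lmodType k).
Context (d' : forall n, {linear C' n -> C' n.+1}) (d : forall n, {linear C n -> C n.+1})
        (d'' : forall n, {linear C'' n -> C'' n.+1}).
Context (i : forall n, {linear C' n -> C n}) (p : forall n, {linear C n -> C'' n}).
Hypotheses (id' : forall n x, i n.+1 (d' n x) = d n (i n x)).
Hypotheses (pd : forall n x, p n.+1 (d n x) = d'' n (p n x)).
Hypothesis (i_inj : forall n, injective (i n)).
Hypothesis (p_surj : forall n y, exists x, p n x = y).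
Hypothesis (exact_ip : forall n x, p n x = 0 <-> exists y, x = i n y).
Hypothesis (acyclic : forall n x, d n.+1 x = 0 -> exists y, x = d n y).
Hypothesis (dK : forall n x, d n.+1 (d n x) = 0).

Let conn n (x : C' n.+1) (y : C'' n) := exists2 z, p n z = y & d n z = i n.+1 x.

Let connL n c x y x' y' : @conn n x y -> @conn n x' y' -> @conn n (c *: x + x') (c *: y + y').
Proof.
by move=> [z <- dz] [z' <- dz']; exists (c *: z + z'); rewrite !linearP // dz dz'.
Qed.
Let conn_total n x : d' n.+1 x = 0 -> exists2 y, d'' n y = 0 & @conn n x y.
Proof.
move=> dx; have [|z zE] := @acyclic n (i n.+1 x); first by rewrite -id' dx linear0.
exists (p n z); last by exists z.
by rewrite -pd -zE; apply/exact_ip; exists x.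
Qed.
Let conn_surj n y : d'' n y = 0 -> exists2 x, d' n.+1 x = 0 & @conn n x y.
Proof.
move=> dy; have [z zE] := p_surj y.
have /exact_ip [x xE] : p n.+1 (d n z) = 0 by rewrite pd zE.
exists x; last by exists z.
by apply: i_inj; rewrite id' -xE dK linear0.
Qed.

Lemma connecting_iso n : linear_iso (cohomology d' n.+2) (cohomology d'' n.+1).
Proof.
apply: (subquot_rel_iso (R := @conn n.+1)); [exact: connL|exact: conn_total|exact: conn_surj|].
move=> x y dx dy [z zE dz]; split=> [[w _ xE]|[u _ yE]].
  have : d n.+1 (z - i n.+1 w) = 0 by rewrite linearB dz xE id' subrr.
  case/acyclic => t tE; exists (p n t) => //.
  rewrite -pd -tE linearB zE (_ : p n.+1 (i n.+1 w) = 0) ?subr0 //.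
  by apply/exact_ip; exists w.
have [t tE] := p_surj u.
have /exact_ip [w wE] : p n.+1 (z - d n t) = 0 by rewrite linearB zE yE pd tE subrr.
exists w => //; apply: i_inj; rewrite id' -wE linearB dK subr0.
by rewrite dz.
Qed.

(** The middle complex is acyclic in positive degrees only, so the images of its cocycles of degree
    0 have to be divided out. *)
Lemma connecting_iso0 : linear_iso (cohomology d' 1)
  (subquot (ker_submod (d'' 0)) (im_submod (p 0) (ker_submod (d 0)))).
Proof.
apply: (subquot_rel_iso (R := @conn 0)); [exact: connL|exact: conn_total|exact: conn_surj|].
move=> x y dx dy [z zE dz]; split=> [[w _ xE]|[t dt yE]].
  exists (z - i 0 w); first by rewrite /= linearB dz xE id' subrr.
  rewrite linearB zE (_ : p 0 (i 0 w) = 0) ?subr0 //.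
  by apply/exact_ip; exists w.
have /exact_ip [w wE] : p 0 (z - t) = 0 by rewrite linearB zE yE subrr.
exists w => //; apply: i_inj; rewrite id' -wE linearB dz.
by have -> : d 0 t = 0 by []; rewrite subr0.
Qed.
End LongExact.

(** * The bimodule Hom_k(E, M) and the quotient by M *)

Section Coinduction.
Context (k : comPzRingType) (E : algebra k) (M : lmodType k) (S : bimodule_on E M).

Local Notation J := (hom_mod E M).
Let jl_fun (e : E) (phi : J) (x : E) : M := lact S e (phi x).
Let jl_lin e phi : lin (jl_fun e phi). Proof. by move=> c x y; rewrite /jl_fun !linearP. Qed.
Let jl e phi : J := lin_pack (jl_lin e phi).
Let jl_linr e : lin (jl e).
Proof. by move=> c x y; apply: linear_ext => t; rewrite /= /jl_fun /= linearP. Qed.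
Let jl_linl : lin (fun e => lin_pack (jl_linr e)).
Proof. by move=> c x y; apply: linear_ext => phi; apply: linear_ext => t; rewrite /= /jl_fun linearP. Qed.

Let jr_fun (e : E) (phi : J) (x : E) : M := phi (e * x).
Let jr_lin e phi : lin (jr_fun e phi). Proof. by move=> c x y; rewrite /jr_fun mulrDr -algZr linearP. Qed.
Let jr e phi : J := lin_pack (jr_lin e phi).
Let jr_linr e : lin (jr e).
Proof. by move=> c x y; apply: linear_ext => t. Qed.
Let jr_linl : lin (fun e => lin_pack (jr_linr e)).
Proof.
move=> c x y; apply: linear_ext => phi; apply: linear_ext => t.
by rewrite /= /jr_fun mulrDl -algZl linearP.
Qed.

(** Only the right action is coinduced. The left one acts on values and so commutes with operations
    on the argument, as the homotopies of the acyclicity proof require. *)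
Fact coind_ex : exists T : bimodule_on E J, forall e phi x,
  (lact T e phi : J) x = lact S e (phi x) /\ (ract T e phi : J) x = phi (e * x).
Proof.
unshelve eexists (@Bimodule k E J (lin_pack jl_linl) (lin_pack jr_linl) _ _ _ _ _) => //.
- by move=> a b phi; apply: linear_ext => x; rewrite /= /jl_fun lactM.
- by move=> a b phi; apply: linear_ext => x; rewrite /= /jr_fun /= /jr_fun mulrA.
- by move=> phi; apply: linear_ext => x; rewrite /= /jl_fun lact1.
- by move=> phi; apply: linear_ext => x; rewrite /= /jr_fun mul1r.
- by move=> a b phi; apply: linear_ext => x.
Qed.
Definition coind : bimodule_on E J := sval (cid coind_ex).
Lemma coind_lact e (phi : J) x : (lact coind e phi : J) x = lact S e (phi x).
Proof. exact: (svalP (cid coind_ex) e phi x).1. Qed.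
Lemma coind_ract e (phi : J) x : (ract coind e phi : J) x = phi (e * x).
Proof. exact: (svalP (cid coind_ex) e phi x).2. Qed.

(* The quotient of J by the image of M splits over k as Hom_k(E/k, M). *)
Local Notation Q := (hom_mod (bar E) M).
Local Notation cls x := (qclass (scalars E) x : bar E).
Lemma cls1 : cls 1 = 0.
Proof. by apply/qclass_eq; rewrite subr0; exists 1; rewrite scale1r. Qed.

Let bar_lift_ex (phi : J) : phi 1 = 0 -> exists L : Q, forall x, L (cls x) = phi x.
Proof.
move=> p1; have W x : scalars E x -> phi x = 0 by case=> c ->; rewrite (linZ (linear_lin phi)) p1 scaler0.
by exists (quot_lift W) => x; apply: quot_liftE.
Qed.

Let pfun (phi : J) (x : E) : M := phi x - ract S x (phi 1).
Let pfun_lin phi : lin (pfun phi).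
Proof. by move=> c x y; rewrite /pfun !linearP /= scalerBr addrACA scalerN. Qed.
Let pex (phi : J) : exists L : Q, forall x, L (cls x) = phi x - ract S x (phi 1).
Proof.
have [|L LE] := @bar_lift_ex (lin_pack (pfun_lin phi)); first by rewrite /= /pfun ract1 subrr.
by exists L.
Qed.

Lemma bar_ext (phi psi : Q) : (forall x, phi (cls x) = psi (cls x)) -> phi = psi.
Proof. by move=> pp; apply: linear_ext => q; case: (qclass_surj q) => x ->. Qed.

Let p (phi : J) : Q := sval (cid (pex phi)).
Let pE (phi : J) x : p phi (cls x) = phi x - ract S x (phi 1).
Proof. exact: (svalP (cid (pex phi))). Qed.
Let p_lin : lin p.
Proof.
move=> c x y; apply: bar_ext => t; rewrite /= !pE /= linearP /= scalerBr opprD addrACA.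
by [].
Qed.
Definition coind_proj : {linear J -> Q} := lin_pack p_lin.
Lemma coind_projE (phi : J) x : coind_proj phi (cls x) = phi x - ract S x (phi 1).
Proof. exact: pE. Qed.

Let sec_fun (phi : Q) : J := lin_pack (lin_comp (linear_lin phi) (linear_lin (qclass (scalars E)))).
Let sec_lin : lin sec_fun. Proof. by move=> c x y; apply: linear_ext => t. Qed.
Definition coind_sec : {linear Q -> J} := lin_pack sec_lin.
Lemma coind_secE (phi : Q) x : coind_sec phi x = phi (cls x). Proof. by []. Qed.

Let inc_fun (m : M) : J := lin_pack (fun c x y => etrans (congr1 (fun g
  : {linear M -> M} => g m) (linearP (ract S) c x y)) erefl
    : ract S (c *: x + y) m = c *: ract S x m + ract S y m).
Let inc_lin : lin inc_fun.
Proof. by move=> c x y; apply: linear_ext => t; rewrite /= linearP. Qed.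
Definition coind_inc : {linear M -> J} := lin_pack inc_lin.
Lemma coind_incE m x : coind_inc m x = ract S x m. Proof. by []. Qed.

Definition coind_ev : {linear J -> M} := lin_pack (fun c (x y : J) => erefl : (c *: x + y
  : J) 1 = c *: x 1 + y 1).
Lemma coind_evE (phi : J) : coind_ev phi = phi 1. Proof. by []. Qed.

Let qr_fun e (phi : Q) (x : E) : M := phi (cls (e * x)) - ract S x (phi (cls e)).
Let qr_fun_lin e (phi : Q) : lin (qr_fun e phi).
Proof. by move=> c x y; rewrite /qr_fun mulrDr -algZr !linearP /= scalerBr ?opprD addrACA ?scalerN. Qed.
Let qr_ex e (phi : Q) : exists L : Q, forall x, L (cls x) = phi (cls (e * x)) - ract S x (phi (cls e)).
Proof.
have [|L LE] := @bar_lift_ex (lin_pack (qr_fun_lin e phi)); last by exists L.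
by rewrite /= /qr_fun mulr1 ract1 subrr.
Qed.
Let qr e (phi : Q) : Q := sval (cid (qr_ex e phi)).
Let qrE e (phi : Q) x : qr e phi (cls x) = phi (cls (e * x)) - ract S x (phi (cls e)).
Proof. exact: (svalP (cid (qr_ex e phi))). Qed.
Let qr_linr e : lin (qr e).
Proof. by move=> c x y; apply: bar_ext => t; rewrite /= !qrE /= linearP /= scalerBr ?opprD addrACA
  ?scalerN. Qed.
Let qr_linl : lin (fun e => lin_pack (qr_linr e)).
Proof.
move=> c x y; apply: linear_ext => phi; apply: bar_ext => t; rewrite /= !qrE.
by rewrite mulrDl -algZl !linearP /= scalerBr ?opprD addrACA ?scalerN.
Qed.
Let ql_fun (e : E) (phi : Q) (x : bar E) : M := lact S e (phi x).
Let ql_lin e phi : lin (ql_fun e phi). Proof. by move=> c x y; rewrite /ql_fun !linearP. Qed.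
Let ql e phi : Q := lin_pack (ql_lin e phi).
Let ql_linr e : lin (ql e).
Proof. by move=> c x y; apply: linear_ext => t; rewrite /= /ql_fun /= linearP. Qed.
Let ql_linl : lin (fun e => lin_pack (ql_linr e)).
Proof. by move=> c x y; apply: linear_ext => phi; apply: linear_ext => t; rewrite /= /ql_fun linearP. Qed.

(** The structure of [coind] carried over by lifting along [coind_sec], acting and projecting; the
    correction term is the value at 1 that the projection removes. *)
Fact coker_ex : exists T : bimodule_on E Q, forall e phi,
  (forall x, (lact T e phi : Q) x = lact S e (phi x)) /\
  (forall x, (ract T e phi : Q) (cls x) = phi (cls (e * x)) - ract S x (phi (cls e))).
Proof.
unshelve eexists (@Bimodule k E Q (lin_pack ql_linl) (lin_pack qr_linl) _ _ _ _ _).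
- by move=> a b phi; apply: linear_ext => x; rewrite /= /ql_fun lactM.
- move=> a b phi; apply: bar_ext => x; rewrite /= !qrE -mulrA ractM linearB.
  by rewrite opprB addrA subrK.
- by move=> phi; apply: linear_ext => x; rewrite /= /ql_fun lact1.
- by move=> phi; apply: bar_ext => x; rewrite /= qrE mul1r cls1 (linear0 phi) (linear0 (ract S x)) subr0.
- move=> a b phi; apply: bar_ext => x; rewrite /= /ql_fun !qrE /= /ql_fun linearB.
  by rewrite lact_ract.
by move=> e phi; split=> x //=; apply: qrE.
Qed.
Definition coker : bimodule_on E Q := sval (cid coker_ex).
Lemma coker_lact e (phi : Q) x : (lact coker e phi : Q) x = lact S e (phi x).
Proof. exact: (svalP (cid coker_ex) e phi).1. Qed.
Lemma coker_ract e (phi : Q) x :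
  (ract coker e phi : Q) (cls x) = phi (cls (e * x)) - ract S x (phi (cls e)).
Proof. exact: (svalP (cid coker_ex) e phi).2. Qed.

Lemma coind_proj_sec phi : coind_proj (coind_sec phi) = phi.
Proof. by apply: bar_ext => x; rewrite coind_projE !coind_secE cls1 (linear0 phi) (linear0 (ract S x))
  subr0. Qed.
(** The splitting is linear over k, not over [E]. That is enough, because the complexes are additive
    functors of k-linear maps in each degree. *)
Lemma coind_split (phi : J) : phi = coind_inc (coind_ev phi) + coind_sec (coind_proj phi).
Proof.
apply: linear_ext => x; rewrite -[RHS]/(ract S x (phi 1) + coind_sec (coind_proj phi) x).
by rewrite coind_secE coind_projE addrC subrK.
Qed.
Lemma coind_ev_inc m : coind_ev (coind_inc m) = m.
Proof. by rewrite coind_evE coind_incE ract1. Qed.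
Lemma coind_proj_inc m : coind_proj (coind_inc m) = 0.
Proof. by apply: bar_ext => x; rewrite coind_projE !coind_incE ract1 subrr. Qed.
End Coinduction.

Definition bimodule_hom (k : comPzRingType) (E : algebra k) (M M' : lmodType k)
    (S : bimodule_on E M) (S' : bimodule_on E M') (u : {linear M -> M'}) : Prop :=
  (forall e m, u (lact S e m) = lact S' e (u m)) /\ (forall e m, u (ract S e m) = ract S' e (u m)).

Section CoinductionHoms.
Context (k : comPzRingType) (E : algebra k) (M : lmodType k) (S : bimodule_on E M).
Lemma coind_inc_hom : bimodule_hom S (coind S) (coind_inc S).
Proof.
split=> e m; apply: linear_ext => x.
  by rewrite coind_lact !coind_incE lact_ract.
by rewrite coind_ract !coind_incE ractM.
Qed.
Lemma coind_proj_hom : bimodule_hom (coind S) (coker S) (coind_proj S).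
Proof.
split=> e phi; apply: bar_ext => x.
  by rewrite coind_projE coker_lact coind_projE !coind_lact linearB lact_ract.
by rewrite coker_ract !coind_projE !coind_ract mulr1 ractM linearB opprB addrA subrK.
Qed.
End CoinductionHoms.

Definition central (k : comPzRingType) (E : algebra k) (M : lmodType k) (S : bimodule_on E M) (m : M) :=
  forall e, lact S e m = ract S e m.

(* An effaceable cohomological functor of bimodules, given by complexes that are functorial in
   linear maps. *)
Record coh_functor (k : comPzRingType) (E : algebra k) := CohFunctor {
  cf_obj : lmodType k -> nat -> lmodType k;
  cf_diff : forall M : lmodType k, bimodule_on E M -> forall n, {linear cf_obj M n -> cf_obj M n.+1};
  cf_map : forall M M' : lmodType k, {linear M -> M'} -> forall n, {linear cf_obj M n -> cf_obj M' n};
  cf_ev : forall M : lmodType k, {linear cf_obj M 0 -> M};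
  cf_diffK : forall (M : lmodType k) (S : bimodule_on E M) n x, cf_diff S n.+1 (cf_diff S n x) = 0;
  cf_map_id : forall (M : lmodType k) (u : {linear M -> M}) n x, (forall m, u m = m) -> cf_map u n x = x;
  cf_map_comp : forall (M M' M'' : lmodType k) (u : {linear M' -> M''}) (v : {linear M -> M'}) (w
    : {linear M -> M''}) n x,
    (forall m, w m = u (v m)) -> cf_map w n x = cf_map u n (cf_map v n x);
  cf_map_add : forall (M M' : lmodType k) (u v w : {linear M -> M'}) n x,
    (forall m, w m = u m + v m) -> cf_map w n x = cf_map u n x + cf_map v n x;
  cf_map_diff : forall (M M' : lmodType k) (S : bimodule_on E M) (S' : bimodule_on E M') (u
    : {linear M -> M'}) n x,
    bimodule_hom S S' u -> cf_map u n.+1 (cf_diff S n x) = cf_diff S' n (cf_map u n x);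
  cf_acyclic : forall (M : lmodType k) (S : bimodule_on E M) n (x : cf_obj (hom_mod E M) n.+1),
    cf_diff (coind S) n.+1 x = 0 -> exists y, x = cf_diff (coind S) n y;
  cf_ev_bij : forall M : lmodType k, bijective (cf_ev M);
  cf_ev_map : forall (M M' : lmodType k) (u : {linear M -> M'}) x, cf_ev M' (cf_map u 0 x) = u (cf_ev M x);
  cf_ev_ker : forall (M : lmodType k) (S : bimodule_on E M) x, cf_diff S 0 x = 0 <-> central S (cf_ev M x)
}.

(** * Effaceable functors with the same degree 0 have isomorphic cohomology *)

Section Uniqueness.
Context (k : comPzRingType) (E : algebra k).

Section One.
Context (T : coh_functor E) (M : lmodType k) (S : bimodule_on E M).
Local Notation inc := (cf_map T (coind_inc S)).
Local Notation proj := (cf_map T (coind_proj S)).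

Lemma cf_map0 (M1 M2 : lmodType k) (u : {linear M1 -> M2}) n x : (forall m, u m = 0) -> cf_map T u n x = 0.
Proof.
move=> u0; have /esym := cf_map_add x (u := u) (v := u) (w := u) (fun m => etrans (u0 m) (esym (etrans
  (congr2 +%R (u0 m) (u0 m)) (addr0 0)))).
by move/eqP; rewrite -subr_eq0 addrK => /eqP.
Qed.

Let inc_inj n : injective (inc n).
Proof.
move=> x y xy; have r z : cf_map T (coind_ev E M) n (inc n z) = z.
  rewrite -(cf_map_comp z (w := idfun)) ?cf_map_id // => m; exact: esym (coind_ev_inc S m).
by rewrite -[x]r xy r.
Qed.
Let proj_surj n y : exists x, proj n x = y.
Proof.
exists (cf_map T (coind_sec E M) n y); rewrite -(cf_map_comp y (w := idfun)) ?cf_map_id // => m.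
exact: esym (coind_proj_sec S m).
Qed.
Let exact_inc_proj n x : proj n x = 0 <-> exists y, x = inc n y.
Proof.
split=> [p0|[y ->]]; last first.
  pose w : {linear M -> hom_mod (bar E) M} := lin_pack (lin_comp (linear_lin (coind_proj S))
    (linear_lin (coind_inc S))).
  rewrite -(cf_map_comp y (w := w)) // cf_map0 // => m; exact: coind_proj_inc.
exists (cf_map T (coind_ev E M) n x).
pose u := lin_pack (lin_comp (linear_lin (coind_inc S)) (linear_lin (coind_ev E M))).
pose v := lin_pack (lin_comp (linear_lin (coind_sec E M)) (linear_lin (coind_proj S))).
rewrite -(cf_map_comp x (w := u)) // -[LHS](cf_map_id x (u := idfun)) //.
rewrite (cf_map_add x (u := u) (v := v)); last by move=> m; exact: (coind_split S m).
by rewrite (cf_map_comp x (w := v) (u := coind_sec E M) (v := coind_proj S)) // p0 linear0 addr0.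
Qed.

Lemma cf_shift n : linear_iso (cohomology (cf_diff T S) n.+2) (cohomology (cf_diff T (coker S)) n.+1).
Proof.
apply: (@connecting_iso k _ _ _ _ (cf_diff T (coind S)) _ inc proj) => //.
- by move=> m x; apply: cf_map_diff; apply: coind_inc_hom.
- by move=> m x; apply: cf_map_diff; apply: coind_proj_hom.
- exact: cf_acyclic.
- exact: cf_diffK.
Qed.
Lemma cf_shift0 : linear_iso (cohomology (cf_diff T S) 1)
  (subquot (ker_submod (cf_diff T (coker S) 0)) (im_submod (proj 0) (ker_submod (cf_diff T (coind S) 0)))).
Proof.
apply: (@connecting_iso0 k _ _ _ _ (cf_diff T (coind S)) _ inc proj) => //.
- by move=> m x; apply: cf_map_diff; apply: coind_inc_hom.
- by move=> m x; apply: cf_map_diff; apply: coind_proj_hom.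
- exact: cf_acyclic.
- exact: cf_diffK.
Qed.
End One.

(** Degree 1 needs its own case: the shift leads to the central elements of the cokernel modulo
    those that come from Hom_k(E, M), a quotient that both functors compute alike through
    [cf_ev]. *)
Lemma coh_functor_iso (T T' : coh_functor E) n (M : lmodType k) (S : bimodule_on E M) :
  linear_iso (cohomology (cf_diff T S) n) (cohomology (cf_diff T' S) n).
Proof.
have ex T0 M0 m : exists x, cf_ev (T0 : coh_functor E) M0 x = m.
  by have [g _ gK] := cf_ev_bij T0 M0; exists (g m).
have inj T0 M0 : injective (cf_ev (T0 : coh_functor E) M0) by apply/bij_inj/cf_ev_bij.
elim: n M S => [|[|n] IH] M S.
- apply: (subquot_rel_iso (R := fun x y => cf_ev T M x = cf_ev T' M y)) => /=.
  + by move=> c x y x' y' E1 E2; rewrite !linearP E1 E2.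
  + move=> x /cf_ev_ker cx; have [y yE] := ex T' M (cf_ev T M x).
    by exists y => //; apply/cf_ev_ker; rewrite yE.
  + move=> y /cf_ev_ker cy; have [x xE] := ex T M (cf_ev T' M y).
    by exists x => //; apply/cf_ev_ker; rewrite xE.
  + move=> x y _ _ E1; split=> [x0|y0].
      by apply: inj; rewrite -E1 x0 !linear0.
    by apply: inj; rewrite E1 y0 !linear0.
- apply: linear_iso_trans (cf_shift0 T S) _; apply/linear_iso_sym.
  apply: linear_iso_trans (cf_shift0 T' S) _; apply/linear_iso_sym.
  apply: (subquot_rel_iso (R := fun x y => cf_ev T _ x = cf_ev T' _ y)) => /=.
  + by move=> c x y x' y' E1 E2; rewrite !linearP E1 E2.
  + move=> x /cf_ev_ker cx; have [y yE] := ex T' _ (cf_ev T _ x).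
    by exists y => //; apply/cf_ev_ker; rewrite yE.
  + move=> y /cf_ev_ker cy; have [x xE] := ex T _ (cf_ev T' _ y).
    by exists x => //; apply/cf_ev_ker; rewrite xE.
  + move=> x y _ _ E1; split=> [[t /cf_ev_ker ct xE]|[t /cf_ev_ker ct yE]].
      have [t' tE] := ex T' _ (cf_ev T _ t); exists t'; first by apply/cf_ev_ker; rewrite tE.
      by apply: inj; rewrite cf_ev_map tE -E1 xE cf_ev_map.
    have [t' tE] := ex T _ (cf_ev T' _ t); exists t'; first by apply/cf_ev_ker; rewrite tE.
    by apply: inj; rewrite cf_ev_map tE E1 yE cf_ev_map.
- apply: linear_iso_trans (cf_shift T S n) _; apply: linear_iso_trans (IH _ (coker S)) _.
  exact/linear_iso_sym/cf_shift.
Qed.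
End Uniqueness.

(** * Acyclicity for coinduced bimodules *)

Section Leading.
Context (k : comPzRingType) (A H E : algebra k) (X : free_extension A H E).
Context (M : lmodType k) (S : bimodule_on E M).
Local Notation iA := (inA X).
Local Notation iH := (inH X).

Lemma lext_zero (c : seq H -> seq A -> M) w a :
  (forall hs, (size hs).+1 = size w -> c hs a = 0) -> lext X S c w a = 0.
Proof.
case: w => [|e w] //= c0; rewrite (_ : nf X w _ = 0) ?linear0 // -(nf0 X M w).
by apply: eq_nf => x hs sh; rewrite c0 ?linear0 // sh.
Qed.

Lemma size_contract (B : algebra k) j (w : seq B) : (j.+1 < size w)%N -> size (contract j w) = (size w).-1.
Proof. by move=> jw; rewrite /contract size_cat /= size_drop size_takel; lia. Qed.

Lemma total_leading (c : seq H -> seq A -> M) h a : (forall u b, (size u < size h)%N -> c u b = 0) ->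
  total X S c h a = (if a is x :: a' then (-1) ^+ size h *: lext X S c (rmul iA (1 :: map iH h) x) a' else 0)
    + (-1) ^+ size h *: rbar X S (c h) a.
Proof.
move=> c0; rewrite /total ldiff_sum rdiff_sum big1 => [|j _]; last first.
  have jw : (j.+1 < size (1%R :: map iH h))%N by move: (ltn_ord j); rewrite -ltnS prednK.
  rewrite lext_zero ?scaler0 // => hs sh; rewrite c0 //.
  by move: (size_contract jw); rewrite -sh /= size_map => ->.
rewrite add0r [size _]/= size_map; congr (_ + _).
rewrite big1 ?addr0 // => i _; rewrite (_ : c (take i h) = fun _ => 0) ?twist0 ?scaler0 //.
by apply: funext => b; rewrite c0 // size_takel ?ltn_ord // ltnW.
Qed.

Lemma size_rmul w x : size (rmul iA w x) = size w.
Proof. by elim: w => [|e [|e' w] IH] //; rewrite -[LHS]/(size (rmul iA (e' :: w) x)).+1 IH. Qed.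
End Leading.

Section Acyclicity.
Context (k : comPzRingType) (A H E : algebra k) (X : free_extension A H E).
Context (M : lmodType k) (S : bimodule_on E M).
Local Notation iA := (inA X).
Local Notation iH := (inH X).
Local Notation J := (hom_mod E M).
Local Notation SJ := (coind S).
Local Notation total := (total X SJ).
Implicit Types (c y : seq H -> seq A -> J) (g : seq A -> J).

Definition eval_at (e : E) : {linear J -> M} :=
  lin_pack (fun z (x y : J) => erefl : (z *: x + y : J) e = z *: x e + y e).

Lemma lext_eval c w a e : (lext X SJ c w a : J) e = lext X S (fun h b => (c h b : J) e) w a.
Proof.
case: w => [|e0 w] //; rewrite /lext coind_lact; congr (lact S e0 _).
rewrite -[LHS]/(eval_at e (nf X w _)) nf_map; apply: eq_nf => x hs _.
by rewrite -[LHS]/((lact SJ (iA x) (c hs a) : J) e) coind_lact.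
Qed.

(* Hom_k(E, M) is coinduced as a right A-module, which gives the rows this contracting homotopy. *)
Lemma row_lin (g : seq A -> J) : mlin g -> forall w, lin (fun e => esum X e (fun b l => (g (rcons w b)
  : J) (iH l))).
Proof.
move=> mg w; apply: esum_linl; split=> [l|b].
  by move=> c x y; rewrite -!cats1 (mg w [::]).
by move=> c x y; rewrite linearP linearP.
Qed.

(** Homotopy identity. With e a sum of products b l, b from [A] and l from [H], the letter b is
    moved to the end of the word. All faces are carried along except the last: there b acts back,
    and (g b)(l) = g(b l) restores the value at e. *)
Lemma row_rbar (g y : seq A -> J) a e : mlin g ->
    (forall w e, (y w : J) e = esum X e (fun b l => (g (rcons w b) : J) (iH l))) ->
  esum X e (fun b l => (rbar X SJ g (rcons a b) : J) (iH l)) =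
  (rbar X SJ y a : J) e + (-1) ^+ (size a).+1 *: (g a : J) e.
Proof.
elim: a g y => [|x a IH] g y mg yE.
  rewrite [rbar _ _ y _]/= add0r expr1 scaleN1r.
  rewrite -[in RHS](esum_eval X e (linear_lin (g [::] : {linear E -> M}))).
  rewrite -(linN (@esum_linF k A H E X M e)); apply: eq_esum => b l.
  rewrite [rcons _ _]/= [rbar _ _ _ _]/= subr0 -[LHS]/(- (ract SJ (iA b) (g [::]) : J) (iH l)).
  by rewrite coind_ract.
have E1 b l : (rbar X SJ g (x :: rcons a b) : J) (iH l) =
    - (mface X SJ g x (rcons a b) : J) (iH l) - (rbar X SJ (fun z => g (x :: z)) (rcons a b) : J) (iH l) by [].
have -> : esum X e (fun b l => (rbar X SJ g (rcons (x :: a) b) : J) (iH l)) =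
    - esum X e (fun b l => (mface X SJ g x (rcons a b) : J) (iH l))
    - esum X e (fun b l => (rbar X SJ (fun z => g (x :: z)) (rcons a b) : J) (iH l)).
  by rewrite -(linN (@esum_linF k A H E X M e)) -(linB (@esum_linF k A H E X M e)).
rewrite (IH (fun z => g (x :: z)) (fun z => y (x :: z))); last 2 first.
- exact: mlin_cons.
- by move=> w e'; rewrite yE.
rewrite -[(rbar X SJ y (x :: a) : J) e]/(- (mface X SJ y x a
  : J) e - (rbar X SJ (fun z => y (x :: z)) a : J) e).
rewrite opprD addrA [in RHS]exprS mulN1r scaleNr; congr (- _ - _ - _).
case: a {IH E1} => [|z a] /=; last by rewrite yE.
rewrite coind_ract yE esum_mulA.
  by [].
split=> [l|b]; first by move=> c u v; rewrite -[LHS]/((g [:: c *: u + v] : J) (iH l)) (mg [::] [::]).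
by move=> c u v; rewrite linearP linearP.
Qed.
(** Clears filtration degree s of a cocycle. The bound [s <= n] guarantees a letter of [A] in that
    degree, on which the homotopy works. *)
Lemma row_step n s c : (s <= n)%N -> ml2 c -> nrm2 c ->
    (forall h a, (size h + size a != n.+1)%N -> c h a = 0) ->
    (forall h a, (size h < s)%N -> c h a = 0) -> (forall h a, total c h a = 0) ->
  exists y, [/\ ml2 y, nrm2 y, forall h a, (size h + size a != n)%N -> y h a = 0 &
    forall h a, (size h < s.+1)%N -> c h a = total y h a].
Proof.
move=> sn mc nc sc c0 dc.
(* The primitive lives in filtration degree s only; its sign compensates those of [total_leading]
   and [row_rbar] together. *)
pose y h a : J := if size h == s then (-1) ^+ n.+1 *: (lin_pack (row_lin (mc.2 h) a) : J) else 0.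
have yE h a e : size h = s -> (y h a : J) e = (-1) ^+ n.+1 *: esum X e (fun b l => (c h (rcons a b) :
  J) (iH l)).
  by move=> sh; rewrite /y sh eqxx.
have y0 h a : size h != s -> y h a = 0 by rewrite /y => /negPf ->.
have esum0 e : esum X e (fun _ _ => 0 : M) = 0 by exact: (lin0 (@esum_linF k A H E X M e)).
have ys u b : (size u + size b != n)%N -> y u b = 0.
  move=> ha; case: (eqVneq (size u) s) => su; last by rewrite y0.
  apply: linear_ext => e; rewrite yE // -[RHS](scaler0 _ ((-1) ^+ n.+1)) -(esum0 e); congr (_ *: _).
  by apply: eq_esum => b' l; rewrite sc // size_rcons addnS eqSS.
exists y; split.
- split=> [b u v|h u v] z x1 x2.
    case: (eqVneq (size (u ++ x1 :: v)) s) => su; last first.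
      by rewrite !y0 ?scaler0 ?addr0 //; move: su; rewrite !size_cat.
    apply: linear_ext => e; rewrite -[RHS]/(z *: (y (u ++ x1 :: v) b : J) e + (y (u ++ x2 :: v) b : J) e).
    rewrite !yE; try by rewrite -su !size_cat.
    rewrite scalerA mulrC -scalerA -scalerDr; congr (_ *: _); rewrite -esum_linF.
    by apply: eq_esum => b' l; rewrite (mc.1 (rcons b b') u v).
  case: (eqVneq (size h) s) => su; last by rewrite !y0 ?scaler0 ?addr0.
  apply: linear_ext => e; rewrite -[RHS]/(z *: (y h (u ++ x1 :: v) : J) e + (y h (u ++ x2 :: v) : J) e).
  rewrite !yE // scalerA mulrC -scalerA -scalerDr; congr (_ *: _); rewrite -esum_linF.
  apply: eq_esum => b' l.
  rewrite -[RHS]/(z *: (c h (rcons (u ++ x1 :: v) b') : J) (iH l) + (c h (rcons (u ++ x2 :: v) b') : J) (iH l)).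
  by rewrite !rcons_cat !rcons_cons (mc.2 h u (rcons v b')).
- split=> [b u v|h u v].
    case: (eqVneq (size (u ++ 1 :: v)) s) => su; last by rewrite y0.
    apply: linear_ext => e; rewrite yE // -[RHS](scaler0 _ ((-1) ^+ n.+1)) -(esum0 e); congr (_ *: _).
    by apply: eq_esum => b' l; rewrite nc.1.
  case: (eqVneq (size h) s) => su; last by rewrite y0.
  apply: linear_ext => e; rewrite yE // -[RHS](scaler0 _ ((-1) ^+ n.+1)) -(esum0 e); congr (_ *: _).
  by apply: eq_esum => b' l; rewrite rcons_cat rcons_cons nc.2.
- exact: ys.
move=> h a; rewrite ltnS leq_eqVlt => /orP[/eqP sh|hs]; last first.
  rewrite c0 // -(total0 X SJ h a).
  have yl u b : (size u < size h)%N -> y u b = 0 by move=> uh; apply: y0; rewrite neq_ltn (ltn_trans uh hs).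
  rewrite total0 total_leading // (_ : y h = fun _ => 0) ?rbar0 ?scaler0 ?addr0; last first.
    by apply: funext => b; apply: y0; rewrite neq_ltn hs.
  case: a => // x a; rewrite lext_zero ?scaler0 // => u; rewrite size_rmul /= size_map => -[su].
  by apply: y0; rewrite su neq_ltn hs.
case: (eqVneq (size h + size a)%N n.+1) => ha; last first.
  rewrite sc // -(total0 X SJ h a); apply: eq_total => u b ub; apply/esym/ys.
  by move: ha; rewrite -ub eqSS.
case: a ha => [|x a] ha; first by move: ha sn; rewrite sh addn0 => ->; rewrite ltnn.
have cl u b : (size u < size h)%N -> c u b = 0 by rewrite sh; apply: c0.
have yl u b : (size u < size h)%N -> y u b = 0 by move=> uh; apply: y0; rewrite -sh neq_ltn uh.
rewrite total_leading //; apply: linear_ext => e.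
rewrite -[RHS]/((-1) ^+ size h *: (lext X SJ y (rmul iA (1 :: map iH h) x) a : J) e
  + (-1) ^+ size h *: (rbar X SJ (y h) (x :: a) : J) e).
pose z u b : J := lin_pack (row_lin (mc.2 u) b).
have zE u b e' : (z u b : J) e' = esum X e' (fun b' l => (c u (rcons b b') : J) (iH l)) by [].
(* The left action on values commutes with the homotopy, so the left term of the primitive is the
   homotopy applied to the left term of [c]. *)
have L1 : (lext X SJ y (rmul iA (1 :: map iH h) x) a : J) e =
    (-1) ^+ n.+1 *: esum X e (fun b l => (lext X SJ c (rmul iA (1 :: map iH h) x) (rcons a b) : J) (iH l)).
  have -> : esum X e (fun b l => (lext X SJ c (rmul iA (1 :: map iH h) x) (rcons a b) : J) (iH l)) =
      (lext X SJ z (rmul iA (1 :: map iH h) x) a : J) e.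
    rewrite lext_eval; transitivity (esum X e (fun b l => lext X S (fun u b' => (c u (rcons b' b)
      : J) (iH l)) (rmul iA (1 :: map iH h) x) a)).
      by apply: eq_esum => b l; rewrite lext_eval; case: (rmul _ _ _).
    rewrite /esum -(lin_sum (@lext_lin _ _ _ _ X _ S (rmul iA (1 :: map iH h) x) a)).
    congr (lext X S _ _ _); apply: funext => u; apply: funext => b; rewrite zE.
    rewrite -[LHS]/(esum X e (fun b' l (u : seq H) (b : seq A) => (c u (rcons b b') : J) (iH l)) u b).
    by rewrite !esum_fun.
  rewrite !lext_eval -(linZ (@lext_lin _ _ _ _ X _ S (rmul iA (1 :: map iH h) x) a)).
  move: (rmul _ _ _) (size_rmul X (1 :: map iH h) x) => [|e1 w] sw; first by [].
  rewrite /lext; congr (lact S e1 _).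
  by apply: eq_nf => b u su; rewrite yE // su; move: sw; rewrite /= size_map => -[->].
have L2 : (rbar X SJ (y h) (x :: a) : J) e = (-1) ^+ n.+1 *: (rbar X SJ (z h) (x :: a) : J) e.
  rewrite (_ : y h = (-1) ^+ n.+1 *: z h); last first.
    by apply: funext => b; apply: linear_ext => e'; rewrite yE.
  by rewrite (linZ (@rbar_lin _ _ _ _ X _ SJ (x :: a))).
have := row_rbar (x :: a) e (mc.2 h) (zE h).
(* The cocycle condition on the word of [A] lengthened by b. *)
have E1 b l : (rbar X SJ (c h) (rcons (x :: a) b) : J) (iH l) =
    - (lext X SJ c (rmul iA (1 :: map iH h) x) (rcons a b) : J) (iH l).
  have := dc h (rcons (x :: a) b); rewrite total_leading // rcons_cons -scalerDr.
  move/(congr1 ( *:%R ((-1) ^+ size h))); rewrite scalerA -exprD addnn -mul2n exprM sqrrN !expr1n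
    scale1r scaler0.
  by move/eqP; rewrite addr_eq0 => /eqP/(congr1 (eval_at (iH l))); rewrite linearN /= => ->; rewrite opprK.
rewrite (eq_esum X e E1) (linN (@esum_linF k A H E X M e)) => Eq.
rewrite L1 L2 !scalerA -scalerDr.
have sol (P : zmodType) (p q r : P) : - p = q + r -> p + q = - r.
  by move=> pqr; rewrite -[q](addrK r) -pqr addNKr.
rewrite (sol _ _ _ _ Eq).
rewrite -scaleNr scalerA mulrN -mulN1r -!exprD -exprS (@sign_par k _ 0) ?expr0 ?scale1r //.
by move: ha => /= ha; lia.
Qed.
End Acyclicity.

(** * Cocycles on words of H alone *)

Section LastColumn.
Context (k : comPzRingType) (A H E : algebra k) (X : free_extension A H E).
Context (M : lmodType k) (S : bimodule_on E M).
Local Notation iA := (inA X).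
Local Notation iH := (inH X).
Local Notation J := (hom_mod E M).
Local Notation SJ := (coind S).
Local Notation total := (total X SJ).

Lemma balanced_rcons (P : lmodType k) (Psi : seq E -> P) e
  : balanced X Psi -> balanced X (fun w => Psi (rcons w e)).
Proof. by move=> B u e1 a e2 v; rewrite !rcons_cat !rcons_cons (B u e1 a e2). Qed.

Lemma balanced_rmul (P : lmodType k) (Psi : seq E -> P) w a e : balanced X Psi -> (0 < size w)%N ->
  Psi (rcons (rmul iA w a) e) = Psi (rcons w (iA a * e)).
Proof.
elim: w Psi => [|e0 [|e1 w] IH] Psi B // _; first exact: (B [::]).
exact: (IH (fun w => Psi (e0 :: w)) (balanced_cons _ B) isT).
Qed.

Lemma ldiff_rcons (P : lmodType k) (Psi : seq E -> P) w l e :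
  ldiff iA (fun u (_ : seq A) => Psi u) (rcons (rcons w l) e) [::] =
  ldiff iA (fun u _ => Psi (rcons u e)) (rcons w l) [::] + (-1) ^+ (size w).+1 *: Psi (rcons w (l * e)).
Proof.
elim: w Psi => [|x w IH] Psi; first by rewrite /= subr0 add0r expr1 scaleN1r.
have {}IH := IH (fun u => Psi (x :: u)).
have cE (Q : seq E -> seq A -> P) v z : ldiff iA Q (x :: rcons v z) [::] =
   - Q (x * head 0 (rcons v z) :: behead (rcons v z)) [::] - ldiff iA (fun u => Q (x :: u)) (rcons v z) [::].
  by case: v.
rewrite !rcons_cons !cE IH opprD addrA [in RHS]exprS mulN1r scaleNr; congr (- _ - _ - _).
by case: (w) => [|y v].
Qed.

Lemma balanced_ext (P : lmodType k) (F G : seq E -> P) m : mlin F -> mlin G -> balanced X F -> balanced X G ->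
    (forall e hs, size hs = m -> F (e :: map iH hs) = G (e :: map iH hs)) ->
  forall e w, size w = m -> F (e :: w) = G (e :: w).
Proof.
move=> mF mG bF bG FG e w sw; rewrite -(nf_balanced _ _ mF bF) -(nf_balanced _ _ mG bG).
by apply: eq_nf => x hs sh; apply: FG; rewrite sh.
Qed.

Lemma eq_ldiff1 (P : lmodType k) (F G : seq E -> seq A -> P) w :
  (forall u, (size u).+1 = size w -> F u [::] = G u [::]) -> ldiff iA F w [::] = ldiff iA G w [::].
Proof.
elim: w F G => [|e [|e' w] IH] F G FG //; rewrite !ldiff_cons FG //; congr (_ - _).
by apply: IH => u su; apply: FG; rewrite /= su.
Qed.

Lemma rdiff_last (N : lmodType k) (T : bimodule_on E N) (phi : seq H -> seq A -> N) h l :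
    (forall u b, (size u < size h)%N -> phi u b = 0) ->
  rdiff X T phi (rcons h l) [::] = (-1) ^+ size h *: ract T (iH l) (phi h [::]).
Proof.
elim: h phi => [|x h IH] phi phi0; first by rewrite /= subr0 scale1r.
rewrite rcons_cons [LHS]/= IH => [|u b uh]; last exact: phi0.
rewrite (_ : phi [::] = fun _ => 0) ?twist0 ?sub0r ?exprS ?mulN1r ?scaleNr //.
by apply: funext => b; apply: phi0.
Qed.

(** Homotopy of the bar complex relative to [A]: the cochain is evaluated at 1, extended to words of
    [E], and the new argument is appended as a last letter. The cocycle condition on words of [H]
    gives the identity for arguments in [H], and the one with a single letter of [A] extends it to
    all of [E]. *)
Lemma last_step n c : ml2 c -> nrm2 c ->
    (forall h a, (size h + size a != n.+1)%N -> c h a = 0) ->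
    (forall h a, (size h < n.+1)%N -> c h a = 0) -> (forall h a, total c h a = 0) ->
  exists y : seq H -> seq A -> J, [/\ ml2 y, nrm2 y, forall h a, (size h + size a != n)%N -> y h a = 0 &
    forall h a, c h a = total y h a].
Proof.
move=> mc nc sc c0 dc.
pose c1 h a : M := (c h a : J) 1.
have mc1 : ml2 c1.
  by split=> [b u v|h u v] z x1 x2; rewrite /c1 ?(mc.1 b u v) ?(mc.2 h u v).
have nc1 : nrm2 c1.
  by split=> [b u v|h u v]; rewrite /c1 ?(nc.1 b u v) ?(nc.2 h u v).
pose Psi w : M := lext X S c1 w [::].
have mP : mlin Psi := (lext_ml2 X S mc1).1 [::].
have bP : balanced X Psi := lext_balanced X S [::] mc1.
have Pl e e' w : Psi (e * e' :: w) = lact S e (Psi (e' :: w)) by rewrite /Psi lext_mulr.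
have lP h : lin (fun e => Psi (rcons (1 :: map iH h) e)).
  by have := mP (1 :: map iH h) [::]; under eq_fun do rewrite cats1.
pose chi (h : seq H) (a : seq A) : J := if (size h == n) && nilp a then lin_pack (lP h) else 0.
have chiE h e : size h = n -> (chi h [::] : J) e = Psi (rcons (1 :: map iH h) e).
  by move=> sh; rewrite /chi sh eqxx.
have chi0 h a : (size h + size a != n)%N || (size h != n) -> chi h a = 0.
  by case: a => [|x a]; rewrite /chi ?andbF // addn0 orbb andbT => /negPf ->.
have chin h u x v : chi h (u ++ x :: v) = 0 by rewrite /chi; case: u => [|x' u]; rewrite andbF.
have mchi : ml2 chi.
  split=> [b u v|h u v] z x1 x2; last first.
    by rewrite !chin scaler0 addr0.
  case: b => [|y b]; last by rewrite /chi !andbF scaler0 addr0.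
  case: (eqVneq (size (u ++ x1 :: v)) n) => su; last first.
    by rewrite !chi0 ?scaler0 ?addr0 //; apply/orP; right; move: su; rewrite !size_cat.
  apply: linear_ext => e; rewrite -[RHS]/(z *: (chi (u ++ x1 :: v) [::]
    : J) e + (chi (u ++ x2 :: v) [::] : J) e).
  rewrite !chiE; try by rewrite -su !size_cat.
  by rewrite !map_cat !map_cons linearP -!cat_cons !rcons_cat !rcons_cons (mP (1 :: map iH u)).
have nchi : nrm2 chi.
  split=> [b u v|h u v]; last first.
    exact: chin.
  case: b => [|y b]; last by rewrite /chi !andbF.
  case: (eqVneq (size (u ++ (1 : H) :: v)) n) => su; last by rewrite chi0 ?su ?orbT.
  apply: linear_ext => e; rewrite chiE // map_cat map_cons inH1 -(inA1 X) -cat_cons rcons_cat rcons_cons.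
  exact: lext_letterA.
(* [Psi] with its last letter fixed is again balanced, so extending [chi] to words of [E] just
   appends the argument. *)
have K e0 w e : size w = n -> (lext X SJ chi (e0 :: w) [::] : J) e = Psi (rcons (e0 :: w) e).
  move=> sw; rewrite lext_eval /=.
  have bP' := balanced_rcons e bP.
  have mP' : mlin (fun w => Psi (rcons w e)).
    by move=> u v z x y; rewrite !rcons_cat !rcons_cons (mP u (rcons v e)).
  rewrite nf_map -[RHS](@nf_balanced _ _ _ _ X _ (fun w => Psi (rcons w e)) e0 w mP' bP');
    apply: eq_nf => x hs sh.
  by rewrite chiE ?sh // !rcons_cons -lactM -Pl mulr1.
pose G w := ldiff iA (fun u (_ : seq A) => Psi u) w [::].
have mG : mlin G by apply: ldiff_mlinl.
have bG : balanced X G by apply: ldiff_balanced => b; apply: bP.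
(* The cocycle condition with one letter x of [A]: letting x pass to the left through [h] is the
   same as multiplying the argument by x. *)
have Cx h x e : size h = n.+1 -> (lext X SJ c (rmul iA (1 :: map iH h) x) [::] : J) e = (c h [::]
  : J) (iA x * e).
  move=> sh; have := dc h [:: x]; rewrite total_leading; last by move=> u b; rewrite sh; apply: c0.
  rewrite -scalerDr => /(congr1 ( *:%R ((-1) ^+ size h))).
  rewrite scalerA -exprD addnn -mul2n exprM sqrrN !expr1n scale1r scaler0 [rbar _ _ _ _]/= subr0.
  by move=> /eqP; rewrite subr_eq0 => /eqP ->; rewrite coind_ract.
(* The cocycle condition on n + 2 letters of [H], evaluated at 1, isolates the value of [c] at the
   last letter; balancedness then allows arbitrary words of [E] before that letter. *)
have G1 e0 w l : size w = n.+1 ->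
    G (rcons (e0 :: w) (iH l)) = (-1) ^+ n *: (lext X SJ c (e0 :: w) [::] : J) (iH l).
  move=> sw; have [m1 m2] := lext_ml2 X SJ mc.
  apply: (@balanced_ext M (fun w => G (rcons w (iH l)))
    (fun w => (-1) ^+ n *: (lext X SJ c w [::] : J) (iH l)) n.+1) => //.
  - by move=> u v z x y; rewrite !rcons_cat !rcons_cons (mG u (rcons v (iH l))).
  - apply: (mlin_comp_lin (F := fun m : J => (-1) ^+ n *: m (iH l)) _ (m1 [::])).
    by apply: lin_scale => z x y.
  - exact: balanced_rcons.
  - by move=> u e a e' v; rewrite (lext_balanced X SJ [::] mc u e a e' v).
  move=> {e0 w sw} e0 hs sh.
  have -> : G (rcons (e0 :: map iH hs) (iH l)) = lact S e0 (G (rcons (1 :: map iH hs) (iH l))).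
    rewrite /G -[in LHS](mulr1 e0) rcons_cons ldiff_mulr ldiff_map; apply: eq_ldiff => -[|x v] b //.
  rewrite lext_in // coind_lact -linearZ; congr (lact S e0 _).
  have := dc (rcons hs l) [::]; rewrite totalE rdiff_last; last by move=> u b; rewrite sh; apply: c0.
  move/(congr1 (eval_at M 1)); rewrite linear0 linearD (linZ (linear_lin (eval_at M 1))) ldiff_map sh
    exprS mulN1r scaleNr => /eqP.
  rewrite subr_eq0 [eval_at _ _ (ract _ _ _)]/= coind_ract mulr1 => /eqP <-.
  rewrite /G map_rcons -rcons_cons; apply: eq_ldiff1 => u _.
  by rewrite [RHS]/= lext_eval.
exists (fun h a => (-1) ^+ n *: chi h a); split.
- by split=> [b u v|h u v]; apply: lin_scale; [apply: mchi.1|apply: mchi.2].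
- by split=> [b u v|h u v]; rewrite ?nchi.1 ?nchi.2 scaler0.
- by move=> h a s; rewrite chi0 ?scaler0 // s.
move=> h a.
have -> : total (fun h a => (-1) ^+ n *: chi h a) h a = (-1) ^+ n *: total chi h a.
  exact: (linZ (@total_lin _ _ _ _ X _ SJ h a)).
case: (eqVneq (size h + size a)%N n.+1) => ha; last first.
  rewrite sc // (_ : total chi h a = 0) ?scaler0 // -(total0 X SJ h a); apply: eq_total => u b ub; apply: chi0.
  by apply/orP; left; move: ha; rewrite -ub eqSS.
(* Below n both sides vanish, above n the identity is [G0], and at n there is one letter of [A],
   whose two terms cancel by balancedness. *)
case: (ltngtP (size h) n) => hn.
- rewrite c0; last exact: ltnW.
  rewrite total_leading; last by move=> u b uh; apply: chi0; rewrite (ltn_eqF (ltn_trans uh hn)) orbT.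
  rewrite (_ : chi h = fun _ => 0) ?rbar0 ?scaler0 ?addr0; last first.
    by apply: funext => b; apply: chi0; rewrite (ltn_eqF hn) orbT.
  case: a {ha} => [|x a]; first by rewrite scaler0.
  rewrite lext_zero ?scaler0 // => u; rewrite size_rmul /= size_map => -[su].
  by apply: chi0; rewrite su (ltn_eqF hn) orbT.
- case: a ha => [|x a] ha; last by move: ha hn => /=; lia.
  move: ha; rewrite addn0 => sh {hn}.
  have G0 : forall e, ldiff iA (fun u _ => Psi u) (rcons (1 :: map iH h) e) [::] = (-1) ^+ n *: (c h
    [::] : J) e.
    have LG : lin (fun e => ldiff iA (fun u (_ : seq A) => Psi u) (rcons (1 :: map iH h) e) [::]).
      by have := mG (1 :: map iH h) [::]; under eq_fun do rewrite cats1.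
    move=> e; rewrite {1}(eterms_sum X e) (lin_sum LG) {2}(eterms_sum X e) linear_sum scaler_sumr.
    apply: eq_bigr => -[a l] _; rewrite -[LHS]/(G (rcons (1 :: map iH h) (iA a * iH l))).
    rewrite -[RHS]/((-1) ^+ n *: (c h [::] : J) (iA a * iH l)) -balanced_rmul //.
    case: (rmul _ _ _) (size_rmul X (1 :: map iH h) a) (Cx h a (iH l) sh) => // e0 w.
    by rewrite /= size_map => -[sw] <-; apply: G1; rewrite sw.
  apply: linear_ext => e; rewrite -[RHS]/((-1) ^+ n *: (total chi h [::] : J) e).
  suff -> : (total chi h [::] : J) e = ldiff iA (fun u (_ : seq A) => Psi u) (rcons (1 :: map iH h) e) [::].
    by rewrite G0 scalerA -exprD addnn -mul2n exprM sqrrN !expr1n scale1r.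
  case/lastP: h sh {G0} => [//|h l]; rewrite size_rcons => -[sh].
  rewrite totalE rdiff_last => [|u b uh]; last by apply: chi0; rewrite -sh (ltn_eqF uh) orbT.
  rewrite map_rcons -rcons_cons ldiff_rcons; set D := ldiff iA (lext _ _ _) _ _.
  rewrite -[LHS]/((D : J) e + (-1) ^+ size h *: (ract SJ (iH l) (chi h [::]) : J) e).
  rewrite coind_ract chiE // [size (_ :: _)]/= size_map !exprS !mulN1r opprK; congr (_ + _).
  rewrite /D -[LHS]/(eval_at M e _) ldiff_map; apply: eq_ldiff1 => u.
  rewrite size_rcons [size (_ :: _)]/= size_map; case: u => [|e0 w] // [sw].
  by rewrite -[RHS]K // sw.
move: ha; rewrite hn -addn1 => /addnI; case: a => [|x [|y a]] // _.
rewrite c0 ?hn // total_leading; last by move=> u b uh; apply: chi0; rewrite -hn (ltn_eqF uh) orbT.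
rewrite -scalerDr (_ : _ + _ = 0) ?scaler0 //; apply: linear_ext => e.
rewrite -[LHS]/((lext X SJ chi (rmul iA (1 :: map iH h) x) [::]
  : J) e + (- ((ract SJ (iA x) (chi h [::]) : J) e) - 0)).
rewrite coind_ract chiE // -balanced_rmul // subr0.
case: (rmul _ _ _) (size_rmul X (1 :: map iH h) x) => // e0 w; rewrite /= size_map => -[sw].
by rewrite K ?subrr // sw.
Qed.
End LastColumn.

Definition homogeneous (k : comPzRingType) (A H : algebra k) (M : lmodType k) n (c : seq H -> seq A -> M) :=
  [/\ ml2 c, nrm2 c & forall h a, (size h + size a != n)%N -> c h a = 0].

Lemma homogeneous0 (k : comPzRingType) (A H : algebra k) (M : lmodType k) (m : M) :
  homogeneous 0 (fun (h : seq H) (a : seq A) => if (h, a) is ([::], [::]) then m else 0).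
Proof.
split; last by case=> [|? ?] [].
- split=> [b|[|z h]] [|x u] v c y z' /=; rewrite ?scaler0 ?addr0 //.
- by split=> [b|[|z h]] [|x u] v.
Qed.

Section Homogeneous.
Context (k : comPzRingType) (A H E : algebra k) (X : free_extension A H E).
Context (M : lmodType k) (S : bimodule_on E M).
Implicit Types (c : seq H -> seq A -> M).

Lemma homogeneousL n z c c' : homogeneous n c -> homogeneous n c' -> homogeneous n (fun h a => z *: c h
  a + c' h a).
Proof.
move=> [m1 n1 s1] [m2 n2 s2]; split.
- by split=> [b|h] u v; apply: lin_add; [apply: lin_scale|..|apply: lin_scale|];
    [apply: m1.1|apply: m2.1|apply: m1.2|apply: m2.2].
- by split=> [b|h] u v; rewrite ?n1.1 ?n1.2 ?n2.1 ?n2.2 scaler0 addr0.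
- by move=> h a s; rewrite s1 // s2 // scaler0 addr0.
Qed.

Lemma homogeneous_total n c : homogeneous n c -> homogeneous n.+1 (total X S c).
Proof.
move=> [m1 n1 s1]; split; [exact: total_ml2|exact: total_nrm2|] => h a ha.
rewrite -(total0 X S h a); apply: eq_total => u b ub; apply: s1.
by move: ha; rewrite -ub eqSS.
Qed.
End Homogeneous.

Section Acyclic.
Context (k : comPzRingType) (A H E : algebra k) (X : free_extension A H E).
Context (M : lmodType k) (S : bimodule_on E M).
Local Notation J := (hom_mod E M).
Local Notation total := (total X (coind S)).

(** [row_step] clears the filtration degrees 0 to n one after the other; what is left lives on words
    of [H] and falls to [last_step]. *)
Lemma total_acyclic n (c : seq H -> seq A -> J) : homogeneous n.+1 c -> (forall h a, total c h a = 0) ->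
  exists2 y : seq H -> seq A -> J, homogeneous n y & forall h a, c h a = total y h a.
Proof.
move=> gc dc.
have L z c1 c2 h a : total (fun h a => z *: c1 h a + c2 h a) h a = z *: total c1 h a + total c2 h a.
  exact: (@total_lin _ _ _ _ X _ (coind S) h a z c1 c2).
have sub y : homogeneous n y -> homogeneous n.+1 (fun h a => c h a - total y h a) /\
    (forall h a, total (fun h a => c h a - total y h a) h a = 0).
  move=> gy; have -> : (fun h a => c h a - total y h a) = (fun h a => (-1) *: total y h a + c h a).
    by apply: funext => h; apply: funext => a; rewrite scaleN1r addrC.
  split; first exact: (homogeneousL _ (homogeneous_total X (coind S) gy) gc).
  by move=> h a; rewrite L dc total_total ?scaler0 ?addr0 //; case: gy.
have step s : (s <= n.+1)%N -> exists2 y : seq H -> seq A -> J, homogeneous n y &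
    forall h a, (size h < s)%N -> c h a = total y h a.
  elim: s => [|s IH] sn.
    exists (fun _ _ => 0) => //; split=> //; split=> [b|h] u v; exact: lin_zero.
  have [y gy yE] := IH (ltnW sn); have [[m1 n1 s1] d1] := sub y gy.
  have c0 h a : (size h < s)%N -> c h a - total y h a = 0 by move=> hs; rewrite yE // subrr.
  have [y' [m2 n2 s2 y'E]] := @row_step _ _ _ _ _ _ _ n s _ sn m1 n1 s1 c0 d1.
  exists (fun h a => 1 *: y' h a + y h a); first exact: homogeneousL.
  by move=> h a hs; rewrite L scale1r -y'E // subrK.
have [y gy yE] := step n.+1 (leqnn _); have [[m1 n1 s1] d1] := sub y gy.
have c0 h a : (size h < n.+1)%N -> c h a - total y h a = 0 by move=> hs; rewrite yE // subrr.
have [y' [m2 n2 s2 y'E]] := last_step m1 n1 s1 c0 d1.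
exists (fun h a => 1 *: y' h a + y h a); first exact: homogeneousL.
by move=> h a; rewrite L scale1r -y'E // subrK.
Qed.
End Acyclic.

(** * The two cohomological functors *)

Section TotalFunctoriality.
Context (k : comPzRingType) (A H E : algebra k) (X : free_extension A H E).
Local Notation iA := (inA X).
Local Notation iH := (inH X).

Lemma total_map (M M' : lmodType k) (S : bimodule_on E M) (S' : bimodule_on E M') (u : {linear M -> M'})
    (c : seq H -> seq A -> M) h a : bimodule_hom S S' u ->
  u (total X S c h a) = total X S' (fun h b => u (c h b)) h a.
Proof.
move=> [uL uR]; rewrite /total linearD (rdiff_map X uR) ldiff_map; congr (_ + _).
apply: eq_ldiff => -[|e w] b _ _; first exact: linear0.
by rewrite /= uL nf_map; congr (lact S' e _); apply: eq_nf => x hs _; rewrite uL.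
Qed.

(** Words of total length 1 are single letters of [A] or [H]; commuting with both suffices, since
    their products span [E]. *)
Lemma total_central (M : lmodType k) (S : bimodule_on E M) (c : seq H -> seq A -> M) :
  (forall h a, (size h + size a = 1)%N -> total X S c h a = 0) <-> central S (c [::] [::]).
Proof.
have EA a : total X S c [::] [:: a] = lact S (iA a) (c [::] [::]) - ract S (iA a) (c [::] [::]).
  by rewrite /total /= mul1r inA1 lact1 subr0.
have EH h : total X S c [:: h] [::] = ract S (iH h) (c [::] [::]) - lact S (iH h) (c [::] [::]).
  by rewrite /total /= mul1r inA1 lact1 !subr0 addrC.
split=> [c0|cc [|h [|h' hs]] [|a [|a' t]] //= _]; last 2 first.
- by rewrite EA cc subrr.
- by rewrite EH cc subrr.
have ca a : lact S (iA a) (c [::] [::]) = ract S (iA a) (c [::] [::]).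
  by apply/eqP; rewrite -subr_eq0 -EA c0.
have ch h : lact S (iH h) (c [::] [::]) = ract S (iH h) (c [::] [::]).
  by apply/eqP; rewrite eq_sym -subr_eq0 -EH c0.
have L (T : {linear E -> {linear M -> M}}) : lin (fun e => T e (c [::] [::])) by move=> z x y; rewrite linearP.
move=> e; rewrite (eterms_sum X e) (lin_sum (L (lact S))) (lin_sum (L (ract S))); apply: eq_bigr => p _.
by rewrite lactM ch lact_ract ca ractM.
Qed.
End TotalFunctoriality.

Section HatFunctor.
Context (k : comPzRingType) (H : hopf_algebra k) (A : algebra k).
Context (act : {linear H -> {linear A -> A}}) (f : {linear tensor H H -> A}).
Context (Hact : weak_action act) (E : crossed_product act f).
Local Notation X := (cp_free Hact E).

Section Map.
Context (M M' : lmodType k) (u : {linear M -> M'}).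
Definition xmap_fun n (phi : xhat H A M n) : xhat H A M' n := fun s => u \o (phi s : {linear _ -> _}).
Fact xmap_linear n : linear (@xmap_fun n).
Proof.
move=> c x y; apply: functional_extensionality_dep => s; apply: linear_ext => t.
by rewrite /xmap_fun /= -linearP.
Qed.
HB.instance Definition _ n := GRing.isLinear.Build k (xhat H A M n) (xhat H A M' n) *:%R
  (@xmap_fun n) (@xmap_linear n).
Definition xmap n : {linear xhat H A M n -> xhat H A M' n} := @xmap_fun n.
Lemma fn_xmap n phi h a : fn (xmap n phi) h a = u (fn phi h a).
Proof. by []. Qed.
End Map.

Lemma fn_homogeneous (M : lmodType k) n (phi : xhat H A M n) : homogeneous n (fn phi).
Proof. by split; [exact: fn_ml2|exact: fn_nrm2|exact: fn_supp]. Qed.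
Lemma tw_homogeneous (M : lmodType k) n (c : seq H -> seq A -> M) : homogeneous n c -> homogeneous n (tw n c).
Proof. by move=> [m1 n1 s1]; split; [exact: tw_ml2|exact: tw_nrm2|exact: tw_supp]. Qed.
Lemma fn_surj (M : lmodType k) n (c : seq H -> seq A -> M) : homogeneous n c -> exists phi
  : xhat H A M n, fn phi = c.
Proof. by move=> [m1 n1 s1]; apply: fn_ex. Qed.

Definition xev (M : lmodType k) : {linear xhat H A M 0 -> M} := lin_pack (@fn_lin k H A M 0 [::] [::]).

Lemma xev_bij (M : lmodType k) : bijective (xev M).
Proof.
apply: inj_surj_bij => [x y xy|m]; last first.
  by have [phi E1] := fn_surj (homogeneous0 A H m); exists phi; rewrite /= E1.
by apply: fn_inj => -[|? ?] [|? ?].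
Qed.

Lemma xdiff0P (M : lmodType k) (S : bimodule_on E M) n (x : xhat H A M n) :
  xdiff Hact S n x = 0 <-> forall h a, (size h + size a)%N = n.+1 -> total X S (tw n (fn x)) h a = 0.
Proof.
have fn0 h a : fn (0 : xhat H A M n.+1) h a = 0 by exact: (lin0 (@fn_lin k H A M n.+1 h a)).
split=> [dx h a _|dx]; last by apply: fn_inj => h a s; rewrite xdiffE /tw dx // scaler0 fn0.
have : tw n.+1 (fn (xdiff Hact S n x)) h a = 0 by rewrite dx /tw fn0 scaler0.
by rewrite xdiffE twK.
Qed.

Lemma xmap_xdiff (M M' : lmodType k) (S : bimodule_on E M) (S' : bimodule_on E M') (u : {linear M -> M'}) n x :
  bimodule_hom S S' u -> xmap u n.+1 (xdiff Hact S n x) = xdiff Hact S' n (xmap u n x).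
Proof.
move=> hu; apply: fn_inj => h a _; rewrite fn_xmap !xdiffE /tw linearZ (total_map X _ _ _ hu).
by congr (_ *: _); apply: eq_total => v b _; rewrite linearZ.
Qed.

Lemma xacyclic (M : lmodType k) (S : bimodule_on E M) n (x : xhat H A (hom_mod E M) n.+1) :
  xdiff Hact (coind S) n.+1 x = 0 -> exists y, x = xdiff Hact (coind S) n y.
Proof.
move=> /xdiff0P dx.
have gx := tw_homogeneous (fn_homogeneous x).
have dc h a : total X (coind S) (tw n.+1 (fn x)) h a = 0.
  case: (eqVneq (size h + size a)%N n.+2) => s; first exact: dx.
  by apply: total_supp s; case: gx.
have [y gy yE] := total_acyclic gx dc; have [z zE] := fn_surj (tw_homogeneous gy).
exists z; apply: fn_inj => h a _; rewrite xdiffE zE twK -[in LHS](twK n.+1 (fn x)).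
by rewrite {1}/tw yE.
Qed.

Definition xhat_functor : coh_functor E.
Proof.
apply: (@CohFunctor k E (fun M n => xhat H A M n) (fun M S n => xdiff Hact S n) (fun M M' u n => xmap u n) xev).
- by move=> M S n x; apply: xdiffK.
- by move=> M u n x u1; apply: fn_inj => h a _; rewrite fn_xmap u1.
- by move=> M M' M'' u v w n x wE; apply: fn_inj => h a _; rewrite !fn_xmap wE.
- by move=> M M' u v w n x wE; apply: fn_inj => h a _; rewrite fn_xmap wE.
- exact: xmap_xdiff.
- exact: xacyclic.
- exact: xev_bij.
- by [].
- move=> M S x; rewrite xdiff0P total_central.
  by rewrite /tw /sg scale1r.
Defined.
End HatFunctor.

(** * The Hochschild complex as the case H = k *)

Section Trivial.
Context (k : comPzRingType) (E : algebra k).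

Definition base_algebra : algebra k :=
  @Algebra k k^o 1 *%R (@mulrA k) (@mul1r k) (@mulr1 k) (@mulrDl k) (@mulrDr k)
    (@mulrA k) (@mulrCA k).
Local Notation K := base_algebra.

Fact scalar_in_linear : lin (fun z : K => (z : k) *: (1 : E)).
Proof. by move=> c x y; rewrite scalerDl scalerA. Qed.
(** With [H] = k a normalized cochain vanishes on every nonempty word of [H], and [total] becomes
    the Hochschild differential of [E]; the results on free extensions thereby cover the Hochschild
    complex. *)
Definition trivial_extension : free_extension E K E.
Proof.
apply: (@FreeExtension k E K E (lin_pack (@lin_id k E)) (lin_pack scalar_in_linear) (fun e => [:: (e, 1)])).
- by [].
- exact: scale1r.
- by [].
- by move=> e; rewrite big_seq1 /= scale1r mulr1.
- by move=> P F L1 L2 c x y; rewrite !big_seq1 L1.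
- move=> P F L1 L2 a h; rewrite big_seq1 /= -algZr mulr1.
  rewrite (linZ (L1 1)) -(linZ (L2 a)); congr F; exact: mulr1.
Defined.
Local Notation X := trivial_extension.

Section OneModule.
Context (N : lmodType k) (S : bimodule_on E N).
Local Notation total := (total X S).
Implicit Types (c : seq K -> seq E -> N).

Lemma scalar_zero c x h a : ml2 c -> nrm2 c -> c (x :: h) a = 0.
Proof.
move=> mc nc; have -> : x = (x : k) *: (1 : K) by symmetry; apply: mulr1.
by rewrite (linZ (mlin_head h (mc.1 a))) (nc.1 a [::] h) scaler0.
Qed.

Lemma total_nil c a : total c [::] a = (if a is x :: a' then lact S x (c [::] a') else 0) + rbar X S (c [::]) a.
Proof.
by rewrite totalE /=; case: a => [|x a] //=; rewrite mul1r lact1.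
Qed.

Definition hfn n (psi : hochschild_cochains E N n) (h : seq K) (a : seq E) : N :=
  if h is [::] then psi (word n a) else 0.

Lemma hfn_homogeneous n (psi : hochschild_cochains E N n) : homogeneous n (hfn psi).
Proof.
split.
- split=> [b|[|z h]] u v x y z'; first by case: u => [|? ?] /=; rewrite scaler0 addr0.
    by rewrite /hfn (word_mlin _ u v) linearP.
  by rewrite scaler0 addr0.
- split=> [b|[|z h]] u v //; first by case: u.
  exact: (@word_nrm k E N n psi (linear_lin psi)).
- by move=> [|z h] a s //=; rewrite word_size ?linear0.
Qed.

Lemma hfn_surj n c : homogeneous n c -> exists psi : hochschild_cochains E N n, hfn psi = c.
Proof.
move=> [mc nc sc].
have cl : multilinear n (c [::]) by move=> u v x y z _; apply: mc.2.
have cn : normalized n (c [::]) by move=> u v _; apply: nc.2.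
have [psi psiE] := word_lift cl cn.
exists psi; apply: funext => -[|z h]; apply: funext => a; last exact/esym/scalar_zero.
case: (eqVneq (size a) n) => sa; first exact: psiE.
by rewrite /= word_size // linear0 (sc [::]).
Qed.

Lemma hfn_inj n (psi psi' : hochschild_cochains E N n) :
  (forall a, size a = n -> hfn psi [::] a = hfn psi' [::] a) -> psi = psi'.
Proof. by move=> E1; apply: word_ext => a sa; apply: E1. Qed.

Lemma hfn_diff n (psi : hochschild_cochains E N n) : hfn (hochschild_diff S n psi) = total (hfn psi).
Proof.
have [m1 n1 s1] := homogeneous_total X S (hfn_homogeneous psi).
apply: funext => -[|z h]; apply: funext => a; last exact/esym/(scalar_zero _ _ _ m1 n1).
case: (eqVneq (size a) n.+1) => sa; last by rewrite s1 // /hfn word_size // linear0.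
rewrite /hfn [hochschild_diff _ _ _]/= hochschild_funE // total_nil.
case: a sa => [//|x a] [sa]; rewrite rbar_sum /hochschild_formula big_ord_recl big_ord_recr.
rewrite /hochschild_face /= expr0 scale1r eqxx sa; congr (_ + (_ + _)).
by apply: eq_bigr => i _; rewrite /bump /= !add0n add1n eqSS ltn_eqF.
Qed.
Local Notation hdiff := (hochschild_diff S).

Lemma hochschild_diffK n x : hdiff n.+1 (hdiff n x) = 0.
Proof.
apply: hfn_inj => a _; rewrite !hfn_diff total_total ?linear0 //.
by case: (hfn_homogeneous x).
Qed.

Lemma hochschild_diff0P n x :
  hdiff n x = 0 <-> forall h a, (size h + size a)%N = n.+1 -> total (hfn x) h a = 0.
Proof.
split=> [dx h a _|dx]; first by rewrite -hfn_diff dx; case: h.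
by apply: hfn_inj => a sa; rewrite hfn_diff dx.
Qed.
End OneModule.

Section Map.
Context (M M' : lmodType k) (u : {linear M -> M'}).
Definition hmap_fun n (psi : hochschild_cochains E M n) : hochschild_cochains E M' n := u \o psi.
Fact hmap_linear n : lin (@hmap_fun n).
Proof. by move=> c x y; apply: linear_ext => t; rewrite /hmap_fun /= -linearP. Qed.
Definition hmap n : {linear hochschild_cochains E M n -> hochschild_cochains E M' n} := lin_pack
  (@hmap_linear n).
Lemma hfn_hmap n (psi : hochschild_cochains E M n) h a : hfn (hmap n psi) h a = u (hfn psi h a).
Proof. by case: h => //=; rewrite linear0. Qed.
End Map.

Definition hev (M : lmodType k) : {linear hochschild_cochains E M 0 -> M} :=
  lin_pack (fun c (x y : hochschild_cochains E M 0) =>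
    erefl : (c *: x + y : {linear _ -> _}) (word 0 [::]) = c *: x (word 0 [::]) + y (word 0 [::])).

Lemma hev_bij (M : lmodType k) : bijective (hev M).
Proof.
apply: inj_surj_bij => [x y xy|m]; first by apply: hfn_inj => -[].
have [psi E1] := hfn_surj (@homogeneous0 k E K M m); exists psi.
by rewrite -[LHS]/(hfn psi [::] [::]) E1.
Qed.

Lemma hochschild_acyclic (M : lmodType k) (S : bimodule_on E M) n (x
  : hochschild_cochains E (hom_mod E M) n.+1) :
  hochschild_diff (coind S) n.+1 x = 0 -> exists y, x = hochschild_diff (coind S) n y.
Proof.
move=> dx; have dc h a : total X (coind S) (hfn x) h a = 0 by rewrite -hfn_diff dx; case: h.
have [y gy yE] := total_acyclic (hfn_homogeneous x) dc; have [z zE] := hfn_surj gy.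
by exists z; apply: hfn_inj => a _; rewrite hfn_diff zE yE.
Qed.

Definition hochschild_functor : coh_functor E.
Proof.
apply: (@CohFunctor k E (fun M n => hochschild_cochains E M n) (fun M S n => hochschild_diff S n)
  (fun M M' u n => hmap u n) hev).
- by move=> M S n x; apply: hochschild_diffK.
- by move=> M u n x u1; apply: hfn_inj => a _; rewrite hfn_hmap u1.
- by move=> M M' M'' u v w n x wE; apply: hfn_inj => a _; rewrite !hfn_hmap wE.
- by move=> M M' u v w n x wE; apply: hfn_inj => a _; rewrite hfn_hmap wE.
- move=> M M' S S' u n x hu; apply: hfn_inj => a _; rewrite hfn_hmap !hfn_diff (total_map X _ _ _ hu).
  by apply: eq_total => v b _; rewrite hfn_hmap.
- exact: hochschild_acyclic.
- exact: hev_bij.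
- by [].
- by move=> M S x; rewrite hochschild_diff0P total_central.
Defined.
End Trivial.

(** * The spectral sequence *)

Section Convergence.
Context (k : comPzRingType) (X : filtered_complex k) (G : nat -> lmodType k).
Context (theta : forall n, {linear fc_cohomology X n -> G n}).
Hypothesis theta_bij : forall n, bijective (theta n).
Hypothesis fil_bounded : forall n x, fc_fil X n.+1 n x -> x = 0.

Lemma fil_zero i n x : (n < i)%N -> fc_fil X i n x -> x = 0.
Proof. by move=> ni Fx; apply: fil_bounded; apply: fc_fil_le Fx. Qed.

(** The filtration of the abutment is the image under [theta] of the one on the cohomology of the
    complex, so any isomorphism serves and [theta] need not be canonical. *)
Lemma bounded_converges : converges (filtration_spectral_sequence X)
  (fun s n => im_submod (theta n) (fc_cohomology_fil X s n)).
Proof.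
split.
- move=> n y; have [g _ gK] := theta_bij n; exists (g y); last by rewrite gK.
  by case: (sclass_surj (g y)) => x [Zx ->]; exists x, Zx; split=> //; apply: fc_fil0.
- move=> s n y [q [x [Zx [Fx ->]]] ->]; exists (sclass _ Zx) => //.
  by exists x, Zx; split=> //; apply: fc_filS.
- move=> n; exists n.+1 => y [q [x [Zx [Fx ->]]] ->].
  have -> : sclass (coboundaries (fc_diff X) n) Zx = 0.
    by apply/sclass_eq0; rewrite (fil_bounded Fx); apply: submod0.
  exact: linear0.
(* From this page on s + p > n + 1, so outgoing differentials land in F_(s+p) = 0 of degree n + 1,
   and p > s, so none arrives. *)
move=> s n; exists (n + s).+2 => p np; split.
- move=> x; case: (sclass_surj x) => {}x [Zx ->].
  change (@fc_page_diff k X p s n (sclass _ Zx) = 0); rewrite fc_page_diffE; apply/sclass_eq0.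
  by case: Zx => _ /fil_zero ->; [apply: submod0|lia].
- by move=> x [//|[s' [n' [es [en _]]]]]; exfalso; lia.
(* By truncated subtraction the boundaries in the denominator come from F_0, that is from the whole
   complex. *)
have sp : (s.+1 - p = 0)%N by lia.
have dz x : @fc_cycles k X p s n x -> ker_submod (fc_diff X n) x.
  by case=> _ /fil_zero; apply; lia.
apply: (subquot_rel_iso (R := fun x y => exists Zx : ker_submod (fc_diff X n) x,
  y = theta n (sclass (coboundaries (fc_diff X) n) Zx))).
- move=> c x y x' y' [Zx ->] [Zy ->]; exists (submodL c Zx Zy).
  by rewrite -linearP; congr (theta n _); symmetry; apply: sclassL.
- move=> x Zx; have Kx := dz x Zx; exists (theta n (sclass _ Kx)); last by exists Kx.
  by exists (sclass _ Kx) => //; exists x, Kx; split=> //; case: Zx.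
- move=> y [q [x [Kx [Fx ->]]] ->]; exists x; last by exists Kx.
  by split=> //=; rewrite (_ : fc_diff X n x = 0); [apply: submod0|exact: Kx].
move=> x y Zx _ [Kx ->]; split=> [[u [Fu Fdu] [v Bv xE]]|[q [u [Ku [Fu ->]]] E]].
  have Ku : ker_submod (fc_diff X n) u by move/fil_zero: Fdu; apply; lia.
  exists (sclass _ Ku); first by exists u, Ku.
  congr (theta n _); apply/sclass_eq; rewrite xE addrAC subrr add0r.
  by move: Bv; rewrite sp; case: (n) v {xE} => // m v [w _ ->]; exists w.
move/(bij_inj (theta_bij n))/sclass_eq: E => xu.
exists u; first by split=> //=; rewrite (_ : fc_diff X n u = 0); [apply: submod0|exact: Ku].
exists (x - u); last by rewrite addrC subrK.
rewrite sp; case: (n) x u xu {Zx Kx Ku Fu} => // m x u [w _ ->].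
by exists w => //; apply: fc_fil0.
Qed.
End Convergence.

(** * The first page as Hochschild cohomology of A *)

Section FirstPage.
Context (k : comPzRingType) (H : hopf_algebra k) (A : algebra k).
Context (act : {linear H -> {linear A -> A}}) (f : {linear tensor H H -> A}).
Context (Hact : weak_action act) (E : crossed_product act f).
Context (M : lmodType k) (S : bimodule_on E M).
Local Notation X := (cp_free Hact E).
Local Notation C s := (hom_mod (tpow (bar H) s) M).
Context (N : forall s, bimodule_on A (C s)).
Hypothesis NE : is_hom_bimodule S N.
Local Notation d := (xdiff Hact S).

Definition column s r (psi : hochschild_cochains A (C s) r) (h : seq H) (a : seq A) : M :=
  (psi (word r a) : C s) (word s h).

Lemma column_homogeneous r s (psi : hochschild_cochains A (C s) r) : homogeneous (r + s) (column psi).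
Proof.
split.
- split=> [b|h] u v c x y; rewrite /column (word_mlin _ u v) linearP //.
- split=> [b|h] u v.
    exact: (@word_nrm k H M s (psi (word r b)) (linear_lin (psi (word r b) : {linear _ -> _}))).
  have L : lin (fun t => (psi t : C s) (word s h)) by move=> c x y; rewrite linearP.
  exact: (word_nrm L).
move=> h a ha; rewrite /column; case: (eqVneq (size a) r) => sa; last by rewrite word_size // linear0.
by rewrite (word_size (w := h)) ?linear0 //; move: ha; rewrite sa addnC eqn_add2l.
Qed.
Lemma column0 s r (psi : hochschild_cochains A (C s) r) h a : size h != s -> column psi h a = 0.
Proof. by move=> sh; rewrite /column (word_size (w := h)) ?linear0. Qed.

Lemma column_inj s r (psi psi' : hochschild_cochains A (C s) r) :
  (forall h a, size h = s -> size a = r -> column psi h a = column psi' h a) -> psi = psi'.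
Proof. by move=> E1; apply: word_ext => a sa; apply: word_ext => h sh; apply: E1. Qed.

Lemma column_surj s r (c : seq H -> seq A -> M) : ml2 c -> nrm2 c ->
  exists psi : hochschild_cochains A (C s) r, forall h a, size h = s -> size a = r -> column psi h a = c h a.
Proof.
move=> mc nc.
have ex_h a : {L : C s | forall h, size h = s -> L (word s h) = c h a}.
  apply: cid; apply: word_lift => [u v x y z _|u v _]; first exact: (mc.1 a).
  exact: nc.1.
have g1 : multilinear r (fun a => sval (ex_h a)).
  move=> u v x y z _; apply: word_ext => h sh.
  rewrite -[RHS]/(x *: sval (ex_h (u ++ y :: v)) (word s h) + sval (ex_h (u ++ z :: v)) (word s h)).
  by rewrite !(svalP (ex_h _)) // mc.2.
have g2 : normalized r (fun a => sval (ex_h a)).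
  by move=> u v _; apply: word_ext => h sh; rewrite (svalP (ex_h _)) // nc.2.
have [psi psiE] := word_lift g1 g2.
by exists psi => h a sh sa; rewrite /column psiE // (svalP (ex_h a)).
Qed.

(** A relation and not a map: [x] may have components in higher filtration degrees, which E_1
    ignores. *)
Definition same_column s r (x : xhat H A M (r + s)) (psi : hochschild_cochains A (C s) r) :=
  forall h a, size h = s -> size a = r -> fn x h a = column psi h a.

(** By [total_lead] only dhat_0 reaches filtration degree s. The signs of [tw] before and after,
    together with the (-1)^s of [total_lead], multiply to 1, so the Hochschild differential appears
    without sign. *)
Lemma same_column_diff s r (x : xhat H A M (r + s)) (psi : hochschild_cochains A (C s) r) :
  xfil s (r + s) x -> same_column x psi -> @same_column s r.+1 (d (r + s) x) (hochschild_diff (N s) r psi).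
Proof.
move=> /xfil_fn Fx xpsi h a sh sa; rewrite xdiffE {1}/tw total_lead; last 2 first.
- exact/tw_ml2/fn_ml2.
- by move=> u b uh; rewrite /tw Fx ?scaler0 // -sh.
case: a sa => [//|y a] [sa].
rewrite /column -[hochschild_diff _ _ _ _]/(hfn (hochschild_diff (N s) r psi) [::] (y :: a)).
rewrite hfn_diff total_nil.
set z := word s h.
rewrite -[RHS]/((lact (N s) y (psi (word r a)) : C s) z + (rbar (trivial_extension A) (N s) (hfn psi
  [::]) (y :: a) : C s) z).
have [-> _] := NE y (psi (word r a)) sh.
have -> : (rbar (trivial_extension A) (N s) (hfn psi [::]) (y :: a) : C s) z = rbar X S (fn x h) (y :: a).
  pose ev : {linear C s -> M} := lin_pack (fun c (u v : C s) => erefl : (c *: u + v : C s) z = c *: u z + v z).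
  rewrite -[LHS]/(ev _) !rbar_sum linearD linear_sum; congr (_ + _).
    apply: eq_bigr => i _; rewrite linearZ; congr (_ *: _); rewrite xpsi //.
    by rewrite size_contract // [size _]/= ltnS ltn_ord.
  rewrite linearZ; congr (_ *: _).
  have [_ E1] := NE (inA (trivial_extension A) (y :: a)`_(size (y :: a)).-1) (hfn psi [::] (take (size
    (y :: a)).-1 (y :: a))) sh.
  rewrite -[LHS]/((ract (N s) _ _ : C s) z) E1 xpsi //.
  by rewrite size_take /= sa ltnSn.
rewrite sweedler2_s2 -scalerDr scalerA.
have sw : tw (r + s) (fn x) h = sg k (r + s) (size h) *: fn x h by [].
rewrite sw (linZ (@rbar_lin _ _ _ _ X _ S (y :: a))).
rewrite (@eq_s2 _ _ _ h _ (fun u v => sg k (r + s) (size h) *: lact S (inA X (act_bar act y u)) (fn x v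
  a))); last first.
  by move=> u v _ sv; rewrite /tw linearZ sv.
have -> : s2 h (fun u v => sg k (r + s) (size h) *: lact S (inA X (act_bar act y u)) (fn x v a)) =
    sg k (r + s) (size h) *: s2 h (fun u v => lact S (inA X (act_bar act y u)) (fn x v a)).
  by rewrite -(linZ (@s2_linF k H M h)).
rewrite -scalerDr scalerA /sg -!exprD sh (@sign_par k _ 0); last by rewrite -addSn !addnK mulSn; lia.
rewrite scale1r; congr (_ + _); apply: eq_s2 => u v _ sv; congr (lact S _ _).
by rewrite xpsi // sv.
Qed.

Lemma column_ex s r (psi : hochschild_cochains A (C s) r) :
  exists2 x : xhat H A M (r + s), xfil s (r + s) x & same_column x psi.
Proof.
have [x xE] := fn_surj (column_homogeneous psi); exists x; last by move=> h a _ _; rewrite xE.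
by apply/xfil_fn => h a hs; rewrite xE column0 // (ltn_eqF hs).
Qed.
Lemma column_of_ex s r (x : xhat H A M (r + s)) : exists psi : hochschild_cochains A (C s) r, same_column x psi.
Proof. by have [psi E1] := column_surj s r (fn_ml2 x) (fn_nrm2 x); exists psi => h a sh sa; rewrite E1. Qed.

Lemma xfilS s r (x : xhat H A M (r + s)) :
  xfil s (r + s) x -> (forall h a, size h = s -> size a = r -> fn x h a = 0) -> xfil s.+1 (r + s) x.
Proof.
move=> /xfil_fn Fx x0; apply/xfil_fn => h a; rewrite ltnS leq_eqVlt => /orP[/eqP sh|]; last exact: Fx.
case: (eqVneq (size a) r) => sa; first exact: x0.
by rewrite fn_supp // sh addnC eqn_add2r.
Qed.

Hypotheses (dK : forall n x, d n.+1 (d n x) = 0)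
  (dF : forall i n (x : xhat H A M n), xfil i n x -> xfil i n.+1 (d n x)).
Local Notation XC := (xhat_complex dK dF).

Lemma xfil_bounded n (x : xhat H A M n) : xfil n.+1 n x -> x = 0.
Proof. by move=> Fx; apply: functional_extensionality_dep => s; apply: Fx; apply: ltn_ord. Qed.

(** For r = 0 the boundaries come from F_s in total degree s - 1, which is 0; this matches the
    absence of coboundaries in H^0. *)
Lemma images0 s (v : XC s) : fc_images XC s s v -> v = 0.
Proof. by case: s v => [|s] v // [w /xfil_bounded -> ->]; rewrite linear0. Qed.

Lemma first_page s r :
  linear_iso (ss_page (filtration_spectral_sequence XC) 1 s (r + s)) (hochschild_cohomology (N s) r).
Proof.
have fnL (n : nat) (x y : xhat H A M n) h a : fn (x + y) h a = fn x h a + fn y h a := linD (@fn_lin k H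
  A M n h a) x y.
have fnB (n : nat) (x y : xhat H A M n) h a : fn (x - y) h a = fn x h a - fn y h a := linB (@fn_lin k H
  A M n h a) x y.
apply: (subquot_rel_iso (R := @same_column s r)).
- by move=> c x y x' y' E1 E2 h a sh sa; rewrite fn_lin E1 // E2.
- move=> x [Fx /xfil_fn Fdx]; have [psi xpsi] := column_of_ex x; exists psi => //.
  apply: column_inj => h a sh sa; rewrite -(same_column_diff Fx xpsi) //.
  rewrite Fdx ?addn1 ?sh //; by rewrite /column linear0.
- move=> psi dpsi; have [x Fx xpsi] := column_ex psi; exists x => //; split=> //.
  rewrite /= addn1; apply: (@xfilS s r.+1); first exact: dF.
  by move=> h a sh sa; rewrite (same_column_diff Fx xpsi) // /column (_ : hochschild_diff _ _ _ = 0).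
move=> x psi [Fx Fdx] _ xpsi; split.
- move=> [u [/xfil_fn Fu _] [v Bv xE]].
  have xv h a : size h = s -> fn x h a = fn v h a by move=> sh; rewrite xE fnL Fu ?sh ?add0r.
  move: Bv; rewrite subSS subn0 => Bv.
  case: r x psi Fx Fdx xpsi u Fu v Bv xE xv => [|r] x psi Fx Fdx xpsi u Fu v Bv xE xv.
    apply: column_inj => h a sh sa; rewrite -xpsi // xv // (images0 Bv).
    exact: (lin0 (@fn_lin k H A M (0 + s) h a)).
  case: Bv => w Fw vE; have [psi' wpsi] := column_of_ex w; exists psi' => //.
  apply: column_inj => h a sh sa.
  by rewrite -(same_column_diff Fw wpsi) // -xpsi // xv // vE.
case: r x psi Fx Fdx xpsi => [|r] x psi Fx Fdx xpsi psiE.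
  exists x; first split=> //.
    by apply: xfilS => // h a sh sa; rewrite xpsi // psiE.
  by exists 0; [exact: submod0|rewrite addr0].
case: psiE => psi' _ psiE; have [w Fw wpsi] := column_ex psi'.
have wE h a : size h = s -> size a = r.+1 -> fn (d (r + s) w) h a = fn x h a.
  by move=> sh sa; rewrite (same_column_diff Fw wpsi) // xpsi // psiE.
(* Subtracting d w removes the component of filtration degree s, so the rest lies in F_(s+1). *)
exists (x - d (r + s) w); last first.
  by exists (d (r + s) w); [exists w; rewrite // subSS subn0|rewrite subrK].
split; last by rewrite /= linearB dK subr0.
apply: (@xfilS s r.+1); first by apply: submodB => //; apply: dF.
by move=> h a sh sa; rewrite fnB wE // subrr.
Qed.
End FirstPage.

Theorem corollary2p2p2p1 (k : comPzRingType) (H : hopf_algebra k) (A : algebra k)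
    (act : {linear H -> {linear A -> A}}) (f : {linear tensor H H -> A})
    (Hact : weak_action act) (E : crossed_product act f)
    (M : lmodType k) (S : bimodule_on E M) :
  exists (d : forall n, {linear xhat H A M n -> xhat H A M n.+1})
         (dK : forall n x, d n.+1 (d n x) = 0)
         (dF : forall i n x, xfil i n x -> xfil i n.+1 (d n x))
         (N : forall s, bimodule_on A (hom_mod (tpow (bar H) s) M)),
    let X := filtration_spectral_sequence (xhat_complex dK dF) in
    [/\ is_dhat S d,
        is_hom_bimodule S N,
        forall r s : nat,
          linear_iso (ss_page X 1 s (r + s)) (hochschild_cohomology (N s) r)
      & exists2 theta : forall n,
          {linear fc_cohomology (xhat_complex dK dF) n -> hochschild_cohomology S n},
          forall n, bijective (theta n)
        & converges X (fun s n =>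
            im_submod (theta n) (fc_cohomology_fil (xhat_complex dK dF) s n))].
Proof.
have [N NE] := hom_bimodules_ex Hact S.
exists (xdiff Hact S), (xdiffK Hact S), (@xdiff_fil _ _ _ _ _ Hact E M S), N => X.
split=> //; first exact: xdiff_is_dhat.
  by move=> r s; apply: first_page.
pose iso n := cid (coh_functor_iso (xhat_functor Hact E) (hochschild_functor E) n S).
exists (fun n => sval (iso n)) => [n|]; first exact: (svalP (iso n)).
apply: bounded_converges => [n|n x]; first exact: (svalP (iso n)).
exact: xfil_bounded.
Qed.
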